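(* Let $f\in\mathcal{S}^{*}$. Then the following inequalities hold for all $q\in\mathbb{B}$: $$\frac{|q|}{(1+|q|)^{2}}\leq|f(q)|\leq\frac{|q|}{(1-|q|)^{2}};$$ $$\frac{1-|q|}{(1+|q|)^{3}}\leq|f'(q)|\leq\frac{1+|q|}{(1-|q|)^{3}};$$ $$\frac{1-|q|}{1+|q|}\leq\frac{|qf'(q)|}{|f(q)|}\leq\frac{1+|q|}{1-|q|}.$$ All of these estimates are sharp: for each point $q_0\in\mathbb{B}\setminus\{0\}$ and each of these inequalities, equality at $q_0$ occurs for the function $f(q)=q(1-qu)^{-\ast2}$, $q\in\mathbb{B}$, for some $u\in\partial\mathbb{B}$.
   Context: $\mathbb{H}$ denotes the quaternions, $\mathbb{B}=\{q\in\mathbb{H}:|q|<1\}$, $\mathbb{S}=\{q\in\mathbb{H}:q^2=-1\}$; for $I\in\mathbb{S}$, $\mathbb{C}_I=\mathbb{R}\oplus I\mathbb{R}$ and $\mathbb{B}_I=\mathbb{B}\cap\mathbb{C}_I$. A function $f:\mathbb{B}\to\mathbb{H}$ is (left) slice regular if for every $I\in\mathbb{S}$ the restriction $f_I=f|_{\mathbb{B}_I}$ has continuous partial derivatives and $\frac12\left(\frac{\partial}{\partial x}+I\frac{\partial}{\partial y}\right)f_I(x+yI)=0$ on $\mathbb{B}_I$; equivalently $f(q)=\sum_{n\ge0}q^na_n$ on $\mathbb{B}$ with $a_n\in\mathbb{H}$. Its slice derivative is $f'(x+yI)=\frac12\left(\frac{\partial}{\partial x}-I\frac{\partial}{\partial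 y}\right)f_I(x+yI)$, i.e. $f'(q)=\sum_{n\ge1}q^{n-1}na_n$. For slice regular $f=\sum q^na_n$, $g=\sum q^nb_n$ on $\mathbb{B}$: the regular product is $f\ast g(q)=\sum_n q^n\sum_{k=0}^n a_kb_{n-k}$; the regular conjugate is $f^c(q)=\sum q^n\overline{a_n}$; the symmetrization is $f^s=f\ast f^c$; the regular reciprocal is $f^{-\ast}(q)=f^s(q)^{-1}f^c(q)$ off the zero set of $f^s$. $(1-qu)^{-\ast2}$ denotes $(1-qu)^{-\ast}\ast(1-qu)^{-\ast}$, so that $q(1-qu)^{-\ast2}=\sum_{n\ge1}n\,q^nu^{n-1}$. $\mathcal{S}$ is the set of slice regular $f:\mathbb{B}\to\mathbb{H}$ whose zero set is $\mathcal{Z}_f=\{0\}$ and with $f'(0)=1$. The class of slice starlike functions $\mathcal{S}^{*}$ is the set of $f\in\mathcal{S}$ such that $\mathrm{Re}\big(f(q)^{-1}qf'(q)\big)>0$ for $q\in\mathbb{B}$ (pointwise products). At $q=0$ the expressions $f(q)^{-1}qf'(q)$ and $|qf'(q)|/|f(q)|$ are understood as their limit value $1$. *)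

(* Defs.v *)
From Stdlib Require Import Reals ClassicalEpsilon.
From Coquelicot Require Import Coquelicot.

Open Scope R_scope.

(** * Quaternions *)

(* (((a, b), c), d) stands for a + b i + c j + d k.  As an iterated product of
   copies of R, the type inherits Coquelicot's real normed module structure,
   whose norm is the Euclidean one. *)
Definition quat : Type := (R * R * R * R)%type.

Canonical quat_UniformSpace : UniformSpace :=
  UniformSpace.Pack quat (UniformSpace.class
    (prod_UniformSpace (prod_UniformSpace
      (prod_UniformSpace R_UniformSpace R_UniformSpace)
      R_UniformSpace) R_UniformSpace)) quat.

Canonical quat_NormedModule : NormedModule R_AbsRing :=
  NormedModule.Pack R_AbsRing quat (NormedModule.class R_AbsRing
    (prod_NormedModule R_AbsRing (prod_NormedModule R_AbsRing
      (prod_NormedModule R_AbsRing R_NormedModule R_NormedModule)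
      R_NormedModule) R_NormedModule)) quat.

Definition mkquat (a b c d : R) : quat := (a, b, c, d).
Definition qre (q : quat) : R := fst (fst (fst q)).
Definition qim_i (q : quat) : R := snd (fst (fst q)).
Definition qim_j (q : quat) : R := snd (fst q).
Definition qim_k (q : quat) : R := snd q.

Definition qreal (a : R) : quat := mkquat a 0 0 0.

Definition qadd (p q : quat) : quat :=
  mkquat (qre p + qre q) (qim_i p + qim_i q)
         (qim_j p + qim_j q) (qim_k p + qim_k q).
Definition qopp (q : quat) : quat :=
  mkquat (- qre q) (- qim_i q) (- qim_j q) (- qim_k q).
Definition qsub (p q : quat) : quat := qadd p (qopp q).
Definition qmul (p q : quat) : quat :=
  mkquat
    (qre p * qre q - qim_i p * qim_i q - qim_j p * qim_j q - qim_k p * qim_k q)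
    (qre p * qim_i q + qim_i p * qre q + qim_j p * qim_k q - qim_k p * qim_j q)
    (qre p * qim_j q - qim_i p * qim_k q + qim_j p * qre q + qim_k p * qim_i q)
    (qre p * qim_k q + qim_i p * qim_j q - qim_j p * qim_i q + qim_k p * qre q).
Definition qconj (q : quat) : quat :=
  mkquat (qre q) (- qim_i q) (- qim_j q) (- qim_k q).
Definition qnorm (q : quat) : R :=
  sqrt (qre q ^ 2 + qim_i q ^ 2 + qim_j q ^ 2 + qim_k q ^ 2).

Declare Scope quat_scope.
Delimit Scope quat_scope with H.
Bind Scope quat_scope with quat.
Infix "+" := qadd : quat_scope.
Infix "-" := qsub : quat_scope.
Infix "*" := qmul : quat_scope.
Notation "0" := (qreal 0) : quat_scope.
Notation "1" := (qreal 1) : quat_scope.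

Definition qinv (q : quat) : quat := (qreal (/ (qnorm q ^ 2)) * qconj q)%H.

Fixpoint qpow (q : quat) (n : nat) : quat :=
  match n with
  | O => 1%H
  | S m => (q * qpow q m)%H
  end.

Definition in_ball (q : quat) : Prop := qnorm q < 1.
Definition in_sphere (u : quat) : Prop := qnorm u = 1.
Definition imag_unit (I : quat) : Prop := (I * I)%H = qreal (-1).

(** * Slice regularity *)

(* Functions on the unit ball are represented by total functions on [quat];
   only their values on the ball matter. *)

Definition slice_pt (I : quat) (x y : R) : quat := (qreal x + qreal y * I)%H.

(* Derivative of a curve, meaningful when [ex_derive g t]. *)
Definition qDerive (g : R -> quat) (t : R) : quat :=
  mkquat (Derive (fun s => qre (g s)) t) (Derive (fun s => qim_i (g s)) t)
         (Derive (fun s => qim_j (g s)) t) (Derive (fun s => qim_k (g s)) t).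

Definition partial_x (f : quat -> quat) (I : quat) (x y : R) : quat :=
  qDerive (fun t => f (slice_pt I t y)) x.
Definition partial_y (f : quat -> quat) (I : quat) (x y : R) : quat :=
  qDerive (fun t => f (slice_pt I x t)) y.

Definition slice_regular (f : quat -> quat) : Prop :=
  forall (I : quat) (x y : R), imag_unit I -> in_ball (slice_pt I x y) ->
    ex_derive (fun t => f (slice_pt I t y)) x /\
    ex_derive (fun t => f (slice_pt I x t)) y /\
    continuous (fun p : R * R => partial_x f I (fst p) (snd p)) (x, y) /\
    continuous (fun p : R * R => partial_y f I (fst p) (snd p)) (x, y) /\
    (qreal (1 / 2) * (partial_x f I x y + I * partial_y f I x y) = 0)%H.

Definition qimag (q : quat) : quat := mkquat 0 (qim_i q) (qim_j q) (qim_k q).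

(* The I in the decomposition q = x + y I with y = |Im q|.  For real q any
   imaginary unit may be used: for slice regular f the slice derivative at q
   then equals the x-partial derivative, whatever the choice. *)
Definition slice_unit (q : quat) : quat :=
  if excluded_middle_informative (qimag q = 0%H) then mkquat 0 1 0 0
  else (qreal (/ qnorm (qimag q)) * qimag q)%H.

Definition slice_derivative (f : quat -> quat) (q : quat) : quat :=
  let I := slice_unit q in
  let x := qre q in
  let y := qnorm (qimag q) in
  (qreal (1 / 2) * (partial_x f I x y - I * partial_y f I x y))%H.

(** * Regular product and reciprocal *)

(* f(q) = sum_n q^n a_n on the unit ball. *)
Definition expands (f : quat -> quat) (a : nat -> quat) : Prop :=
  forall q : quat, in_ball q ->
    is_series (fun n => qpow q n * a n)%H (f q).

(* The power series coefficients of f, unique if they exist. *)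
Definition coeffs (f : quat -> quat) : nat -> quat :=
  epsilon (inhabits (fun _ : nat => 0%H)) (expands f).

(* Sum of a quaternionic series, meaningful when [ex_series c]. *)
Definition qSeries (c : nat -> quat) : quat :=
  mkquat (Series (fun n => qre (c n))) (Series (fun n => qim_i (c n)))
         (Series (fun n => qim_j (c n))) (Series (fun n => qim_k (c n))).

Definition power_sum (a : nat -> quat) (q : quat) : quat :=
  qSeries (fun n => qpow q n * a n)%H.

Fixpoint qsum (c : nat -> quat) (n : nat) : quat :=
  match n with
  | O => c O
  | S m => (qsum c m + c (S m))%H
  end.

Definition regular_mul (f g : quat -> quat) : quat -> quat :=
  power_sum (fun n => qsum (fun k => coeffs f k * coeffs g (n - k)%nat)%H n).

Definition regular_conj (f : quat -> quat) : quat -> quat :=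
  power_sum (fun n => qconj (coeffs f n)).

Definition symmetrization (f : quat -> quat) : quat -> quat :=
  regular_mul f (regular_conj f).

Definition regular_inv (f : quat -> quat) (q : quat) : quat :=
  (qinv (symmetrization f q) * regular_conj f q)%H.

(** * Slice starlike functions *)

Definition class_S (f : quat -> quat) : Prop :=
  slice_regular f /\
  (forall q : quat, in_ball q -> (f q = 0%H <-> q = 0%H)) /\
  slice_derivative f 0%H = 1%H.

(* f(q)^{-1} q f'(q) and |q f'(q)| / |f(q)|, with their limit value at 0. *)
Definition log_quotient (f : quat -> quat) (q : quat) : quat :=
  if excluded_middle_informative (q = 0%H) then 1%H
  else (qinv (f q) * q * slice_derivative f q)%H.

Definition abs_quotient (f : quat -> quat) (q : quat) : R :=
  if excluded_middle_informative (q = 0%H) then 1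
  else qnorm (q * slice_derivative f q)%H / qnorm (f q).

Definition slice_starlike (f : quat -> quat) : Prop :=
  class_S f /\ forall q : quat, in_ball q -> 0 < qre (log_quotient f q).

(* q (1 - q u)^{-*2} *)
Definition koebe (u q : quat) : quat :=
  let r := regular_inv (fun p => 1 - p * u)%H in
  (q * regular_mul r r q)%H.

(* Main.v *)
(** With [f(q) = q H(q)] and [f' = P], starlikeness means [|P - H| < |P + H|] on the ball, where
[P - H = q C] and [C], [B = P + H] are again power series with coefficients on the right.  A Schwarz
lemma improves this to [|P - H| <= |q| |P + H|].  Writing a point as [q = l^-1 z l] with [z] complex,
[l B(q)] and [l C(q)] are row vectors in [C^2], linear in [l] through 2x2 matrices holomorphic in [z];
the hypothesis says that the first matrix is invertible and that [z] times the quotient matrix is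
contracting for every [z], so the maximum principle, applied to a scalar coefficient of the quotient,
gives [|C| <= |B|].  The disc inequality bounds [|P| / |H|] and [Re (f^-1 q f')], and the latter is
the logarithmic radial derivative of [|f|], whence the growth bounds.

Power series come from Cauchy's formula on each slice: the integral over [t] of
[k(t) u(z + s (r e^(it) - z))] with the Cauchy kernel [k] does not depend on [s]. *)

(* Products are pointwise and do not commute, so [f^-1 q f'] need not be slice regular and the
   one-variable Schwarz lemma cannot be applied to it. The disc form contains no inverse: both of
   its sides are norms of power series, and norms are multiplicative, so both may be multiplied on
   the left by any [l]. With [z] fixed and [l] arbitrary, the points [rot l z] supply every row
   vector of C^2, and a bound at the points of a sphere becomes a bound on an operator depending
   holomorphically on [z]. Expansions are first found slice by slice and on smaller discs. All
   slices share the real axis, which determines the coefficients, so a single sequence serves the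
   whole ball. The exponent 2 in the growth bounds comes from integrating 2/(1 - t) and -2/(1 + t),
   the extreme values of the logarithmic derivative of |H| along a ray. For sharpness, [u] is chosen
   with [q u] real. Then [u] commutes with [q], and the recursions for the sums with coefficients
   u^n, (n + 1) u^n and (n + 1)^2 u^n become scalar equations. *)
Require Import Defs.
From Stdlib Require Import Reals Lra Lia Psatz ClassicalEpsilon.
From Coquelicot Require Import Coquelicot.
Open Scope R_scope.

(** * Complex derivatives *)

(* [ring] and [field] only recognise [C] under that name, not as the carrier of [C_AbsRing]. *)
Ltac as_C := match goal with |- @eq _ ?a ?b => change (@eq C a b) end.
Ltac as_R := match goal with |- @eq _ ?a ?b => change (@eq R a b) end.

Notation CU := (AbsRing_UniformSpace C_AbsRing).
Notation CV := (AbsRing_NormedModule C_AbsRing).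

Definition Cderive (u : C -> C) (z d : C) : Prop :=
  is_derive (K := C_AbsRing) (V := CV) u z d.

Definition Ccont {T : UniformSpace} (g : T -> C) (x : T) : Prop :=
  continuous (U := CU) g x.

Lemma Ccont_eps {T : UniformSpace} (g : T -> C) (x : T) :
  Ccont g x <-> forall eps : posreal, locally x (fun y => Cmod (g y - g x) < eps).
Proof.
split.
- intros H eps. apply (H (fun w => Cmod (w - g x) < eps)). now exists eps.
- intros H P [eps HP]. unfold filtermap.
  generalize (H eps). apply filter_imp. intros y Hy. apply HP. exact Hy.
Qed.

Lemma le_of_sq_le (a b : R) : 0 <= b -> a ^ 2 <= b ^ 2 -> a <= b.
Proof. intros Hb H. nra. Qed.

Lemma Cmod_le_sum (z : C) : Cmod z <= Rabs (Re z) + Rabs (Im z).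
Proof.
unfold Cmod. apply Rsqr_incr_0_var.
- rewrite Rsqr_sqrt by nra. fold (Re z) (Im z). unfold Rsqr.
  rewrite <- (pow2_abs (Re z)), <- (pow2_abs (Im z)).
  generalize (Rabs_pos (Re z)) (Rabs_pos (Im z)); nra.
- generalize (Rabs_pos (Re z)) (Rabs_pos (Im z)); lra.
Qed.

Lemma Ccont_pair {T : UniformSpace} (a b : T -> R) (x : T) :
  continuous a x -> continuous b x -> Ccont (fun t => (a t, b t)) x.
Proof.
intros Ha Hb. apply Ccont_eps. intros eps.
assert (He : 0 < eps / 2) by (destruct eps; simpl; lra).
assert (La : locally x (fun y => Rabs (a y - a x) < eps / 2)).
{ apply (Ha (fun w => Rabs (w - a x) < eps / 2)). now exists (mkposreal _ He). }
assert (Lb : locally x (fun y => Rabs (b y - b x) < eps / 2)).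
{ apply (Hb (fun w => Rabs (w - b x) < eps / 2)). now exists (mkposreal _ He). }
generalize (filter_and _ _ La Lb). apply filter_imp. intros y [H1 H2].
eapply Rle_lt_trans; [apply Cmod_le_sum|]. simpl.
unfold Rminus in H1, H2. lra.
Qed.

Lemma Re_le_Cmod (z : C) : Rabs (Re z) <= Cmod z.
Proof. eapply Rle_trans; [|apply (Rmax_Cmod z)]. apply Rmax_l. Qed.

Lemma Im_le_Cmod (z : C) : Rabs (Im z) <= Cmod z.
Proof. eapply Rle_trans; [|apply (Rmax_Cmod z)]. apply Rmax_r. Qed.

Lemma continuous_Re {T : UniformSpace} (g : T -> C) (x : T) :
  Ccont g x -> continuous (fun t => Re (g t)) x.
Proof.
intros H P [eps HP]. unfold filtermap. generalize (proj1 (Ccont_eps g x) H eps).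
apply filter_imp. intros y Hy. apply HP.
eapply Rle_lt_trans; [|exact Hy].
apply (Re_le_Cmod (g y - g x)).
Qed.

Lemma continuous_Im {T : UniformSpace} (g : T -> C) (x : T) :
  Ccont g x -> continuous (fun t => Im (g t)) x.
Proof.
intros H P [eps HP]. unfold filtermap. generalize (proj1 (Ccont_eps g x) H eps).
apply filter_imp. intros y Hy. apply HP.
eapply Rle_lt_trans; [|exact Hy].
apply (Im_le_Cmod (g y - g x)).
Qed.

Lemma Ccont_plus {T : UniformSpace} (f g : T -> C) (x : T) :
  Ccont f x -> Ccont g x -> Ccont (fun t => f t + g t)%C x.
Proof. apply (continuous_plus (V := CV)). Qed.

Lemma Ccont_mult {T : UniformSpace} (f g : T -> C) (x : T) :
  Ccont f x -> Ccont g x -> Ccont (fun t => f t * g t)%C x.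
Proof. apply (continuous_mult (K := C_AbsRing)). Qed.

Lemma Ccont_const {T : UniformSpace} (c : C) (x : T) : Ccont (fun _ => c) x.
Proof. apply continuous_const. Qed.

Lemma Cderive_eps (u : C -> C) (z d : C) :
  Cderive u z d <->
  forall eps : posreal, exists delta : posreal, forall w,
    Cmod (w - z) < delta -> Cmod (u w - u z - d * (w - z)) <= eps * Cmod (w - z).
Proof.
split.
- intros [_ H] eps.
  destruct (H z (fun P H => H) eps) as [delta Hd].
  exists delta. intros w Hw. specialize (Hd w Hw).
  eapply Rle_trans; [|exact Hd]. apply Req_le.
  change (Cmod (u w - u z - d * (w - z)) = Cmod (u w - u z - (w - z) * d))%C.
  f_equal. ring.
- intros H. split; [apply is_linear_scal_l|].
  intros x Hx eps.
  assert (E : x = z). { symmetry. exact (is_filter_lim_locally_unique (V:=CV) z x Hx). } subst x.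
  destruct (H eps) as [delta Hd]. exists delta. intros w Hw.
  eapply Rle_trans; [|exact (Hd w Hw)]. apply Req_le.
  change (Cmod (u w - u z - (w - z) * d) = Cmod (u w - u z - d * (w - z)))%C.
  f_equal. ring.
Qed.

Lemma Cderive_const (c z : C) : Cderive (fun _ => c) z 0.
Proof. apply (is_derive_const (K := C_AbsRing) (V := CV)). Qed.

Lemma Cderive_id (z : C) : Cderive (fun w => w) z 1.
Proof. apply (is_derive_id (K := C_AbsRing)). Qed.

Lemma Cderive_plus (u v : C -> C) (z d e : C) :
  Cderive u z d -> Cderive v z e -> Cderive (fun w => u w + v w)%C z (d + e).
Proof. apply (is_derive_plus (K := C_AbsRing) (V := CV)). Qed.

Lemma Cderive_mult (u v : C -> C) (z d e : C) :
  Cderive u z d -> Cderive v z e ->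
  Cderive (fun w => u w * v w)%C z (d * v z + u z * e).
Proof.
intros H1 H2. apply (is_derive_mult (K := C_AbsRing)); try assumption. exact Cmult_comm.
Qed.

Lemma Cderive_cont (u : C -> C) (z d : C) : Cderive u z d -> Ccont (T := CU) u z.
Proof.
intros H. apply (ex_derive_continuous (K:=C_AbsRing) (V:=CV)). now exists d.
Qed.

Lemma Cderive_inv (z : C) : z <> 0 -> Cderive Cinv z (- / (z * z)).
Proof.
intros Hz. apply Cderive_eps. intros eps.
assert (Pz : 0 < Cmod z) by now apply Cmod_gt_0.
(* The first bound keeps |w| >= |z|/2. The error is |w - z|^2 / (|w| |z|^2), hence at most 2 |w -
   z|^2 / |z|^3, and the second bound brings this below eps |w - z|. *)
assert (Pd : 0 < Rmin (Cmod z / 2) (eps * Cmod z ^ 3 / 2)).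
{ apply Rmin_glb_lt; [lra|]. assert (0 < Cmod z ^ 3) by now apply pow_lt.
  destruct eps as [e He]; simpl in *. apply Rdiv_lt_0_compat; [|lra]. now apply Rmult_lt_0_compat. }
exists (mkposreal _ Pd). simpl. intros w Hw.
assert (H1 := Rlt_le_trans _ _ _ Hw (Rmin_l _ _)).
assert (H2 := Rlt_le_trans _ _ _ Hw (Rmin_r _ _)).
assert (Hwz : Cmod z / 2 <= Cmod w).
{ assert (Cmod z <= Cmod (z - w) + Cmod w).
  { replace z with ((z - w) + w)%C at 1 by ring. apply Cmod_triangle. }
  replace (z - w)%C with (- (w - z))%C in H by ring. rewrite Cmod_opp in H. lra. }
assert (Hw0 : w <> 0). { intros E. rewrite E, Cmod_0 in Hwz. lra. }
assert (Pw : 0 < Cmod w) by now apply Cmod_gt_0.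
replace (/ w - / z - - / (z * z) * (w - z))%C with ((w - z) * (w - z) * / (w * (z * z)))%C
  by (field; split; assumption).
rewrite !Cmod_mult, Cmod_inv, !Cmod_mult by (repeat apply Cmult_neq_0; assumption).
rewrite (Rmult_comm eps), Rmult_assoc.
apply Rmult_le_compat_l; [apply Cmod_ge_0|].
apply Rle_trans with (eps * Cmod z ^ 3 / 2 * / (Cmod z / 2 * (Cmod z * Cmod z))).
- apply Rmult_le_compat; try (apply Cmod_ge_0); try lra.
  + apply Rlt_le, Rinv_0_lt_compat. repeat apply Rmult_lt_0_compat; assumption.
  + apply Rinv_le_contravar. repeat apply Rmult_lt_0_compat; lra.
    apply Rmult_le_compat_r; [|assumption]. nra.
- apply Req_le. field. lra.
Qed.

Lemma Cderive_comp (u v : C -> C) (z d e : C) :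
  Cderive u (v z) d -> Cderive v z e -> Cderive (fun w => u (v w)) z (e * d).
Proof. intros H1 H2. exact (is_derive_comp (K:=C_AbsRing) (V:=CV) u v z d e H1 H2). Qed.

(** The Cauchy-Riemann equations: u_x = d and u_y = i d, so the partial derivatives of Re u are Re d
    and Re (i d) = - Im d. *)
Lemma Cderive_differentiable_Re (u : C -> C) (x y : R) (d : C) :
  Cderive u (x, y) d ->
  differentiable_pt_lim (fun a b => Re (u (a, b))) x y (Re d) (- Im d).
Proof.
intros H eps.
assert (He : 0 < eps / 2) by (destruct eps; simpl; lra).
destruct (proj1 (Cderive_eps _ _ _) H (mkposreal _ He)) as [delta Hd].
assert (Pd : 0 < delta / 2) by (destruct delta; simpl; lra).
exists (mkposreal _ Pd). simpl. intros a b Ha Hb.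
assert (Hm : Cmod ((a, b) - (x, y)) <= 2 * Rmax (Rabs (a - x)) (Rabs (b - y))).
{ eapply Rle_trans; [apply Cmod_2Rmax|]. simpl.
  apply Rmult_le_compat_r. eapply Rle_trans; [apply Rabs_pos|apply Rmax_l].
  apply Rlt_le, sqrt_less; lra. }
assert (Hl : Cmod ((a, b) - (x, y)) < delta).
{ eapply Rle_lt_trans; [exact Hm|].
  assert (Rmax (Rabs (a - x)) (Rabs (b - y)) < delta / 2) by now apply Rmax_lub_lt. lra. }
specialize (Hd _ Hl). simpl in Hd.
eapply Rle_trans; [|apply Rle_trans with (1 := Hd)].
- eapply Rle_trans; [|apply Re_le_Cmod]. apply Req_le. f_equal.
  unfold Re, Im; simpl. ring.
- apply Rle_trans with (eps / 2 * (2 * Rmax (Rabs (a - x)) (Rabs (b - y)))).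
  + apply Rmult_le_compat_l; lra.
  + apply Req_le. field.
Qed.

(** The factor [c] makes a statement about real parts serve everywhere: [c = - Ci] yields imaginary
    parts, and in the homotopy [c] carries the kernel or the factor of a primitive. *)
Lemma Cderive_curve (u : C -> C) (g : R -> C) (t : R) (c d v : C) :
  Cderive u (g t) d ->
  is_derive (fun s => Re (g s)) t (Re v) -> is_derive (fun s => Im (g s)) t (Im v) ->
  is_derive (fun s => Re (c * u (g s))) t (Re (c * d * v)).
Proof.
intros H H1 H2.
assert (Hc : Cderive (fun w => c * u w)%C (Re (g t), Im (g t)) (c * d)).
{ change (Re (g t), Im (g t)) with (fst (g t), snd (g t)). rewrite <- (surjective_pairing (g t)).
  replace (c * d)%C with (0 * u (g t) + c * d)%C by ring.
  apply (Cderive_mult (fun _ => c) u). apply Cderive_const. assumption. }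
apply Cderive_differentiable_Re in Hc.
apply is_derive_Reals in H1. apply is_derive_Reals in H2.
generalize (derivable_pt_lim_comp_2d _ _ _ _ _ _ _ _ Hc H1 H2). intros H3.
apply is_derive_Reals in H3.
replace (Re (c * d * v)) with (Re (c * d) * Re v + - Im (c * d) * Im v) by (unfold Re, Im; simpl; ring).
apply (is_derive_ext (fun t : R => Re (c * u (Re (g t), Im (g t))))); [|exact H3].
intros s. unfold Re at 2, Im. now rewrite <- (surjective_pairing (g s)).
Qed.

(** * Cauchy's formula *)

(** The derivative is named and required to be continuous; continuity is what allows differentiation
    under the integral in the proof of Cauchy's formula, in place of Goursat's argument. *)
Definition Chol (u u' : C -> C) : Prop :=
  forall z, Cmod z < 1 -> Cderive u z (u' z) /\ Ccont (T := CU) u' z.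

Definition circ (r t : R) : C := (r * cos t, r * sin t).

Lemma Cmod_circ (r t : R) : 0 <= r -> Cmod (circ r t) = r.
Proof.
intros Hr. unfold Cmod, circ; simpl.
replace (_ + _) with (Rsqr r * (Rsqr (sin t) + Rsqr (cos t))) by (unfold Rsqr; ring).
rewrite sin2_cos2, Rmult_1_r. now apply sqrt_Rsqr.
Qed.

Lemma Ccont_circ {T : UniformSpace} (r : R) (f : T -> R) (x : T) :
  continuous f x -> Ccont (fun y => circ r (f y)) x.
Proof.
intros H. apply Ccont_pair; apply (continuous_mult (K := R_AbsRing)); try apply continuous_const.
- apply (continuous_comp f cos); [assumption|apply continuous_cos].
- apply (continuous_comp f sin); [assumption|apply continuous_sin].
Qed.

Lemma Ccont_comp {T : UniformSpace} (u : C -> C) (g : T -> C) (x : T) :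
  Ccont g x -> Ccont (T := CU) u (g x) -> Ccont (fun y => u (g y)) x.
Proof. apply (continuous_comp (V := CU) (W := CU)). Qed.

Lemma Cmod_segment (z w : C) (t r : R) :
  0 <= t <= 1 -> Cmod z <= r -> Cmod w <= r -> Cmod (z + t * (w - z)) <= r.
Proof.
intros Ht Hz Hw.
replace (z + t * (w - z))%C with ((1 - t)%R * z + t * w)%C
  by (rewrite RtoC_minus; ring).
eapply Rle_trans; [apply Cmod_triangle|].
rewrite !Cmod_mult, !Cmod_R, !Rabs_pos_eq by lra. nra.
Qed.

Section Homotopy.

Variables (u u' : C -> C) (z : C) (r : R) (k : R -> C).
Hypothesis Hu : Chol u u'.
Hypothesis Hr : 0 < r < 1.
Hypothesis Hz : Cmod z < r.
Hypothesis Hk : forall t, Ccont k t.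
Hypothesis Hkz : forall t, (k t * (circ r t - z) = circ r t)%C.

Let g (s t : R) : C := (z + s * (circ r t - z))%C.

(** The parameter runs over slightly more than [0, 1], so that the end points 0 and 1 also have
    neighbourhoods on which the curve stays in the unit disc. *)
Lemma homotopy_ball (s t : R) : - ((1 - r) / 2) < s < 1 + (1 - r) / 2 -> Cmod (g s t) < 1.
Proof.
intros Hs.
assert (Hc : Cmod (circ r t) = r) by (apply Cmod_circ; lra).
(* [s'] is [s] clamped to [0, 1]. On the segment the modulus is at most r, and the excess (1 - r)/2
   moves the point by at most r (1 - r), leaving 2 r - r^2 < 1. *)
set (s' := Rmax 0 (Rmin 1 s)).
assert (Hs' : 0 <= s' <= 1 /\ Rabs (s - s') < (1 - r) / 2).
{ unfold s', Rmax, Rmin. repeat destruct Rle_dec; unfold Rabs; destruct Rcase_abs; lra. }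
replace (g s t) with (g s' t + (s - s')%R * (circ r t - z))%C
  by (unfold g; rewrite RtoC_minus; ring).
eapply Rle_lt_trans; [apply Cmod_triangle|].
assert (Cmod (g s' t) <= r) by (apply Cmod_segment; lra).
assert (Cmod (circ r t - z) <= 2 * r).
{ unfold Cminus. eapply Rle_trans; [apply Cmod_triangle|]. rewrite Cmod_opp. lra. }
rewrite Cmod_mult, Cmod_R.
assert (Rabs (s - s') * Cmod (circ r t - z) <= (1 - r) / 2 * (2 * r)).
{ apply Rmult_le_compat; try lra. apply Rabs_pos. apply Cmod_ge_0. }
nra.
Qed.

Lemma Ccont_homotopy (p : R * R) : Ccont (fun p : R * R => g (fst p) (snd p)) p.
Proof.
apply Ccont_plus; [apply Ccont_const|]. apply Ccont_mult.
- apply Ccont_pair; [apply continuous_fst|apply continuous_const].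
- apply Ccont_plus; [|apply Ccont_const]. apply Ccont_circ, continuous_snd.
Qed.

Lemma Ccont_slice (h : R * R -> C) (s t : R) :
  Ccont h (s, t) -> Ccont (fun t => h (s, t)) t.
Proof.
intros H. apply (continuous_comp (fun t : R => (s, t) : prod_UniformSpace R_UniformSpace R_UniformSpace) (h : _ -> CU)); [|exact H].
apply continuous_comp_2; [apply continuous_const|apply continuous_id|].
apply (continuous_ext (fun x => x)). intros [a b]; reflexivity. apply continuous_id.
Qed.

(** Differentiation produces the factor [circ r t - z], which the kernel turns into [circ r t]: no
    denominator is left. *)
Lemma homotopy_derive_s (s t : R) : - ((1 - r) / 2) < s < 1 + (1 - r) / 2 ->
  is_derive (fun s => Re (k t * u (g s t))) s (Re (circ r t * u' (g s t))).
Proof.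
intros Hs.
replace (circ r t * u' (g s t))%C with (k t * u' (g s t) * (circ r t - z))%C
  by (rewrite <- (Hkz t) at 2; ring).
apply (Cderive_curve u (fun s => g s t)).
- apply Hu. now apply homotopy_ball.
- apply (is_derive_ext (fun s => Re z + s * Re (circ r t - z))).
  intros x; unfold g, Re, Im; simpl; ring. auto_derive; auto. unfold Re, Im; simpl; ring.
- apply (is_derive_ext (fun s => Im z + s * Im (circ r t - z))).
  intros x; unfold g, Re, Im; simpl; ring. auto_derive; auto. unfold Re, Im; simpl; ring.
Qed.

Lemma Ccont_homotopy_deriv (s t : R) : - ((1 - r) / 2) < s < 1 + (1 - r) / 2 ->
  Ccont (fun p : R * R => circ r (snd p) * u' (g (fst p) (snd p)))%C (s, t).
Proof.
intros Hs. apply Ccont_mult. apply Ccont_circ, continuous_snd.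
apply (Ccont_comp u' (fun p : R * R => g (fst p) (snd p))). apply Ccont_homotopy.
apply Hu. simpl. now apply homotopy_ball.
Qed.

(* The integrand is the [t]-derivative of the periodic function [- i / s * u (g s t)]. *)
Lemma homotopy_integral_deriv (s : R) : 0 <= s <= 1 ->
  RInt (fun t => Re (circ r t * u' (g s t))) 0 (2 * PI) = 0.
Proof.
intros Hs.
assert (Hc : forall t, continuous (fun t => Re (circ r t * u' (g s t))) t).
{ intros t. apply (continuous_Re (fun t => circ r t * u' (g s t))%C).
  apply (Ccont_slice (fun p : R * R => circ r (snd p) * u' (g (fst p) (snd p)))%C).
  apply Ccont_homotopy_deriv; lra. }
assert (Hper : circ r (2 * PI) = circ r 0).
{ unfold circ. now rewrite cos_2PI, sin_2PI, cos_0, sin_0. }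
apply is_RInt_unique.
(* The primitive contains 1/s. At s = 0 the curve is constant and the integrand is the fixed number
   [u' z] times [circ r t], with primitive [- Ci * u' z * circ r t]. *)
destruct (proj1 Hs) as [Hs0|Hs0].
- replace 0 with (minus (Re (- Ci / s * u (g s (2 * PI)))) (Re (- Ci / s * u (g s 0)))) at 2
    by (unfold g; rewrite Hper; apply (minus_eq_zero (G := R_AbelianGroup))).
  apply (is_RInt_derive (fun t => Re (- Ci / s * u (g s t)))); [|intros; apply Hc].
  intros t _.
  replace (circ r t * u' (g s t))%C with (- Ci / s * u' (g s t) * (s * (Ci * circ r t)))%C.
  2:{ assert (E : (Ci * Ci = -1)%C) by (unfold Ci, Cmult; apply injective_projections; simpl; ring).
      transitivity (- (Ci * Ci) * circ r t * u' (g s t))%C. field. intros F; injection F; lra.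
      rewrite E. ring. }
  apply (Cderive_curve u (g s)).
  + apply Hu, homotopy_ball. lra.
  + unfold g; simpl. auto_derive; auto. unfold Re, Im; simpl; ring.
  + unfold g; simpl. auto_derive; auto. unfold Re, Im; simpl; ring.
- subst s.
  replace 0 with (minus (Re (- Ci * u' z * circ r (2 * PI))) (Re (- Ci * u' z * circ r 0))) at 2
    by (rewrite Hper; apply (minus_eq_zero (G := R_AbelianGroup))).
  apply (is_RInt_derive (fun t => Re (- Ci * u' z * circ r t))); [|intros; apply Hc].
  intros t _. replace (g 0 t) with z by (unfold g; ring).
  unfold circ; simpl. auto_derive; auto. unfold Re, Im; simpl; ring.
Qed.

(** Real parts only, so that differentiation under a real-valued integral applies; the imaginary
    part is recovered in [cauchy_formula] by passing to [- Ci * u]. *)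
Lemma cauchy_homotopy :
  RInt (fun t => Re (k t * u (circ r t))) 0 (2 * PI) = RInt (fun t => Re (k t * u z)) 0 (2 * PI).
Proof.
assert (Hin : forall s, 0 <= s <= 1 -> locally s (fun s => - ((1 - r) / 2) < s < 1 + (1 - r) / 2)).
{ intros s Hs. apply (open_and (fun s => - ((1 - r) / 2) < s) (fun s => s < 1 + (1 - r) / 2)).
  apply open_gt. apply open_lt. lra. }
transitivity (RInt (fun t => Re (k t * u (g 1 t))) 0 (2 * PI)).
{ apply RInt_ext. intros t _. unfold g. do 3 f_equal. ring. }
transitivity (RInt (fun t => Re (k t * u (g 0 t))) 0 (2 * PI)).
2:{ apply RInt_ext. intros t _. unfold g. do 3 f_equal. ring. }
symmetry. apply (eq_is_derive (fun s => RInt (fun t => Re (k t * u (g s t))) 0 (2 * PI))); [|lra].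
intros s Hs.
assert (E : RInt (fun t => Derive (fun s => Re (k t * u (g s t))) s) 0 (2 * PI) = 0).
{ eapply eq_trans; [|apply (homotopy_integral_deriv s Hs)]. apply RInt_ext. intros t _.
  apply is_derive_unique, homotopy_derive_s. lra. }
refine (eq_ind _ (fun d : R => is_derive (K := R_AbsRing) (V := R_NormedModule) _ s d) _ _ E).
apply (is_derive_RInt_param (fun s t => Re (k t * u (g s t)))).
- generalize (Hin s Hs). apply filter_imp. intros x Hx t _. eexists. now apply homotopy_derive_s.
- intros t _. apply continuity_2d_pt_filterlim.
  change (continuous (fun p : R * R => Derive (fun s => Re (k (snd p) * u (g s (snd p)))) (fst p)) (s, t)).
  apply (continuous_ext_loc _ (fun p : R * R => Re (circ r (snd p) * u' (g (fst p) (snd p))))).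
  + generalize (continuous_fst (U := R_UniformSpace) (V := R_UniformSpace) s t _ (Hin s Hs)).
    unfold filtermap. apply filter_imp. intros [a b] Hab. simpl in *. symmetry.
    now apply is_derive_unique, homotopy_derive_s.
  + apply (continuous_Re (fun p : R * R => circ r (snd p) * u' (g (fst p) (snd p)))%C).
    apply Ccont_homotopy_deriv. lra.
- generalize (Hin s Hs). apply filter_imp. intros x Hx.
  apply (ex_RInt_continuous (V := R_CompleteNormedModule)). intros t _.
  apply (continuous_Re (fun t => k t * u (g x t))%C). apply Ccont_mult; [apply Hk|].
  apply (Ccont_comp u).
  apply (Ccont_slice (fun p : R * R => g (fst p) (snd p))). apply Ccont_homotopy.
  eapply Cderive_cont. apply Hu. now apply homotopy_ball.
Qed.

End Homotopy.

(** * Integrals over the circle and the geometric series of the Cauchy kernel *)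

Definition Cseries (c : nat -> C) (l : C) : Prop :=
  is_series (K := C_AbsRing) (V := CV) c l.

Definition CI (g : R -> C) : C :=
  (RInt (fun t => Re (g t)) 0 (2 * PI), RInt (fun t => Im (g t)) 0 (2 * PI)).

Lemma ex_RInt_Re (g : R -> C) a b : (forall t, Ccont g t) -> ex_RInt (fun t => Re (g t)) a b.
Proof.
intros H. apply (ex_RInt_continuous (V := R_CompleteNormedModule)). intros t _.
now apply continuous_Re.
Qed.

Lemma ex_RInt_Im (g : R -> C) a b : (forall t, Ccont g t) -> ex_RInt (fun t => Im (g t)) a b.
Proof.
intros H. apply (ex_RInt_continuous (V := R_CompleteNormedModule)). intros t _.
now apply continuous_Im.
Qed.

Lemma CI_ext (f g : R -> C) : (forall t, f t = g t) -> CI f = CI g.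
Proof. intros H. unfold CI. f_equal; apply RInt_ext; intros; now rewrite H. Qed.

Lemma CI_plus (f g : R -> C) : (forall t, Ccont f t) -> (forall t, Ccont g t) ->
  CI (fun t => f t + g t)%C = (CI f + CI g)%C.
Proof.
intros Hf Hg. unfold CI, Cplus; simpl. f_equal.
- apply (RInt_plus (V := R_CompleteNormedModule)); now apply ex_RInt_Re.
- apply (RInt_plus (V := R_CompleteNormedModule)); now apply ex_RInt_Im.
Qed.

Lemma CI_scal (c : C) (g : R -> C) : (forall t, Ccont g t) ->
  CI (fun t => c * g t)%C = (c * CI g)%C.
Proof.
intros Hg.
assert (H1 : ex_RInt (fun t => Re (g t)) 0 (2 * PI)) by now apply ex_RInt_Re.
assert (H2 : ex_RInt (fun t => Im (g t)) 0 (2 * PI)) by now apply ex_RInt_Im.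
assert (HS : forall a h, ex_RInt h 0 (2 * PI) ->
  RInt (fun t => a * h t) 0 (2 * PI) = a * RInt h 0 (2 * PI) /\ ex_RInt (fun t => a * h t) 0 (2 * PI)).
{ intros a h Hh. split.
  - now apply (RInt_scal (V := R_CompleteNormedModule)).
  - now apply (ex_RInt_scal (V := R_CompleteNormedModule)). }
destruct (HS (Re c) _ H1) as [E1 X1]. destruct (HS (Im c) _ H2) as [E2 X2].
destruct (HS (Im c) _ H1) as [E3 X3]. destruct (HS (Re c) _ H2) as [E4 X4].
unfold CI, Cmult. apply injective_projections; cbn [fst snd].
- fold (Re c) (Im c). rewrite <- E1, <- E2.
  exact (RInt_minus (V := R_CompleteNormedModule) _ _ _ _ X1 X2).
- fold (Re c) (Im c). rewrite <- E3, <- E4, Rplus_comm.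
  etransitivity; [|exact (RInt_plus (V := R_CompleteNormedModule) _ _ _ _ X3 X4)].
  apply RInt_ext. intros; unfold plus, Re, Im; simpl; ring.
Qed.

(** The factor 2 is the price of estimating real and imaginary parts separately. It is harmless,
    since constants disappear in [max_principle]. *)
Lemma Cmod_CI_le (g : R -> C) (M : R -> R) : (forall t, Ccont g t) ->
  (forall t, continuous M t) -> (forall t, Cmod (g t) <= M t) ->
  Cmod (CI g) <= 2 * RInt M 0 (2 * PI).
Proof.
intros Hg HM HgM.
assert (P : 0 <= 2 * PI) by (generalize PI_RGT_0; lra).
assert (EM : ex_RInt M 0 (2 * PI)).
{ apply (ex_RInt_continuous (V := R_CompleteNormedModule)). intros; apply HM. }
assert (B : forall h : R -> R, ex_RInt h 0 (2 * PI) -> (forall t, Rabs (h t) <= M t) ->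
   Rabs (RInt h 0 (2 * PI)) <= RInt M 0 (2 * PI)).
{ intros h Eh Hh. apply (norm_RInt_le (V := R_NormedModule) h M 0 (2 * PI)); try assumption.
  intros; apply Hh. now apply (RInt_correct (V := R_CompleteNormedModule)).
  now apply (RInt_correct (V := R_CompleteNormedModule)). }
eapply Rle_trans; [apply Cmod_le_sum|]. simpl.
assert (H1 := B _ (ex_RInt_Re g _ _ Hg) (fun t => Rle_trans _ _ _ (Re_le_Cmod (g t)) (HgM t))).
assert (H2 := B _ (ex_RInt_Im g _ _ Hg) (fun t => Rle_trans _ _ _ (Im_le_Cmod (g t)) (HgM t))).
lra.
Qed.

(** This is e^(-it), the conjugate of the point e^(it) of the unit circle. *)
Definition eneg (t : R) : C := (cos t, - sin t).

Lemma circ_eneg (r t : R) : (circ r t * eneg t = r)%C.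
Proof.
unfold circ, eneg, Cmult, RtoC; simpl. apply injective_projections; simpl; [|ring].
transitivity (r * (Rsqr (sin t) + Rsqr (cos t))); [unfold Rsqr; ring|].
rewrite sin2_cos2. ring.
Qed.

Lemma Cmod_eneg (t : R) : Cmod (eneg t) = 1.
Proof.
unfold Cmod, eneg; simpl.
replace (_ + _) with (Rsqr (sin t) + Rsqr (cos t)) by (unfold Rsqr; ring).
rewrite sin2_cos2. apply sqrt_1.
Qed.

Lemma Ccont_eneg (t : R) : Ccont eneg t.
Proof.
apply Ccont_pair. apply continuous_cos.
apply (continuous_opp (V := R_NormedModule)), continuous_sin.
Qed.

Lemma Ccont_pow {T : UniformSpace} (g : T -> C) (x : T) (n : nat) :
  Ccont g x -> Ccont (fun y => g y ^ n)%C x.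
Proof.
intros H. induction n; simpl. apply Ccont_const. now apply Ccont_mult.
Qed.

Lemma eneg_pow (t : R) (n : nat) : (eneg t ^ n)%C = (cos (INR n * t), - sin (INR n * t)).
Proof.
induction n.
- simpl. rewrite Rmult_0_l, cos_0, sin_0. apply injective_projections; simpl; ring.
- rewrite Cpow_S, IHn, S_INR.
  replace ((INR n + 1) * t) with (INR n * t + t) by ring.
  rewrite cos_plus, sin_plus. unfold eneg, Cmult; apply injective_projections; simpl; ring.
Qed.

Lemma CI_eneg_pow (n : nat) : CI (fun t => eneg t ^ S n)%C = 0.
Proof.
assert (P : INR (S n) <> 0) by (apply not_0_INR; lia).
rewrite (CI_ext _ _ (fun t => eneg_pow t (S n))).
assert (N : cos (INR (S n) * (2 * PI)) = 1 /\ sin (INR (S n) * (2 * PI)) = 0).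
{ replace (INR (S n) * (2 * PI)) with (0 + 2 * INR (S n) * PI) by ring.
  now rewrite cos_period, sin_period, cos_0, sin_0. }
generalize dependent (INR (S n)). intros m P N.
unfold CI. apply injective_projections; apply is_RInt_unique; unfold Re, Im; cbv beta; cbn [fst snd].
- replace (fst (RtoC 0)) with (minus (sin (m * (2 * PI)) / m) (sin (m * 0) / m)).
  2:{ rewrite (proj2 N), Rmult_0_r, sin_0. unfold minus, plus, opp; simpl. lra. }
  apply (is_RInt_derive (fun t => sin (m * t) / m)).
  + intros x _. auto_derive; auto. field. assumption.
  + intros x _. apply (ex_derive_continuous (K := R_AbsRing) (V := R_NormedModule)). auto_derive; auto.
- replace (snd (RtoC 0)) with (minus (cos (m * (2 * PI)) / m) (cos (m * 0) / m)).
  2:{ rewrite (proj1 N), Rmult_0_r, cos_0. unfold minus, plus, opp; simpl. lra. }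
  apply (is_RInt_derive (fun t => cos (m * t) / m)).
  + intros x _. auto_derive; auto. field. assumption.
  + intros x _. apply (ex_derive_continuous (K := R_AbsRing) (V := R_NormedModule)). auto_derive; auto.
Qed.

Lemma CI_const (c : C) : CI (fun _ => c) = ((2 * PI)%R * c)%C.
Proof.
unfold CI. rewrite !RInt_const. apply injective_projections; simpl; unfold scal; simpl; unfold mult; simpl; unfold Re, Im; ring.
Qed.

Section Kernel.

Variable w : C.
Hypothesis Hw : Cmod w < 1.

(* [r e^(it) / (r e^(it) - z)] for [w = z / r]. *)
Definition ker (t : R) : C := (/ (1 - w * eneg t))%C.

Lemma ker_den_ge (t : R) : 1 - Cmod w <= Cmod (1 - w * eneg t).
Proof.
assert (H : Cmod 1 <= Cmod (1 - w * eneg t) + Cmod (w * eneg t)).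
{ replace (RtoC 1) with ((1 - w * eneg t) + w * eneg t)%C at 1 by ring. apply Cmod_triangle. }
rewrite Cmod_1, Cmod_mult, Cmod_eneg in H. lra.
Qed.

Lemma ker_den_neq (t : R) : (1 - w * eneg t)%C <> 0.
Proof. apply Cmod_gt_0. generalize (ker_den_ge t); lra. Qed.

Lemma Cmod_ker (t : R) : Cmod (ker t) <= / (1 - Cmod w).
Proof.
unfold ker. rewrite Cmod_inv by apply ker_den_neq. apply Rinv_le_contravar. lra. apply ker_den_ge.
Qed.

Lemma Ccont_ker (t : R) : Ccont ker t.
Proof.
apply (Ccont_comp Cinv (fun t => 1 - w * eneg t)%C).
- unfold Cminus. apply Ccont_plus; [apply Ccont_const|].
  apply (continuous_opp (V := CV)). apply Ccont_mult; [apply Ccont_const|apply Ccont_eneg].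
- eapply Cderive_cont. apply Cderive_inv, ker_den_neq.
Qed.

Lemma ker_rec (t : R) : (ker t = 1 + w * eneg t * ker t)%C.
Proof. unfold ker. field. apply ker_den_neq. Qed.

(** Iterating [ker_rec] gives a finite geometric sum in w e^(-it) with an exact remainder, so that
    no infinite sum has to be exchanged with the integral. *)
Lemma CI_ker_expand (g : R -> C) (N : nat) : (forall t, Ccont g t) ->
  (CI (fun t => ker t * g t) = sum_n (fun n => w ^ n * CI (fun t => eneg t ^ n * g t)) N
     + w ^ S N * CI (fun t => eneg t ^ S N * (ker t * g t)))%C.
Proof.
intros Hg.
assert (Hen : forall n t, Ccont (fun t => eneg t ^ n * g t)%C t).
{ intros n t. apply Ccont_mult; [apply Ccont_pow, Ccont_eneg|apply Hg]. }
assert (Hek : forall n t, Ccont (fun t => eneg t ^ n * (ker t * g t))%C t).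
{ intros n t. apply Ccont_mult; [apply Ccont_pow, Ccont_eneg|].
  apply Ccont_mult; [apply Ccont_ker|apply Hg]. }
assert (Hrec : forall n, (CI (fun t => eneg t ^ n * (ker t * g t)) =
   CI (fun t => eneg t ^ n * g t) + w * CI (fun t => eneg t ^ S n * (ker t * g t)))%C).
{ intros n. rewrite <- CI_scal by apply Hek. rewrite <- CI_plus.
  - apply CI_ext. intros t. rewrite (ker_rec t) at 1. rewrite Cpow_S. ring.
  - apply Hen.
  - intros t. apply Ccont_mult; [apply Ccont_const|apply Hek]. }
induction N.
- rewrite sum_O, (CI_ext _ (fun t => eneg t ^ 0 * (ker t * g t))%C) by (intros; simpl; ring).
  rewrite Hrec. simpl. ring.
- rewrite IHN, sum_Sn, Hrec. change plus with Cplus. rewrite (Cpow_S w (S N)). ring.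
Qed.

Lemma CI_ker_series (g : R -> C) : (forall t, Ccont g t) ->
  Cseries (fun n => w ^ n * CI (fun t => eneg t ^ n * g t))%C (CI (fun t => ker t * g t)%C).
Proof.
intros Hg.
(* [M] bounds all remainder integrals at once, because |e^(-it)| = 1; the remainder after the term
   of index N is then at most M |w|^(N + 1). *)
set (M := 2 * RInt (fun t => Cmod (ker t * g t)) 0 (2 * PI)).
assert (HC : forall t, Ccont (fun t => ker t * g t)%C t).
{ intros t. apply Ccont_mult; [apply Ccont_ker|apply Hg]. }
assert (HB : forall n, Cmod (CI (fun t => eneg t ^ n * (ker t * g t))%C) <= M).
{ intros n. apply Cmod_CI_le.
  - intros t. apply Ccont_mult; [apply Ccont_pow, Ccont_eneg|apply HC].
  - intros t. apply (continuous_comp (V := CU) (fun t => ker t * g t)%C Cmod); [apply HC|].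
    apply (filterlim_norm (V := CV)).
  - intros t. rewrite Cmod_mult, Cmod_pow, Cmod_eneg, pow1. lra. }
assert (M0 : 0 <= M) by (eapply Rle_trans; [apply Cmod_ge_0|apply (HB O)]).
assert (L : is_lim_seq (fun N => M * Cmod w ^ S N) 0).
{ replace (Finite 0) with (Rbar_mult M 0) by (simpl; f_equal; ring).
  apply is_lim_seq_scal_l. apply (is_lim_seq_incr_1 (fun n => Cmod w ^ n)).
  apply is_lim_seq_geom. rewrite Rabs_pos_eq; [exact Hw|apply Cmod_ge_0]. }
intros P [eps HP].
destruct (L _ (locally_ball 0 eps)) as [N HN].
exists N. intros n Hn. apply HP.
change (Cmod (sum_n (fun n => w ^ n * CI (fun t => eneg t ^ n * g t))%C n - CI (fun t => ker t * g t)%C) < eps).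
rewrite (CI_ker_expand g n Hg) at 1.
match goal with |- Cmod (?a - (?a + ?b)) < _ => replace (a - (a + b))%C with (- b)%C by ring end.
rewrite Cmod_opp, Cmod_mult, Cmod_pow.
specialize (HN n Hn). change (Rabs (M * Cmod w ^ S n - 0) < eps) in HN.
eapply Rle_lt_trans; [|exact HN]. eapply Rle_trans; [|apply Rle_abs].
rewrite Rminus_0_r, Rmult_comm. apply Rmult_le_compat_r; [|apply HB].
apply pow_le, Cmod_ge_0.
Qed.

(** The kernel series for the constant function 1: every moment of e^(-it) except the zeroth
    vanishes. This normalises [cauchy_formula]. *)
Lemma CI_ker : CI ker = (2 * PI)%R.
Proof.
assert (H := CI_ker_series (fun _ => 1) (fun t => Ccont_const _ _)).
assert (E : CI ker = CI (fun t => ker t * 1)%C) by (apply CI_ext; intros; ring).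
rewrite E. clear E.
apply (filterlim_locally_unique (K := C_AbsRing) (V := CV) _ _ _ H).
apply (is_series_ext (K := C_AbsRing) (V := CV) (fun n => match n with O => RtoC (2 * PI) | _ => RtoC 0 end)).
- intros n. rewrite (CI_ext _ (fun t => eneg t ^ n)%C) by (intros; ring). destruct n.
  + simpl. rewrite CI_const. as_C. ring.
  + rewrite CI_eneg_pow. as_C. ring.
- intros P HP. exists O. intros n _.
  replace (sum_n _ n) with (RtoC (2 * PI)). now apply locally_singleton in HP.
  induction n. now rewrite sum_O. rewrite sum_Sn, <- IHn. as_C. change (RtoC (2 * PI) = RtoC (2 * PI) + 0)%C. ring.
Qed.

End Kernel.

(** * Cauchy's formula, Taylor expansion and Cauchy's estimate *)

Section Cauchy.

Variables (u u' : C -> C) (r : R).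
Hypothesis Hu : Chol u u'.
Hypothesis Hr : 0 < r < 1.

Lemma Ccont_u_circ (t : R) : Ccont (fun t => u (circ r t)) t.
Proof.
apply (Ccont_comp u). apply Ccont_circ, continuous_id.
eapply Cderive_cont, Hu. rewrite Cmod_circ; lra.
Qed.

Lemma Cmod_div_r (z : C) : Cmod z < r -> Cmod (z / r) < 1.
Proof.
intros Hz. rewrite Cmod_div by (intros E; injection E; lra).
rewrite Cmod_R, Rabs_pos_eq by lra. apply Rlt_div_l; lra.
Qed.

Lemma cauchy_formula (z : C) : Cmod z < r ->
  CI (fun t => ker (z / r) t * u (circ r t))%C = ((2 * PI)%R * u z)%C.
Proof.
intros Hz. assert (Hw := Cmod_div_r z Hz).
assert (r0 : RtoC r <> 0) by (intros E; injection E; lra).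
rewrite <- (CI_ker (z / r) Hw). rewrite Cmult_comm, <- CI_scal by (intros; now apply Ccont_ker).
rewrite (CI_ext (fun t => u z * ker (z / r) t)%C (fun t => ker (z / r) t * u z)%C) by (intros; ring).
assert (Hk : forall t, (ker (z / r) t * (circ r t - z))%C = circ r t).
{ intros t. assert (E := circ_eneg r t).
  replace (circ r t - z)%C with (circ r t * (1 - z / r * eneg t))%C.
  - unfold ker. field. split; [assumption|]. intros F. apply (ker_den_neq (z / r) Hw t).
    transitivity ((r - z * eneg t) / r)%C; [field; assumption|]. rewrite F. field. assumption.
  - transitivity (circ r t - z / r * (circ r t * eneg t))%C; [ring|]. rewrite E. field. assumption. }
unfold CI. f_equal.
- apply (cauchy_homotopy u u' z r (ker (z / r)) Hu Hr Hz (Ccont_ker _ Hw) Hk).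
- assert (Hv : Chol (fun w => - Ci * u w)%C (fun w => - Ci * u' w)%C).
  { intros w Hww. destruct (Hu w Hww) as [H1 H2]. split.
    - replace (- Ci * u' w)%C with (0 * u w + - Ci * u' w)%C by ring.
      apply (Cderive_mult (fun _ => - Ci)%C). apply Cderive_const. assumption.
    - apply (Ccont_mult (T := CU)). apply Ccont_const. assumption. }
  assert (H := cauchy_homotopy _ _ z r (ker (z / r)) Hv Hr Hz (Ccont_ker _ Hw) Hk).
  etransitivity; [|etransitivity; [exact H|]]; apply RInt_ext; intros t _; unfold Re, Im; simpl; ring.
Qed.

Lemma PI2_neq_0 : RtoC (2 * PI) <> 0.
Proof. intros E; injection E. generalize PI_RGT_0; lra. Qed.

(** The kernel is expanded in powers of z / r, so the coefficients come with the chosen [r]; that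
    they agree for different radii is left to uniqueness of real power series. *)
Lemma Chol_series : exists c : nat -> C,
  forall z, Cmod z < r -> Cseries (fun n => z ^ n * c n)%C (u z).
Proof.
assert (r0 : RtoC r <> 0) by (intros E; injection E; lra).
exists (fun n => / (2 * PI)%R * (CI (fun t => eneg t ^ n * u (circ r t)) / r ^ n))%C.
intros z Hz.
replace (u z) with (/ (2 * PI)%R * ((2 * PI)%R * u z))%C by (field; apply PI2_neq_0).
rewrite <- (cauchy_formula z Hz).
apply (is_series_ext (K := C_AbsRing) (V := CV) (fun n => / (2 * PI)%R *
   ((z / r) ^ n * CI (fun t => eneg t ^ n * u (circ r t))))%C).
- intros n. unfold Cdiv at 1. rewrite Cpow_mult_l, Cpow_inv by assumption.
  as_C. field. split; [now apply Cpow_nz|apply PI2_neq_0].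
- apply (is_series_scal (K := C_AbsRing) (V := CV)).
  apply CI_ker_series. now apply Cmod_div_r. apply Ccont_u_circ.
Qed.

(** The constant depends on [z] and [r] but not on [u], so it stays the same when [u] is replaced by
    its powers. *)
Lemma cauchy_bound (M : R) (z : C) : Cmod z < r ->
  (forall t, Cmod (u (circ r t)) <= M) -> Cmod (u z) <= 2 / (1 - Cmod z / r) * M.
Proof.
intros Hz HM. assert (Hw := Cmod_div_r z Hz).
assert (PP := PI_RGT_0).
assert (H : Cmod (CI (fun t => ker (z / r) t * u (circ r t))%C) <= 2 * RInt (fun _ => / (1 - Cmod (z / r)) * M) 0 (2 * PI)).
{ apply Cmod_CI_le.
  - intros t. apply Ccont_mult. now apply Ccont_ker. apply Ccont_u_circ.
  - intros; apply continuous_const.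
  - intros t. rewrite Cmod_mult. apply Rmult_le_compat; try apply Cmod_ge_0. now apply Cmod_ker. apply HM. }
rewrite (cauchy_formula z Hz), RInt_const in H.
rewrite Cmod_mult, Cmod_R, Rabs_pos_eq in H by lra.
unfold scal in H; simpl in H; unfold mult in H; simpl in H.
rewrite Cmod_div, Cmod_R, (Rabs_pos_eq r) in H by (try (intros E; injection E); lra).
apply Rmult_le_reg_l with (2 * PI); [lra|]. eapply Rle_trans; [exact H|].
apply Req_le. unfold Rdiv at 2. ring.
Qed.

End Cauchy.

(** * Holomorphic functions on the unit disc *)

Definition holomorphic (u : C -> C) : Prop := exists u', Chol u u'.

Lemma holomorphic_const (c : C) : holomorphic (fun _ => c).
Proof.
exists (fun _ => 0). intros z _. split. apply Cderive_const. apply (Ccont_const (T := CU)).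
Qed.

Lemma Chol_cont (u u' : C -> C) (z : C) : Chol u u' -> Cmod z < 1 -> Ccont (T := CU) u z.
Proof. intros H Hz. eapply Cderive_cont. now apply H. Qed.

Lemma holomorphic_plus (u v : C -> C) :
  holomorphic u -> holomorphic v -> holomorphic (fun z => u z + v z)%C.
Proof.
intros [u' Hu] [v' Hv]. exists (fun z => u' z + v' z)%C. intros z Hz. split.
- apply Cderive_plus. now apply Hu. now apply Hv.
- apply (Ccont_plus (T := CU)). now apply Hu. now apply Hv.
Qed.

Lemma holomorphic_mult (u v : C -> C) :
  holomorphic u -> holomorphic v -> holomorphic (fun z => u z * v z)%C.
Proof.
intros [u' Hu] [v' Hv]. exists (fun z => u' z * v z + u z * v' z)%C. intros z Hz. split.
- apply Cderive_mult. now apply Hu. now apply Hv.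
- apply (Ccont_plus (T := CU)); apply (Ccont_mult (T := CU)).
  + now apply Hu.
  + now apply (Chol_cont v v').
  + now apply (Chol_cont u u').
  + now apply Hv.
Qed.

Lemma holomorphic_pow (u : C -> C) (n : nat) :
  holomorphic u -> holomorphic (fun z => u z ^ n)%C.
Proof.
intros H. induction n; simpl.
- apply holomorphic_const.
- now apply holomorphic_mult.
Qed.

Lemma holomorphic_opp (u : C -> C) : holomorphic u -> holomorphic (fun z => - u z)%C.
Proof.
intros [u' Hu]. exists (fun z => - u' z)%C. intros z Hz. split.
- apply (is_derive_opp (K := C_AbsRing) (V := CV)). now apply Hu.
- apply (continuous_opp (U := CU) (V := CV)). now apply Hu.
Qed.

Lemma holomorphic_inv (u : C -> C) : (forall z, Cmod z < 1 -> u z <> 0) ->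
  holomorphic u -> holomorphic (fun z => / u z)%C.
Proof.
intros H0 [u' Hu]. exists (fun z => u' z * - / (u z * u z))%C. intros z Hz.
assert (Hc := Chol_cont u u' z Hu Hz). split.
- apply Cderive_comp. now apply Cderive_inv, H0. now apply Hu.
- apply (Ccont_mult (T := CU)); [now apply Hu|].
  apply (continuous_opp (U := CU) (V := CV)).
  apply (Ccont_comp (T := CU) Cinv). now apply (Ccont_mult (T := CU)).
  eapply Cderive_cont, Cderive_inv. apply Cmult_neq_0; now apply H0.
Qed.

Lemma holomorphic_minus (u v : C -> C) :
  holomorphic u -> holomorphic v -> holomorphic (fun z => u z - v z)%C.
Proof. intros Hu Hv. apply holomorphic_plus. assumption. now apply holomorphic_opp. Qed.

Lemma holomorphic_div (u v : C -> C) : (forall z, Cmod z < 1 -> v z <> 0) ->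
  holomorphic u -> holomorphic v -> holomorphic (fun z => u z / v z)%C.
Proof. intros H Hu Hv. apply holomorphic_mult. assumption. now apply holomorphic_inv. Qed.

(** If a = (1 + h) b with h > 0, the hypothesis bounds every power of 1 + h by K, against
    Bernoulli's inequality. The case b = 0 is settled by n = 1. *)
Lemma le_of_pow_le (a b K : R) : 0 <= b -> (forall n, a ^ n <= K * b ^ n) -> a <= b.
Proof.
intros Hb H. destruct (Rle_or_lt a b) as [|Hab]; [assumption|exfalso].
destruct Hb as [Hb|Hb].
- set (h := a / b - 1).
  assert (Hh : 0 < h) by (unfold h; apply Rlt_0_minus, Rlt_div_r; lra).
  (* The integer part gives n + 1 > K / h, and [Rmax 0] meets the sign condition of [nfloor_ex].
     Bernoulli's inequality is [poly]. *)
  destruct (nfloor_ex (Rmax 0 (K / h)) (Rmax_l _ _)) as [n [_ Hn]].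
  assert (H1 := poly (S n) h Hh). specialize (H (S n)).
  assert (Hbn : 0 < b ^ S n) by now apply pow_lt.
  assert (E : a = (1 + h) * b) by (unfold h; field; lra).
  rewrite E, Rpow_mult_distr in H. apply Rmult_le_reg_r in H; [|assumption].
  rewrite S_INR in H1. assert (H2 := Rmax_r 0 (K / h)).
  assert (K <= (INR n + 1) * h); [|lra].
  apply Rle_div_l in H2; [|assumption]. nra.
- specialize (H 1%nat). rewrite <- Hb in H. simpl in H. lra.
Qed.

(* Cauchy's estimate loses a constant factor, which disappears when it is applied to the powers of [u]. *)
Lemma max_principle (u : C -> C) (r M : R) (z : C) : holomorphic u -> 0 < r < 1 -> Cmod z < r ->
  (forall w, Cmod w = r -> Cmod (u w) <= M) -> Cmod (u z) <= M.
Proof.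
intros Hu Hr Hz HM.
assert (HM' : forall t, Cmod (u (circ r t)) <= M) by (intros t; apply HM, Cmod_circ; lra).
apply (le_of_pow_le _ _ (2 / (1 - Cmod z / r))).
- eapply Rle_trans; [apply Cmod_ge_0|apply (HM' 0)].
- intros n. destruct (holomorphic_pow u n Hu) as [v Hv].
  rewrite <- Cmod_pow. apply (cauchy_bound (fun z => u z ^ n)%C v r Hv Hr (M ^ n) z Hz).
  intros t. rewrite Cmod_pow. apply pow_incr. split. apply Cmod_ge_0. apply HM'.
Qed.

(** * Complex power series *)

Lemma Re_sum_n (c : nat -> C) (n : nat) :
  Re (sum_n (c : nat -> CV) n) = sum_n (fun k => Re (c k)) n.
Proof.
induction n. now rewrite !sum_O. rewrite !sum_Sn, <- IHn. reflexivity.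
Qed.

Lemma Im_sum_n (c : nat -> C) (n : nat) :
  Im (sum_n (c : nat -> CV) n) = sum_n (fun k => Im (c k)) n.
Proof.
induction n. now rewrite !sum_O. rewrite !sum_Sn, <- IHn. reflexivity.
Qed.

Lemma Cseries_components (c : nat -> C) (l : C) :
  Cseries c l <-> is_series (fun n => Re (c n)) (Re l) /\ is_series (fun n => Im (c n)) (Im l).
Proof.
split.
- intros H. split.
  + apply (filterlim_ext (fun n => Re (sum_n (c : nat -> CV) n))); [apply Re_sum_n|].
    apply (filterlim_comp _ _ _ (sum_n (c : nat -> CV)) Re _ (locally (l : CU)) _ H).
    apply (continuous_Re (T := CU) (fun z => z)), continuous_id.
  + apply (filterlim_ext (fun n => Im (sum_n (c : nat -> CV) n))); [apply Im_sum_n|].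
    apply (filterlim_comp _ _ _ (sum_n (c : nat -> CV)) Im _ (locally (l : CU)) _ H).
    apply (continuous_Im (T := CU) (fun z => z)), continuous_id.
- intros [H1 H2] P [eps HP].
  assert (He : 0 < eps / 2) by (destruct eps; simpl; lra).
  destruct (H1 _ (locally_ball (Re l) (mkposreal _ He))) as [N1 B1'].
  destruct (H2 _ (locally_ball (Im l) (mkposreal _ He))) as [N2 B2'].
  exists (max N1 N2). intros n Hn. apply HP.
  assert (B1 := B1' n ltac:(lia)). assert (B2 := B2' n ltac:(lia)).
  change (Cmod (sum_n (c : nat -> CV) n - l) < eps).
  eapply Rle_lt_trans; [apply Cmod_le_sum|].
  change (Rabs (sum_n (fun k => Re (c k)) n - Re l) < eps / 2) in B1.
  change (Rabs (sum_n (fun k => Im (c k)) n - Im l) < eps / 2) in B2.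
  rewrite <- Re_sum_n in B1. rewrite <- Im_sum_n in B2.
  change (Re (sum_n (c : nat -> CV) n - l)) with (Re (sum_n (c : nat -> CV) n) - Re l).
  change (Im (sum_n (c : nat -> CV) n - l)) with (Im (sum_n (c : nat -> CV) n) - Im l). lra.
Qed.

Lemma Cseries_ext (a b : nat -> C) (l : C) : (forall n, a n = b n) -> Cseries a l -> Cseries b l.
Proof. apply (is_series_ext (K := C_AbsRing) (V := CV)). Qed.

Lemma Cseries_plus (a b : nat -> C) (la lb : C) : Cseries a la -> Cseries b lb ->
  Cseries (fun n => a n + b n)%C (la + lb).
Proof. apply (is_series_plus (K := C_AbsRing) (V := CV)). Qed.

Lemma Cseries_scal (k : C) (a : nat -> C) (l : C) : Cseries a l ->
  Cseries (fun n => k * a n)%C (k * l).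
Proof. apply (is_series_scal (K := C_AbsRing) (V := CV)). Qed.

Lemma Cseries_decr_1 (a : nat -> C) (l : C) :
  Cseries (fun n => a (S n)) l -> Cseries a (l + a O).
Proof.
intros H. apply (is_series_decr_1 (K := C_AbsRing) (V := CV)).
replace (plus _ _) with (l : CV); [exact H|].
as_C. change (l = l + a O - a O)%C. ring.
Qed.

Lemma Cseries_unique (a : nat -> C) (l l' : C) : Cseries a l -> Cseries a l' -> l = l'.
Proof. apply (filterlim_locally_unique (K := C_AbsRing) (V := CV)). Qed.

Lemma Cmod_series_le (a : nat -> C) (b : nat -> R) (l : C) (m : R) :
  Cseries a l -> is_series b m -> (forall n, Cmod (a n) <= b n) -> Cmod l <= m.
Proof.
intros Ha Hb Hab.
apply (is_lim_seq_le (fun n => Cmod (sum_n (a : nat -> CV) n)) (sum_n b) (Cmod l) m).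
- intros n. eapply Rle_trans; [apply (norm_sum_n_m (K := C_AbsRing) (V := CV))|].
  apply sum_n_m_le. exact Hab.
- apply (filterlim_comp _ _ _ (sum_n (a : nat -> CV)) Cmod _ (locally (l : CU)) _ Ha).
  apply (filterlim_norm (V := CV)).
- exact Hb.
Qed.

Lemma sum_n_ge_0 (b : nat -> R) (n : nat) : (forall n, 0 <= b n) -> 0 <= sum_n b n.
Proof.
intros H. apply Rle_trans with (sum_n (fun _ => 0) n).
- rewrite sum_n_const. lra.
- now apply sum_n_m_le.
Qed.

Lemma is_series_ge_0 (b : nat -> R) (m : R) : (forall n, 0 <= b n) -> is_series b m -> 0 <= m.
Proof.
intros Hb H. apply (is_lim_seq_le (fun _ => 0) (sum_n b) 0 m).
- intros n. now apply sum_n_ge_0.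
- apply is_lim_seq_const.
- exact H.
Qed.

Lemma Cseries_ex (a : nat -> C) (b : nat -> R) : ex_series b -> (forall n, Cmod (a n) <= b n) ->
  Cseries a (Series (fun n => Re (a n)), Series (fun n => Im (a n))).
Proof.
intros Hb Hab. apply Cseries_components. split; apply Series_correct;
apply (ex_series_le (K := R_AbsRing) (V := R_CompleteNormedModule) _ b); try assumption; intros n.
- eapply Rle_trans; [apply (Re_le_Cmod (a n))|apply Hab].
- eapply Rle_trans; [apply (Im_le_Cmod (a n))|apply Hab].
Qed.

(** Meant for nonnegative sequences, namely norms of coefficients, where it expresses absolute
    convergence on the open unit disc. *)
Definition conv_disc (b : nat -> R) : Prop :=
  forall r, 0 <= r < 1 -> ex_series (fun n => b n * r ^ n).

Definition Csum (c : nat -> C) (z : C) : C :=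
  (Series (fun n => Re (z ^ n * c n)), Series (fun n => Im (z ^ n * c n))).

Lemma Csum_correct (c : nat -> C) (z : C) : conv_disc (fun n => Cmod (c n)) -> Cmod z < 1 ->
  Cseries (fun n => z ^ n * c n)%C (Csum c z).
Proof.
intros Hc Hz. apply (Cseries_ex _ (fun n => Cmod (c n) * Cmod z ^ n)).
- apply Hc. split; [apply Cmod_ge_0|assumption].
- intros n. rewrite Cmod_mult, Cmod_pow, Rmult_comm. lra.
Qed.

(** Gives access to [CV_radius] and its invariance under termwise differentiation. Partial sums of
    nonnegative terms bound each term, so convergence at the midpoint [r] of [x] and 1 contradicts a
    radius x < 1. *)
Lemma conv_disc_CV_radius (b : nat -> R) : (forall n, 0 <= b n) -> conv_disc b -> Rbar_le 1 (CV_radius b).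
Proof.
intros Hp H. apply Rbar_not_lt_le. intros Hlt.
assert (H0 := CV_radius_ge_0 b).
destruct (CV_radius b) as [x| |] eqn:E; simpl in *; try easy.
set (r := (x + 1) / 2).
destruct (H r ltac:(unfold r; lra)) as [l Hl].
destruct (CV_radius_bounded b) as [Hub _]. rewrite E in Hub.
assert (B : r <= x); [|unfold r in B; lra].
apply (Hub r). exists l. intros n.
assert (Hr : forall k, 0 <= b k * r ^ k) by (intros k; apply Rmult_le_pos; [apply Hp|apply pow_le; unfold r; lra]).
rewrite Rabs_pos_eq by apply Hr.
apply Rle_trans with (sum_n (fun k => b k * r ^ k) n).
- destruct n. rewrite sum_O. lra. rewrite sum_Sn.
  assert (H1 := sum_n_ge_0 _ n Hr).
  unfold plus; simpl. simpl in H1. lra.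
- rewrite sum_n_Reals. apply (sum_incr (fun k => b k * r ^ k)); [|apply Hr].
  apply is_lim_seq_Reals. apply (is_lim_seq_ext (sum_n (fun k => b k * r ^ k))).
  intros; apply sum_n_Reals. exact Hl.
Qed.

Lemma CV_radius_conv_disc (b : nat -> R) : (forall n, 0 <= b n) -> Rbar_le 1 (CV_radius b) -> conv_disc b.
Proof.
intros Hp H r Hr. apply (ex_series_ext (fun n => Rabs (b n * r ^ n))).
- intros n. apply Rabs_pos_eq, Rmult_le_pos; [apply Hp|apply pow_le; lra].
- apply CV_disk_inside. eapply Rbar_lt_le_trans; [|exact H]. simpl. rewrite Rabs_pos_eq; lra.
Qed.

Lemma conv_disc_derive (b : nat -> R) : (forall n, 0 <= b n) -> conv_disc b -> conv_disc (PS_derive b).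
Proof.
intros Hp H. apply CV_radius_conv_disc.
- intros n. apply Rmult_le_pos. apply pos_INR. apply Hp.
- rewrite CV_radius_derive. now apply conv_disc_CV_radius.
Qed.

Lemma conv_disc_ext (a b : nat -> R) : (forall n, a n = b n) -> conv_disc a -> conv_disc b.
Proof.
intros E H r Hr. apply (ex_series_ext (fun n => a n * r ^ n)); [|now apply H].
intros n. now rewrite E.
Qed.

Definition Cdcoef (c : nat -> C) (n : nat) : C := (INR (S n) * c (S n))%C.

Lemma Cmod_Cdcoef (c : nat -> C) (n : nat) : Cmod (Cdcoef c n) = PS_derive (fun n => Cmod (c n)) n.
Proof.
unfold Cdcoef, PS_derive. rewrite Cmod_mult, Cmod_R, Rabs_pos_eq. reflexivity. apply pos_INR.
Qed.

Lemma conv_disc_Cdcoef (c : nat -> C) : conv_disc (fun n => Cmod (c n)) ->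
  conv_disc (fun n => Cmod (Cdcoef c n)).
Proof.
intros H. eapply conv_disc_ext. intros n; symmetry; apply Cmod_Cdcoef.
apply conv_disc_derive; [|exact H]. intros; apply Cmod_ge_0.
Qed.

(** Twice the sharp constant, and the general term of the second derived series at [rho], so that
    the bounds are summable. Induction: the remainder of exponent n + 3 is [w] times that of
    exponent n + 2, plus (n + 2) z^(n + 1) (w - z)^2. *)
Lemma pow_taylor_remainder (z w : C) (rho : R) (n : nat) : Cmod z <= rho -> Cmod w <= rho ->
  Cmod (w ^ S (S n) - z ^ S (S n) - INR (S (S n)) * z ^ S n * (w - z))
    <= INR (S n) * INR (S (S n)) * rho ^ n * Cmod (w - z) ^ 2.
Proof.
intros Hz Hw.
assert (Hd := pow_le (Cmod (w - z)) 2 (Cmod_ge_0 _)).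
assert (Hr : 0 <= rho) by (eapply Rle_trans; [apply Cmod_ge_0|exact Hz]).
induction n.
- replace (w ^ 2 - z ^ 2 - INR 2 * z ^ 1 * (w - z))%C with ((w - z) ^ 2)%C.
  + rewrite Cmod_pow. change (INR 1) with 1. change (INR 2) with 2. simpl in *; nra.
  + change (INR 2) with 2. ring.
- replace (w ^ S (S (S n)) - z ^ S (S (S n)) - INR (S (S (S n))) * z ^ S (S n) * (w - z))%C
    with (w * (w ^ S (S n) - z ^ S (S n) - INR (S (S n)) * z ^ S n * (w - z))
          + INR (S (S n)) * z ^ S n * (w - z) ^ 2)%C.
  + eapply Rle_trans; [apply Cmod_triangle|].
    rewrite !Cmod_mult, !Cmod_pow, Cmod_R, Rabs_pos_eq by apply pos_INR.
    assert (H1 : Cmod w * Cmod (w ^ S (S n) - z ^ S (S n) - INR (S (S n)) * z ^ S n * (w - z))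
       <= rho * (INR (S n) * INR (S (S n)) * rho ^ n * Cmod (w - z) ^ 2)).
    { apply Rmult_le_compat; try apply Cmod_ge_0; assumption. }
    assert (H2 : INR (S (S n)) * Cmod z ^ S n * Cmod (w - z) ^ 2 <= INR (S (S n)) * rho ^ S n * Cmod (w - z) ^ 2).
    { apply Rmult_le_compat_r; [assumption|]. apply Rmult_le_compat_l; [apply pos_INR|].
      apply pow_incr. split; [apply Cmod_ge_0|assumption]. }
    eapply Rle_trans; [apply Rplus_le_compat; [exact H1|exact H2]|].
    assert (Hp : 0 <= rho ^ S n * Cmod (w - z) ^ 2) by (apply Rmult_le_pos; [now apply pow_le|assumption]).
    rewrite !S_INR. assert (HI := pos_INR n).
    apply Rle_trans with ((INR n + 1 + 1) * (INR n + 1 + 1) * (rho ^ S n * Cmod (w - z) ^ 2)).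
    * apply Req_le. simpl. ring.
    * rewrite (Rmult_assoc _ (rho ^ S n)). apply Rmult_le_compat_r; [assumption|nra].
  + rewrite !S_INR, !RtoC_plus, (Cpow_S w (S (S n))), (Cpow_S z (S (S n))), (Cpow_S z (S n)).
    ring.
Qed.

Lemma Cderive_Csum (c : nat -> C) (z : C) : conv_disc (fun n => Cmod (c n)) -> Cmod z < 1 ->
  Cderive (Csum c) z (Csum (Cdcoef c) z).
Proof.
intros Hc Hz.
set (rho := (1 + Cmod z) / 2).
assert (Hz0 := Cmod_ge_0 z).
assert (Hrho : Cmod z < rho < 1) by (unfold rho; lra).
(* [B n] times |w - z|^2 bounds the first-order Taylor error of the n-th term; the constant and the
   linear term have no error. *)
set (B := fun n => match n with O => 0 | S O => 0
  | S (S n) => INR (S n) * INR (S (S n)) * Cmod (c (S (S n))) * rho ^ n end).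
assert (HB : ex_series B).
{ apply (ex_series_incr_n (K := R_AbsRing) (V := R_NormedModule) B 2).
  apply (ex_series_ext (fun n => Cmod (Cdcoef (Cdcoef c) n) * rho ^ n)).
  - intros n. unfold B, Cdcoef. simpl Nat.add. cbv iota beta.
    rewrite !Cmod_mult, !Cmod_R, !Rabs_pos_eq by apply pos_INR. as_R. ring.
  - refine (conv_disc_Cdcoef _ (conv_disc_Cdcoef _ Hc) rho _). lra. }
destruct HB as [K HB].
assert (HK : 0 <= K).
{ apply (is_series_ge_0 B); [|exact HB]. intros [|[|n]]; unfold B; try lra.
  repeat apply Rmult_le_pos; try apply pos_INR. apply Cmod_ge_0. apply pow_le; lra. }
apply Cderive_eps. intros eps.
(* The first bound keeps [w] within radius [rho]; the second uses K + 1 because [K] may vanish. *)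
assert (Pd : 0 < Rmin (rho - Cmod z) (eps / (K + 1))).
{ apply Rmin_glb_lt; [lra|]. apply Rdiv_lt_0_compat; [apply eps|lra]. }
exists (mkposreal _ Pd). simpl. intros w Hw.
assert (Hw1 := Rlt_le_trans _ _ _ Hw (Rmin_l _ _)).
assert (Hw2 := Rlt_le_trans _ _ _ Hw (Rmin_r _ _)).
assert (Hwr : Cmod w <= rho).
{ replace w with (z + (w - z))%C by ring. eapply Rle_trans; [apply Cmod_triangle|]. lra. }
assert (S1 := Csum_correct c w Hc ltac:(lra)).
assert (S2 := Csum_correct c z Hc Hz).
assert (S3 := Csum_correct _ z (conv_disc_Cdcoef c Hc) Hz).
(* A zero term is put in front of the derived series, which aligns its index with the series at [w]
   and at [z]. *)
assert (S3' := Cseries_decr_1 (fun n => match n with O => RtoC 0 | S n => z ^ n * Cdcoef c n end)%C _ S3).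
cbv beta iota in S3'.
assert (SD := Cseries_plus _ _ _ _ (Cseries_plus _ _ _ _ S1 (Cseries_scal (-1) _ _ S2))
   (Cseries_scal (- (w - z)) _ _ S3')).
assert (HE : Cmod (Csum c w - Csum c z - Csum (Cdcoef c) z * (w - z)) <= K * Cmod (w - z) ^ 2).
{ match type of SD with Cseries _ ?l =>
    replace (Csum c w - Csum c z - Csum (Cdcoef c) z * (w - z))%C with l by ring end.
  apply (Cmod_series_le _ (fun n => B n * Cmod (w - z) ^ 2) _ _ SD).
  - now apply is_series_scal_r.
  - intros [|[|n]].
    + simpl B. rewrite Rmult_0_l. apply Req_le. match goal with |- Cmod ?x = _ => replace x with (RtoC 0) end; [apply Cmod_0|]. simpl. ring.
    + simpl B. rewrite Rmult_0_l. apply Req_le. match goal with |- Cmod ?x = _ => replace x with (RtoC 0) end; [apply Cmod_0|]. unfold Cdcoef. simpl. ring.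
    + replace (_ + _)%C with ((w ^ S (S n) - z ^ S (S n) - INR (S (S n)) * z ^ S n * (w - z)) * c (S (S n)))%C
        by (unfold Cdcoef; ring).
      rewrite Cmod_mult. unfold B.
      replace (INR (S n) * INR (S (S n)) * Cmod (c (S (S n))) * rho ^ n * Cmod (w - z) ^ 2)
        with (INR (S n) * INR (S (S n)) * rho ^ n * Cmod (w - z) ^ 2 * Cmod (c (S (S n)))) by ring.
      apply Rmult_le_compat_r; [apply Cmod_ge_0|]. apply pow_taylor_remainder; lra. }
eapply Rle_trans; [exact HE|].
assert (Hm := Cmod_ge_0 (w - z)).
simpl. rewrite Rmult_1_r, <- Rmult_assoc. apply Rmult_le_compat_r; [assumption|].
apply Rle_trans with ((K + 1) * Cmod (w - z)); [nra|].
apply Rlt_div_r in Hw2; lra.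
Qed.

Lemma Chol_Csum (c : nat -> C) : conv_disc (fun n => Cmod (c n)) -> Chol (Csum c) (Csum (Cdcoef c)).
Proof.
intros Hc z Hz. split. now apply Cderive_Csum.
eapply Cderive_cont. apply Cderive_Csum; [|assumption]. now apply conv_disc_Cdcoef.
Qed.

(** * Quaternions as pairs of complex numbers *)

Ltac qunfold := unfold qsub, qadd, qopp, qmul, qconj, qreal, mkquat, qre, qim_i, qim_j, qim_k in *; cbn [fst snd] in *.
Ltac qdestruct := repeat match goal with q : quat |- _ => destruct q as [[[? ?] ?] ?] end.
Ltac qcompute := lazy beta iota zeta delta [qsub qadd qopp qmul qconj qreal mkquat qre qim_i qim_j qim_k fst snd].
Ltac qsplit := repeat match goal with |- (_, _) = (_, _) => apply f_equal2 end.
Ltac qring := intros; qdestruct; qcompute; qsplit; ring.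

Lemma quat_eq (p q : quat) : qre p = qre q -> qim_i p = qim_i q -> qim_j p = qim_j q ->
  qim_k p = qim_k q -> p = q.
Proof. intros. qdestruct. qunfold. congruence. Qed.

Lemma qmulA (p q s : quat) : (p * (q * s) = p * q * s)%H.
Proof. qring. Qed.
Lemma qmul1l (q : quat) : (1 * q = q)%H.
Proof. qring. Qed.
Lemma qmul1r (q : quat) : (q * 1 = q)%H.
Proof. qring. Qed.
Lemma qmul0l (q : quat) : (0 * q = 0)%H.
Proof. qring. Qed.
Lemma qmul0r (q : quat) : (q * 0 = 0)%H.
Proof. qring. Qed.

Lemma qadd_0_r (q : quat) : (q + 0 = q)%H.
Proof. qring. Qed.

Lemma qadd_0_l (q : quat) : (0 + q = q)%H.
Proof. qring. Qed.

Lemma qsub_0_r (q : quat) : (q - 0 = q)%H.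
Proof. qring. Qed.

Lemma qaddC (p q : quat) : (p + q = q + p)%H.
Proof. qring. Qed.

Lemma qaddA (p q s : quat) : (p + (q + s) = p + q + s)%H.
Proof. qring. Qed.

Lemma qadd_sub (p q : quat) : (p + q - p = q)%H.
Proof. qring. Qed.

Lemma qsub_sub (p q : quat) : (p - (p - q) = q)%H.
Proof. qring. Qed.

Lemma qmul_add_l (p q s : quat) : (p * (q + s) = p * q + p * s)%H.
Proof. qring. Qed.

Lemma qmul_add_r (p q s : quat) : ((p + q) * s = p * s + q * s)%H.
Proof. qring. Qed.

Lemma qmul_sub_l (p q s : quat) : (p * (q - s) = p * q - p * s)%H.
Proof. qring. Qed.

Lemma qmul_sub_r (p q s : quat) : ((p - q) * s = p * s - q * s)%H.
Proof. qring. Qed.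

Lemma qmul_opp_r (p q : quat) : (p * qopp q = qopp (p * q))%H.
Proof. qring. Qed.

Lemma qconj_1 : qconj 1%H = 1%H.
Proof. qring. Qed.

Lemma qconj_opp (q : quat) : qconj (qopp q) = qopp (qconj q).
Proof. qring. Qed.

Lemma qconj_0 : qconj 0%H = 0%H.
Proof. qring. Qed.

Lemma qreal_comm (x : R) (q : quat) : (qreal x * q = q * qreal x)%H.
Proof. qring. Qed.

Lemma qreal_mul (x y : R) : (qreal x * qreal y)%H = qreal (x * y).
Proof. qring. Qed.

Lemma qreal_add_mul (x y : R) (q : quat) : (qreal (x + y) * q = qreal x * q + qreal y * q)%H.
Proof. qring. Qed.

Lemma qreal_trace_mul (u q : quat) : (qreal (2 * qre u) * q = q * u + q * qconj u)%H.
Proof. qring. Qed.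

Lemma qsub_add (p q : quat) : (p - q + q = p)%H.
Proof. qring. Qed.

Lemma qopp_sub_add (p q : quat) : (qopp (p - q) + p = q)%H.
Proof. qring. Qed.

(** * The quaternionic norm and inverses *)

Definition qsq (q : quat) : R := qre q ^ 2 + qim_i q ^ 2 + qim_j q ^ 2 + qim_k q ^ 2.

Lemma qsq_ge_0 (q : quat) : 0 <= qsq q.
Proof. unfold qsq. nra. Qed.

Lemma qnorm_sq (q : quat) : qnorm q ^ 2 = qsq q.
Proof. unfold qnorm. rewrite pow2_sqrt. reflexivity. apply qsq_ge_0. Qed.

Lemma qnorm_ge_0 (q : quat) : 0 <= qnorm q.
Proof. apply sqrt_pos. Qed.

Lemma qsq_mul (p q : quat) : qsq (p * q)%H = qsq p * qsq q.
Proof. qdestruct. unfold qsq. qunfold. ring. Qed.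

Lemma qnorm_mul (p q : quat) : qnorm (p * q)%H = qnorm p * qnorm q.
Proof.
unfold qnorm. fold (qsq (p * q)%H) (qsq p) (qsq q). rewrite qsq_mul.
apply sqrt_mult; apply qsq_ge_0.
Qed.

Lemma qsq_eq_0 (q : quat) : qsq q = 0 -> q = 0%H.
Proof.
unfold qsq. intros H. apply quat_eq; unfold qreal, mkquat; cbn [qre qim_i qim_j qim_k fst snd];
 qdestruct; qunfold; nra.
Qed.

Lemma qnorm_eq_0 (q : quat) : qnorm q = 0 -> q = 0%H.
Proof. intros H. apply qsq_eq_0. rewrite <- qnorm_sq, H. ring. Qed.

Lemma qnorm_qreal (x : R) : qnorm (qreal x) = Rabs x.
Proof.
unfold qnorm. qunfold. rewrite <- (sqrt_Rsqr_abs x). f_equal. unfold Rsqr. ring.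
Qed.

Lemma qnorm_0 : qnorm 0%H = 0.
Proof. rewrite qnorm_qreal. apply Rabs_R0. Qed.

Lemma qnorm_gt_0 (q : quat) : q <> 0%H -> 0 < qnorm q.
Proof.
intros H. destruct (qnorm_ge_0 q) as [|E]; [assumption|].
exfalso. apply H, qnorm_eq_0. now symmetry.
Qed.

Lemma qinv_l (q : quat) : q <> 0%H -> (qinv q * q = 1)%H.
Proof.
intros H. assert (P := pow_lt _ 2 (qnorm_gt_0 q H)).
unfold qinv. rewrite qnorm_sq in *. unfold qsq in *. qdestruct. qunfold.
qsplit; field; lra.
Qed.

Lemma qinv_r (q : quat) : q <> 0%H -> (q * qinv q = 1)%H.
Proof.
intros H. assert (P := pow_lt _ 2 (qnorm_gt_0 q H)).
unfold qinv. rewrite qnorm_sq in *. unfold qsq in *. qdestruct. qunfold.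
qsplit; field; lra.
Qed.

Lemma qmul_eq_0 (p q : quat) : (p * q = 0)%H -> p = 0%H \/ q = 0%H.
Proof.
intros H. assert (E : qnorm p * qnorm q = 0) by now rewrite <- qnorm_mul, H, qnorm_0.
apply Rmult_integral in E. destruct E; [left|right]; now apply qnorm_eq_0.
Qed.

(** * Complex coordinates, slices and their conjugation onto the slice of [i] *)

Definition qC (z : C) : quat := mkquat (fst z) (snd z) 0 0.
(* Coordinates in [q = c1 q + c2 q * j], where [C] is identified with [R + R i]. *)
Definition c1 (q : quat) : C := (qre q, qim_i q).
Definition c2 (q : quat) : C := (qim_j q, qim_k q).
(* [z + w j] *)
Definition qpair (z w : C) : quat := mkquat (fst z) (snd z) (fst w) (snd w).

Lemma c1_qpair (z w : C) : c1 (qpair z w) = z.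
Proof. now destruct z. Qed.
Lemma c2_qpair (z w : C) : c2 (qpair z w) = w.
Proof. now destruct w. Qed.
Lemma qpair_c (q : quat) : qpair (c1 q) (c2 q) = q.
Proof. now destruct q as [[[? ?] ?] ?]. Qed.

Lemma c1_qC_mul (z : C) (q : quat) : c1 (qC z * q)%H = (z * c1 q)%C.
Proof. unfold c1, qC, Cmult. qunfold. apply f_equal2; ring. Qed.
Lemma c2_qC_mul (z : C) (q : quat) : c2 (qC z * q)%H = (z * c2 q)%C.
Proof. unfold c2, qC, Cmult. qunfold. apply f_equal2; ring. Qed.
Lemma c1_mul (p q : quat) : c1 (p * q)%H = (c1 p * c1 q - c2 p * Cconj (c2 q))%C.
Proof. unfold c1, c2, Cconj. apply injective_projections; qunfold; simpl; ring. Qed.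
Lemma c2_mul (p q : quat) : c2 (p * q)%H = (c1 p * c2 q + c2 p * Cconj (c1 q))%C.
Proof. unfold c1, c2, Cconj. apply injective_projections; qunfold; simpl; ring. Qed.

Lemma qC_mul (z w : C) : (qC z * qC w)%H = qC (z * w).
Proof. unfold qC. qunfold. unfold Cmult. simpl. qsplit; ring. Qed.

Lemma qsq_c (q : quat) : qsq q = Cmod (c1 q) ^ 2 + Cmod (c2 q) ^ 2.
Proof. rewrite !Cmod2_alt. unfold qsq, c1, c2. simpl. ring. Qed.

Lemma Cmod_c1_le (q : quat) : Cmod (c1 q) <= qnorm q.
Proof.
apply le_of_sq_le. apply qnorm_ge_0. rewrite qnorm_sq, qsq_c.
assert (H := pow2_ge_0 (Cmod (c2 q))). lra.
Qed.
Lemma Cmod_c2_le (q : quat) : Cmod (c2 q) <= qnorm q.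
Proof.
apply le_of_sq_le. apply qnorm_ge_0. rewrite qnorm_sq, qsq_c.
assert (H := pow2_ge_0 (Cmod (c1 q))). lra.
Qed.

Lemma qnorm_le_c (q : quat) : qnorm q <= Cmod (c1 q) + Cmod (c2 q).
Proof.
assert (H1 := Cmod_ge_0 (c1 q)). assert (H2 := Cmod_ge_0 (c2 q)).
apply le_of_sq_le. lra. rewrite qnorm_sq, qsq_c. nra.
Qed.

Lemma qnorm_qC (z : C) : qnorm (qC z) = Cmod z.
Proof. unfold qnorm, qC, Cmod. qunfold. f_equal. ring. Qed.

Lemma qnorm_re_le (q : quat) : Rabs (qre q) <= qnorm q.
Proof. eapply Rle_trans; [apply (Re_le_Cmod (c1 q))|apply Cmod_c1_le]. Qed.
Lemma qnorm_im_i_le (q : quat) : Rabs (qim_i q) <= qnorm q.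
Proof. eapply Rle_trans; [apply (Im_le_Cmod (c1 q))|apply Cmod_c1_le]. Qed.
Lemma qnorm_im_j_le (q : quat) : Rabs (qim_j q) <= qnorm q.
Proof. eapply Rle_trans; [apply (Re_le_Cmod (c2 q))|apply Cmod_c2_le]. Qed.
Lemma qnorm_im_k_le (q : quat) : Rabs (qim_k q) <= qnorm q.
Proof. eapply Rle_trans; [apply (Im_le_Cmod (c2 q))|apply Cmod_c2_le]. Qed.

Lemma qnorm_le_sum (q : quat) :
  qnorm q <= Rabs (qre q) + Rabs (qim_i q) + Rabs (qim_j q) + Rabs (qim_k q).
Proof.
eapply Rle_trans; [apply qnorm_le_c|].
assert (H1 := Cmod_le_sum (c1 q)). assert (H2 := Cmod_le_sum (c2 q)).
unfold c1, c2 in *; simpl in *. lra.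
Qed.

Definition qdot (p q : quat) : R :=
  qre p * qre q + qim_i p * qim_i q + qim_j p * qim_j q + qim_k p * qim_k q.

(** [qdot p q] is the real part of [qconj p * q], whose squared norm is the right-hand side. *)
Lemma qdot_sq_le (p q : quat) : qdot p q ^ 2 <= qsq p * qsq q.
Proof.
assert (E : qsq p * qsq q = qsq (qconj p * q)%H) by (rewrite qsq_mul; f_equal; unfold qsq; qdestruct; qunfold; ring).
rewrite E. unfold qsq, qdot. qdestruct. qunfold.
match goal with |- ?a ^ 2 <= ?b ^ 2 + ?c ^ 2 + ?d ^ 2 + ?e ^ 2 => replace b with a by ring;
  assert (H1 := pow2_ge_0 c); assert (H2 := pow2_ge_0 d); assert (H3 := pow2_ge_0 e) end. lra.
Qed.

Lemma qnorm_triangle (p q : quat) : qnorm (p + q)%H <= qnorm p + qnorm q.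
Proof.
assert (H1 := qnorm_ge_0 p). assert (H2 := qnorm_ge_0 q).
apply le_of_sq_le. lra.
assert (E : qsq (p + q)%H = qsq p + qsq q + 2 * qdot p q)
  by (unfold qsq, qdot; qdestruct; qunfold; ring).
rewrite qnorm_sq, E, <- !qnorm_sq.
assert (H := qdot_sq_le p q). rewrite <- !qnorm_sq, <- Rpow_mult_distr in H.
assert (qdot p q <= qnorm p * qnorm q); [|nra].
apply Rle_trans with (1 := Rle_abs _). apply le_of_sq_le. nra.
now rewrite pow2_abs.
Qed.

Lemma qnorm_opp (q : quat) : qnorm (qopp q) = qnorm q.
Proof. unfold qnorm. f_equal. qdestruct. qunfold. ring. Qed.

(* Every quaternion has this form.  If [f(q) = sum q^n a_n], then [l * f(rot l z)] is
   [sum z^n (l * a_n)], a holomorphic function of [z] for the left action of [C] on the quaternions. *)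
Definition rot (l : quat) (z : C) : quat := (qinv l * qC z * l)%H.

Lemma qpow_rot (l : quat) (z : C) (n : nat) : l <> 0%H ->
  qpow (rot l z) n = rot l (z ^ n)%C.
Proof.
intros Hl. induction n.
- unfold rot. simpl. replace (qC 1) with 1%H by reflexivity. now rewrite qmul1r, qinv_l.
- simpl. rewrite IHn. unfold rot. rewrite <- (qC_mul z).
  rewrite <- !qmulA. do 2 f_equal. rewrite (qmulA l), (qinv_r l Hl), qmul1l. reflexivity.
Qed.

Lemma mul_rot (l : quat) (z : C) : l <> 0%H -> (l * rot l z = qC z * l)%H.
Proof. intros Hl. unfold rot. now rewrite !qmulA, qinv_r, qmul1l. Qed.

Lemma qnorm_rot (l : quat) (z : C) : l <> 0%H -> qnorm (rot l z) = Cmod z.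
Proof.
intros Hl. apply Rmult_eq_reg_l with (qnorm l). 2: now apply Rgt_not_eq, qnorm_gt_0.
rewrite <- qnorm_mul, mul_rot, qnorm_mul, qnorm_qC by assumption. ring.
Qed.

Definition qi : quat := mkquat 0 1 0 0.

(* [l = 1 - i I] works unless it vanishes, that is [I = - i], when [l = j] does. *)
Lemma imag_unit_rot (I : quat) : imag_unit I ->
  exists l, l <> 0%H /\ forall x y, slice_pt I x y = rot l (x, y).
Proof.
intros HI.
assert (Hl : exists l, l <> 0%H /\ (l * I = qi * l)%H).
{ destruct (Classical_Prop.classic ((1 - qi * I)%H = 0%H)) as [E|E].
  - exists (mkquat 0 0 1 0). split.
    + intros F. injection F. lra.
    + assert (EI : I = qopp qi).
      { replace I with (qopp (qi * (qi * I)))%H by (unfold qi; qring).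
        replace (qi * I)%H with (1 - (1 - qi * I))%H by qring. rewrite E. unfold qi. qring. }
      rewrite EI. unfold qi. qring.
  - exists (1 - qi * I)%H. split; [assumption|].
    transitivity (I - qi * (I * I))%H; [qring|]. rewrite HI. unfold qi. qring. }
destruct Hl as [l [Hl E]]. exists l. split; [assumption|].
intros x y. unfold slice_pt.
transitivity (qinv l * (l * (qreal x + qreal y * I)))%H.
- now rewrite qmulA, qinv_l, qmul1l.
- unfold rot. rewrite <- qmulA. f_equal.
  transitivity (qreal x * l + qreal y * (l * I))%H; [qring|].
  rewrite E. unfold qi, qC. qring.
Qed.

Lemma imag_unit_slice_unit (q : quat) : imag_unit (slice_unit q).
Proof.
unfold slice_unit. destruct (ClassicalEpsilon.excluded_middle_informative (qimag q = 0%H)) as [E|E].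
- unfold imag_unit. qring.
- assert (P := pow_lt _ 2 (qnorm_gt_0 _ E)).
  unfold imag_unit. set (n := qnorm (qimag q)) in *.
  assert (E2 : n ^ 2 = qsq (qimag q)) by apply qnorm_sq.
  assert (n0 : n <> 0) by (intros F; rewrite F in P; lra).
  clearbody n. unfold qimag, qsq in *. qdestruct. qunfold.
  qsplit; try (field; assumption).
  apply Rmult_eq_reg_r with (n ^ 2); [|lra]. rewrite E2 at 2. field. assumption.
Qed.

Lemma slice_pt_slice_unit (q : quat) : slice_pt (slice_unit q) (qre q) (qnorm (qimag q)) = q.
Proof.
unfold slice_pt, slice_unit. destruct (ClassicalEpsilon.excluded_middle_informative (qimag q = 0%H)) as [E|E].
- rewrite E, qnorm_0. unfold qimag in E. qdestruct. qunfold. injection E; intros; subst.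
  qsplit; ring.
- assert (P := qnorm_gt_0 _ E). set (n := qnorm (qimag q)) in *. clearbody n.
  unfold qimag. qdestruct. qunfold. qsplit; field; lra.
Qed.

Lemma exists_rot (q : quat) : exists l z, l <> 0%H /\ q = rot l z /\ Cmod z = qnorm q.
Proof.
destruct (imag_unit_rot _ (imag_unit_slice_unit q)) as [l [Hl H]].
exists l, (qre q, qnorm (qimag q)). rewrite <- H, slice_pt_slice_unit.
repeat split; try assumption.
rewrite <- (slice_pt_slice_unit q) at 3. rewrite H. symmetry. now apply qnorm_rot.
Qed.

Lemma qre_sum_n (c : nat -> quat) (n : nat) : qre (sum_n c n) = sum_n (fun k => qre (c k)) n.
Proof. induction n. now rewrite !sum_O. rewrite !sum_Sn, <- IHn. reflexivity. Qed.
Lemma qim_i_sum_n (c : nat -> quat) (n : nat) : qim_i (sum_n c n) = sum_n (fun k => qim_i (c k)) n.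
Proof. induction n. now rewrite !sum_O. rewrite !sum_Sn, <- IHn. reflexivity. Qed.
Lemma qim_j_sum_n (c : nat -> quat) (n : nat) : qim_j (sum_n c n) = sum_n (fun k => qim_j (c k)) n.
Proof. induction n. now rewrite !sum_O. rewrite !sum_Sn, <- IHn. reflexivity. Qed.
Lemma qim_k_sum_n (c : nat -> quat) (n : nat) : qim_k (sum_n c n) = sum_n (fun k => qim_k (c k)) n.
Proof. induction n. now rewrite !sum_O. rewrite !sum_Sn, <- IHn. reflexivity. Qed.

Lemma filterlim_quat {T : Type} {F : (T -> Prop) -> Prop} {FF : Filter F} (g : T -> quat) (l : quat) :
  filterlim g F (locally l) <->
  filterlim (fun t => qre (g t)) F (locally (qre l)) /\
  filterlim (fun t => qim_i (g t)) F (locally (qim_i l)) /\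
  filterlim (fun t => qim_j (g t)) F (locally (qim_j l)) /\
  filterlim (fun t => qim_k (g t)) F (locally (qim_k l)).
Proof.
split.
- intros H.
  assert (H' : forall eps : posreal, F (fun t => ball l eps (g t))).
  { intros eps. apply (H (ball l eps)). apply locally_ball. }
  repeat split; intros P [eps HP]; unfold filtermap; generalize (H' eps); apply filter_imp;
  intros t Ht; apply HP; unfold ball in Ht; simpl in Ht; unfold prod_ball in Ht; simpl in Ht;
  unfold prod_ball in Ht; simpl in Ht; unfold prod_ball in Ht; apply Ht.
- intros [H1 [H2 [H3 H4]]] P [eps HP].
  assert (A1 := H1 _ (locally_ball _ eps)). assert (A2 := H2 _ (locally_ball _ eps)).
  assert (A3 := H3 _ (locally_ball _ eps)). assert (A4 := H4 _ (locally_ball _ eps)).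
  unfold filtermap in *.
  generalize (filter_and _ _ (filter_and _ _ (filter_and _ _ A1 A2) A3) A4).
  apply filter_imp. intros t Ht. apply HP. exact Ht.
Qed.

Lemma qseries_components (c : nat -> quat) (l : quat) : is_series c l <->
  is_series (fun n => qre (c n)) (qre l) /\ is_series (fun n => qim_i (c n)) (qim_i l) /\
  is_series (fun n => qim_j (c n)) (qim_j l) /\ is_series (fun n => qim_k (c n)) (qim_k l).
Proof.
unfold is_series at 1. rewrite filterlim_quat.
assert (X : forall (f g : nat -> R) (x : R), (forall n, f n = g n) ->
  (filterlim f eventually (locally x) <-> filterlim g eventually (locally x))).
{ intros f g x E. split; apply filterlim_ext; intros; now rewrite E. }
rewrite (X _ _ _ (qre_sum_n c)), (X _ _ _ (qim_i_sum_n c)), (X _ _ _ (qim_j_sum_n c)), (X _ _ _ (qim_k_sum_n c)).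
reflexivity.
Qed.

Lemma qseries_c (c : nat -> quat) (l : quat) : is_series c l <->
  Cseries (fun n => c1 (c n)) (c1 l) /\ Cseries (fun n => c2 (c n)) (c2 l).
Proof.
rewrite qseries_components, !Cseries_components. simpl. tauto.
Qed.

(** * Quaternionic power series *)

Lemma qseries_ext (a b : nat -> quat) (l : quat) : (forall n, a n = b n) -> is_series a l -> is_series b l.
Proof. apply is_series_ext. Qed.

Lemma qseries_plus (a b : nat -> quat) (la lb : quat) : is_series a la -> is_series b lb ->
  is_series (fun n => a n + b n)%H (la + lb)%H.
Proof. apply (is_series_plus (K := R_AbsRing) (V := quat_NormedModule)). Qed.

Lemma qseries_unique (a : nat -> quat) (l l' : quat) : is_series a l -> is_series a l' -> l = l'.
Proof. apply (filterlim_locally_unique (K := R_AbsRing) (V := quat_NormedModule)). Qed.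

Lemma is_series_lin4 (a b c d : nat -> R) (la lb lc ld x y z t : R) :
  is_series a la -> is_series b lb -> is_series c lc -> is_series d ld ->
  is_series (fun n => x * a n + y * b n + z * c n + t * d n) (x * la + y * lb + z * lc + t * ld).
Proof.
intros Ha Hb Hc Hd.
apply (is_series_plus (V := R_NormedModule)); [|now apply (is_series_scal (V := R_NormedModule))].
apply (is_series_plus (V := R_NormedModule)); [|now apply (is_series_scal (V := R_NormedModule))].
apply (is_series_plus (V := R_NormedModule)); now apply (is_series_scal (V := R_NormedModule)).
Qed.

Lemma qseries_mul_l (p : quat) (c : nat -> quat) (l : quat) : is_series c l ->
  is_series (fun n => p * c n)%H (p * l)%H.
Proof.
rewrite !qseries_components. intros [H1 [H2 [H3 H4]]].
destruct p as [[[x y] z] t]. unfold qmul; cbn [mkquat qre qim_i qim_j qim_k fst snd].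
fold (qre l) (qim_i l) (qim_j l) (qim_k l).
repeat split.
- replace (_ - _) with (x * qre l + - y * qim_i l + - z * qim_j l + - t * qim_k l) by (qunfold; ring).
  eapply is_series_ext; [|apply (is_series_lin4 _ _ _ _ _ _ _ _ _ _ _ _ H1 H2 H3 H4)].
  intros; qunfold; as_R; ring.
- replace (_ - _) with (y * qre l + x * qim_i l + - t * qim_j l + z * qim_k l) by (qunfold; ring).
  eapply is_series_ext; [|apply (is_series_lin4 _ _ _ _ _ _ _ _ _ _ _ _ H1 H2 H3 H4)].
  intros; qunfold; as_R; ring.
- replace (_ + _) with (z * qre l + t * qim_i l + x * qim_j l + - y * qim_k l) by (qunfold; ring).
  eapply is_series_ext; [|apply (is_series_lin4 _ _ _ _ _ _ _ _ _ _ _ _ H1 H2 H3 H4)].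
  intros; qunfold; as_R; ring.
- replace (_ + _) with (t * qre l + - z * qim_i l + y * qim_j l + x * qim_k l) by (qunfold; ring).
  eapply is_series_ext; [|apply (is_series_lin4 _ _ _ _ _ _ _ _ _ _ _ _ H1 H2 H3 H4)].
  intros; qunfold; as_R; ring.
Qed.

Lemma qseries_conj (c : nat -> quat) (l : quat) : is_series c l ->
  is_series (fun n => qconj (c n)) (qconj l).
Proof.
rewrite !qseries_components. intros [H1 [H2 [H3 H4]]].
repeat split; try assumption; now apply (is_series_opp (V := R_NormedModule)).
Qed.

(** Conjugation reverses products, which reduces right multiplication to left multiplication. *)
Lemma qseries_mul_r (p : quat) (c : nat -> quat) (l : quat) : is_series c l ->
  is_series (fun n => c n * p)%H (l * p)%H.
Proof.
intros H.
apply (qseries_ext (fun n => qconj (qconj p * qconj (c n)))%H). { intros; qring. }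
replace (l * p)%H with (qconj (qconj p * qconj l))%H by qring.
apply qseries_conj, qseries_mul_l, qseries_conj, H.
Qed.

Lemma qSeries_unique (c : nat -> quat) (l : quat) : is_series c l -> qSeries c = l.
Proof.
rewrite qseries_components. intros [H1 [H2 [H3 H4]]].
apply quat_eq; now apply is_series_unique.
Qed.

Lemma qseries_ex (c : nat -> quat) (b : nat -> R) : ex_series b -> (forall n, qnorm (c n) <= b n) ->
  is_series c (qSeries c).
Proof.
intros Hb Hc. apply qseries_components.
repeat split; apply Series_correct;
apply (ex_series_le (K := R_AbsRing) (V := R_CompleteNormedModule) _ b); try assumption; intros n;
 (eapply Rle_trans; [|apply (Hc n)]).
- apply (qnorm_re_le (c n)).
- apply (qnorm_im_i_le (c n)).
- apply (qnorm_im_j_le (c n)).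
- apply (qnorm_im_k_le (c n)).
Qed.

Lemma qseries_decr_1 (a : nat -> quat) (l : quat) :
  is_series (fun n => a (S n)) l -> is_series a (l + a O)%H.
Proof.
intros H. apply (is_series_decr_1 (V := quat_NormedModule)).
replace (plus _ _) with l; [exact H|].
change (l = l + a O + qopp (a O))%H. qring.
Qed.

Definition qconv (a : nat -> quat) : Prop := conv_disc (fun n => qnorm (a n)).

Lemma qnorm_qpow (q : quat) (n : nat) : qnorm (qpow q n) = qnorm q ^ n.
Proof.
induction n; simpl. rewrite qnorm_qreal. apply Rabs_R1. now rewrite qnorm_mul, IHn.
Qed.

Lemma qpow_qreal (x : R) (n : nat) : qpow (qreal x) n = qreal (x ^ n).
Proof. induction n; simpl. reflexivity. rewrite IHn. qring. Qed.

Lemma power_sum_correct (a : nat -> quat) (q : quat) : qconv a -> in_ball q ->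
  is_series (fun n => qpow q n * a n)%H (power_sum a q).
Proof.
intros Ha Hq. apply (qseries_ex _ (fun n => qnorm (a n) * qnorm q ^ n)).
- apply Ha. split; [apply qnorm_ge_0|assumption].
- intros n. rewrite qnorm_mul, qnorm_qpow, Rmult_comm. lra.
Qed.

(** Were the radius of convergence below s = (1 + r)/2, the terms at [s] would not tend to 0,
    although the series converges there. Since r < s, convergence at [r] is absolute. *)
Lemma ex_series_abs_conv_disc (b : nat -> R) :
  (forall x, 0 <= x < 1 -> ex_series (fun n => x ^ n * b n)) -> conv_disc (fun n => Rabs (b n)).
Proof.
intros H r Hr.
set (s := (1 + r) / 2).
assert (E : Rbar_le s (CV_radius b)).
{ apply Rbar_not_lt_le. intros Hlt.
  apply (CV_disk_outside b s).
  - rewrite Rabs_pos_eq by (unfold s; lra). exact Hlt.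
  - apply (is_lim_seq_ext (fun n => s ^ n * b n)). intros; apply Rmult_comm.
    apply ex_series_lim_0, H. unfold s; lra. }
apply (ex_series_ext (fun n => Rabs (b n * r ^ n))).
- intros n. rewrite Rabs_mult, (Rabs_pos_eq (r ^ n)). reflexivity. apply pow_le; lra.
- apply CV_disk_inside. eapply Rbar_lt_le_trans; [|exact E]. simpl. rewrite Rabs_pos_eq; unfold s; lra.
Qed.

Lemma qpow_qreal_mul (x : R) (n : nat) (q : quat) :
  (qpow (qreal x) n * q)%H = mkquat (x ^ n * qre q) (x ^ n * qim_i q) (x ^ n * qim_j q) (x ^ n * qim_k q).
Proof. rewrite qpow_qreal. qring. Qed.

Lemma in_ball_qreal (x : R) : Rabs x < 1 -> in_ball (qreal x).
Proof. intros H. red. now rewrite qnorm_qreal. Qed.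

(** Real points suffice: there the series splits into four real power series, whose absolute
    convergence bounds the norms of the coefficients. *)
Lemma expands_conv (f : quat -> quat) (a : nat -> quat) : expands f a -> qconv a.
Proof.
intros H r Hr.
assert (X : forall x, 0 <= x < 1 -> ex_series (fun n => x ^ n * qre (a n)) /\ ex_series (fun n => x ^ n * qim_i (a n)) /\
   ex_series (fun n => x ^ n * qim_j (a n)) /\ ex_series (fun n => x ^ n * qim_k (a n))).
{ intros x Hx.
  assert (Hb : in_ball (qreal x)) by (apply in_ball_qreal; rewrite Rabs_pos_eq; lra).
  assert (Y := proj1 (qseries_components _ _) (H _ Hb)). destruct Y as [Y1 [Y2 [Y3 Y4]]].
  repeat split; eexists.
  - eapply is_series_ext; [|exact Y1]. intros n. cbv beta; now rewrite qpow_qreal_mul.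
  - eapply is_series_ext; [|exact Y2]. intros n. cbv beta; now rewrite qpow_qreal_mul.
  - eapply is_series_ext; [|exact Y3]. intros n. cbv beta; now rewrite qpow_qreal_mul.
  - eapply is_series_ext; [|exact Y4]. intros n. cbv beta; now rewrite qpow_qreal_mul. }
assert (C1 := ex_series_abs_conv_disc _ (fun x Hx => proj1 (X x Hx)) r Hr).
assert (C2 := ex_series_abs_conv_disc _ (fun x Hx => proj1 (proj2 (X x Hx))) r Hr).
assert (C3 := ex_series_abs_conv_disc _ (fun x Hx => proj1 (proj2 (proj2 (X x Hx)))) r Hr).
assert (C4 := ex_series_abs_conv_disc _ (fun x Hx => proj2 (proj2 (proj2 (X x Hx)))) r Hr).
assert (Y := ex_series_plus _ _ (ex_series_plus _ _ (ex_series_plus _ _ C1 C2) C3) C4).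
apply (ex_series_le (K := R_AbsRing) (V := R_CompleteNormedModule) _ _ ) with (2 := Y).
intros n. assert (Hn : 0 <= r ^ n) by (apply pow_le; lra).
change (norm _) with (Rabs (qnorm (a n) * r ^ n)).
rewrite Rabs_pos_eq by (apply Rmult_le_pos; [apply qnorm_ge_0|assumption]).
unfold plus; simpl. rewrite <- !Rmult_plus_distr_r. apply Rmult_le_compat_r. assumption.
apply qnorm_le_sum.
Qed.

Lemma expands_power_sum (a : nat -> quat) : qconv a -> expands (power_sum a) a.
Proof. intros H q Hq. now apply power_sum_correct. Qed.

Lemma expands_eq (f : quat -> quat) (a : nat -> quat) (q : quat) :
  expands f a -> in_ball q -> f q = power_sum a q.
Proof. intros H Hq. symmetry. apply qSeries_unique. now apply H. Qed.

Lemma real_coeffs_unique (rho : R) (a b : nat -> R) : 0 < rho ->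
  (forall x, Rabs x < rho -> exists l, is_series (fun n => x ^ n * a n) l /\ is_series (fun n => x ^ n * b n) l) ->
  forall n, a n = b n.
Proof.
intros Hr H n.
assert (P : forall c, (forall x, Rabs x < rho -> exists l, is_series (fun n => x ^ n * c n) l) -> Rbar_lt 0 (CV_radius c)).
{ intros c Hc. apply Rbar_lt_le_trans with (rho / 2). simpl; lra.
  apply Rbar_not_lt_le. intros Hlt. apply (CV_disk_outside c (rho / 2)).
  - rewrite Rabs_pos_eq by lra. exact Hlt.
  - apply (is_lim_seq_ext (fun n => (rho / 2) ^ n * c n)). intros; apply Rmult_comm.
    apply ex_series_lim_0. apply Hc. rewrite Rabs_pos_eq; lra. }
apply PSeries_ext_recip.
- apply P. intros x Hx. destruct (H x Hx) as [l [Hl _]]. now exists l.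
- apply P. intros x Hx. destruct (H x Hx) as [l [_ Hl]]. now exists l.
- exists (mkposreal _ Hr). intros x Hx.
  assert (Hx' : Rabs x < rho).
  { change (Rabs (x - 0) < rho) in Hx. now rewrite Rminus_0_r in Hx. }
  destruct (H x Hx') as [l [H1 H2]].
  transitivity l; [|symmetry]; apply is_series_unique.
  + eapply is_series_ext; [|exact H1]. intros; apply Rmult_comm.
  + eapply is_series_ext; [|exact H2]. intros; apply Rmult_comm.
Qed.

(** Only values on a real interval around 0 enter. Every slice contains that interval, which makes
    expansions found on different slices comparable. *)
Lemma qcoeffs_unique (rho : R) (a b : nat -> quat) (f : R -> quat) : 0 < rho ->
  (forall x, Rabs x < rho -> is_series (fun n => qpow (qreal x) n * a n)%H (f x)) ->
  (forall x, Rabs x < rho -> is_series (fun n => qpow (qreal x) n * b n)%H (f x)) ->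
  forall n, a n = b n.
Proof.
intros Hr Ha Hb n.
assert (X : forall c, (forall x, Rabs x < rho -> is_series (fun n => qpow (qreal x) n * c n)%H (f x)) ->
  forall x, Rabs x < rho -> is_series (fun n => x ^ n * qre (c n)) (qre (f x)) /\
   is_series (fun n => x ^ n * qim_i (c n)) (qim_i (f x)) /\
   is_series (fun n => x ^ n * qim_j (c n)) (qim_j (f x)) /\
   is_series (fun n => x ^ n * qim_k (c n)) (qim_k (f x))).
{ intros c Hc x Hx.
  assert (Y := proj1 (qseries_components _ _) (Hc x Hx)). destruct Y as [Y1 [Y2 [Y3 Y4]]].
  repeat split.
  - eapply is_series_ext; [|exact Y1]. intros k. cbv beta; now rewrite qpow_qreal_mul.
  - eapply is_series_ext; [|exact Y2]. intros k. cbv beta; now rewrite qpow_qreal_mul.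
  - eapply is_series_ext; [|exact Y3]. intros k. cbv beta; now rewrite qpow_qreal_mul.
  - eapply is_series_ext; [|exact Y4]. intros k. cbv beta; now rewrite qpow_qreal_mul. }
assert (Xa := X a Ha). assert (Xb := X b Hb).
apply quat_eq.
- apply (real_coeffs_unique rho (fun n => qre (a n)) (fun n => qre (b n)) Hr).
  intros x Hx. exists (qre (f x)). split. apply (Xa x Hx). apply (Xb x Hx).
- apply (real_coeffs_unique rho (fun n => qim_i (a n)) (fun n => qim_i (b n)) Hr).
  intros x Hx. exists (qim_i (f x)). split. apply (Xa x Hx). apply (Xb x Hx).
- apply (real_coeffs_unique rho (fun n => qim_j (a n)) (fun n => qim_j (b n)) Hr).
  intros x Hx. exists (qim_j (f x)). split. apply (Xa x Hx). apply (Xb x Hx).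
- apply (real_coeffs_unique rho (fun n => qim_k (a n)) (fun n => qim_k (b n)) Hr).
  intros x Hx. exists (qim_k (f x)). split. apply (Xa x Hx). apply (Xb x Hx).
Qed.

(** [epsilon] yields an expansion as soon as one exists, and uniqueness identifies it; this makes
    [regular_mul] and [regular_conj] computable on known expansions. *)
Lemma coeffs_unique (f : quat -> quat) (a : nat -> quat) : expands f a -> forall n, coeffs f n = a n.
Proof.
intros H.
assert (Hc : expands f (coeffs f)).
{ unfold coeffs. apply ClassicalEpsilon.epsilon_spec. now exists a. }
apply (qcoeffs_unique 1 _ _ (fun x => f (qreal x))); [lra| |]; intros x Hx;
 [apply Hc|apply H]; now apply in_ball_qreal.
Qed.

Lemma power_sum_ext (a b : nat -> quat) (q : quat) : (forall n, a n = b n) -> power_sum a q = power_sum b q.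
Proof. intros E. unfold power_sum, qSeries. apply quat_eq; apply Series_ext; intros n; now rewrite E. Qed.

Definition qdcoef (a : nat -> quat) (n : nat) : quat := (qreal (INR (S n)) * a (S n))%H.

Lemma qconv_qdcoef (a : nat -> quat) : qconv a -> qconv (qdcoef a).
Proof.
intros H. apply (conv_disc_ext (PS_derive (fun n => qnorm (a n)))).
- intros n. unfold qdcoef, PS_derive. rewrite qnorm_mul, qnorm_qreal, Rabs_pos_eq. reflexivity. apply pos_INR.
- apply conv_disc_derive; [|exact H]. intros; apply qnorm_ge_0.
Qed.

Lemma conv_disc_le (a b : nat -> R) : (forall n, 0 <= a n <= b n) -> conv_disc b -> conv_disc a.
Proof.
intros E H r Hr. apply (ex_series_le (K := R_AbsRing) (V := R_CompleteNormedModule) _ (fun n => b n * r ^ n)).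
- intros n. assert (0 <= r ^ n) by (apply pow_le; lra).
  change (norm _) with (Rabs (a n * r ^ n)). destruct (E n).
  rewrite Rabs_pos_eq. now apply Rmult_le_compat_r. now apply Rmult_le_pos.
- now apply H.
Qed.

Lemma conv_disc_scal (k : R) (b : nat -> R) : conv_disc b -> conv_disc (fun n => k * b n).
Proof.
intros H r Hr. apply (ex_series_ext (fun n => k * (b n * r ^ n))).
- intros; as_R; ring.
- apply (ex_series_scal (V := R_NormedModule)). now apply H.
Qed.

Lemma conv_c1 (l : quat) (a : nat -> quat) : qconv a -> conv_disc (fun n => Cmod (c1 (l * a n)%H)).
Proof.
intros H. apply (conv_disc_le _ (fun n => qnorm l * qnorm (a n))).
- intros n. split. apply Cmod_ge_0. rewrite <- qnorm_mul. apply Cmod_c1_le.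
- now apply conv_disc_scal.
Qed.

Lemma conv_c2 (l : quat) (a : nat -> quat) : qconv a -> conv_disc (fun n => Cmod (c2 (l * a n)%H)).
Proof.
intros H. apply (conv_disc_le _ (fun n => qnorm l * qnorm (a n))).
- intros n. split. apply Cmod_ge_0. rewrite <- qnorm_mul. apply Cmod_c2_le.
- now apply conv_disc_scal.
Qed.

Lemma power_sum_rot (l : quat) (a : nat -> quat) (z : C) : qconv a -> l <> 0%H -> Cmod z < 1 ->
  (l * power_sum a (rot l z))%H = qpair (Csum (fun n => c1 (l * a n)%H) z) (Csum (fun n => c2 (l * a n)%H) z).
Proof.
intros Ha Hl Hz.
assert (Hb : in_ball (rot l z)) by (red; now rewrite qnorm_rot).
assert (H := qseries_mul_l l _ _ (power_sum_correct a _ Ha Hb)).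
assert (E : forall n, (l * (qpow (rot l z) n * a n) = qC (z ^ n) * (l * a n))%H).
{ intros n. rewrite qpow_rot by assumption. now rewrite qmulA, mul_rot, <- qmulA. }
apply (qseries_ext _ _ _ E) in H. apply qseries_c in H. destruct H as [H1 H2].
rewrite <- (qpair_c (l * power_sum a (rot l z))%H). f_equal.
- apply (Cseries_unique _ _ _ H1). apply (Cseries_ext (fun n => z ^ n * c1 (l * a n)%H)%C).
  intros; now rewrite c1_qC_mul. apply Csum_correct; [|assumption]. now apply conv_c1.
- apply (Cseries_unique _ _ _ H2). apply (Cseries_ext (fun n => z ^ n * c2 (l * a n)%H)%C).
  intros; now rewrite c2_qC_mul. apply Csum_correct; [|assumption]. now apply conv_c2.
Qed.

Lemma Csum_ext (a b : nat -> C) (z : C) : (forall n, a n = b n) -> Csum a z = Csum b z.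
Proof. intros E. unfold Csum. f_equal; apply Series_ext; intros n; now rewrite E. Qed.

Lemma c1_qdcoef (l : quat) (a : nat -> quat) (n : nat) :
  c1 (l * qdcoef a n)%H = Cdcoef (fun n => c1 (l * a n)%H) n.
Proof.
unfold Cdcoef, qdcoef. generalize (INR (S n)), (a (S n)). intros x q.
unfold c1. apply injective_projections; qdestruct; qunfold; simpl; ring.
Qed.

Lemma c2_qdcoef (l : quat) (a : nat -> quat) (n : nat) :
  c2 (l * qdcoef a n)%H = Cdcoef (fun n => c2 (l * a n)%H) n.
Proof.
unfold Cdcoef, qdcoef. generalize (INR (S n)), (a (S n)). intros x q.
unfold c2. apply injective_projections; qdestruct; qunfold; simpl; ring.
Qed.

Lemma power_sum_qdcoef_rot (l : quat) (a : nat -> quat) (z : C) : qconv a -> l <> 0%H -> Cmod z < 1 ->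
  (l * power_sum (qdcoef a) (rot l z))%H =
  qpair (Csum (Cdcoef (fun n => c1 (l * a n)%H)) z) (Csum (Cdcoef (fun n => c2 (l * a n)%H)) z).
Proof.
intros Ha Hl Hz. rewrite power_sum_rot; try assumption. 2: now apply qconv_qdcoef.
f_equal; apply Csum_ext; intros n. apply c1_qdcoef. apply c2_qdcoef.
Qed.

(** * Slice regular functions and power series *)

Definition is_qderive (g : R -> quat) (t : R) (d : quat) : Prop :=
  is_derive (fun s => qre (g s)) t (qre d) /\ is_derive (fun s => qim_i (g s)) t (qim_i d) /\
  is_derive (fun s => qim_j (g s)) t (qim_j d) /\ is_derive (fun s => qim_k (g s)) t (qim_k d).

Lemma is_qderive_qDerive (g : R -> quat) (t : R) (d : quat) : is_qderive g t d -> qDerive g t = d.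
Proof.
intros [H1 [H2 [H3 H4]]]. apply quat_eq; now apply is_derive_unique.
Qed.

Lemma is_derive_iff_little_o {V : NormedModule R_AbsRing} (g : R -> V) (t : R) (d : V) :
  is_derive g t d <->
  forall eps : posreal, locally t (fun s => norm (minus (minus (g s) (g t)) (scal (s - t) d)) <= eps * Rabs (s - t)).
Proof.
split.
- intros [_ H] eps. exact (H t (fun P H => H) eps).
- intros H. split; [apply is_linear_scal_l|].
  intros x Hx eps.
  assert (E : x = t) by (symmetry; exact (is_filter_lim_locally_unique (V := R_NormedModule) t x Hx)).
  subst x. exact (H eps).
Qed.

Lemma qnorm_norm (q : quat) : norm q = qnorm q.
Proof.
destruct q as [[[a b] c] d].
unfold norm; simpl. unfold prod_norm. simpl. unfold norm; simpl. unfold prod_norm; simpl.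
unfold norm; simpl. unfold prod_norm; simpl. unfold norm; simpl. unfold abs; simpl.
unfold qnorm. qunfold. f_equal.
rewrite !Rmult_1_r, !sqrt_sqrt.
rewrite <- !Rabs_mult, !Rabs_pos_eq. ring.
all: try nra.
all: repeat apply Rplus_le_le_0_compat; try (rewrite <- Rabs_mult; apply Rabs_pos); try apply sqrt_pos.
all: try (apply Rmult_le_pos; apply sqrt_pos).
Qed.

(** Links the two notions of derivative in the definitions: [ex_derive] refers to the normed module
    of quaternions, [qDerive] is assembled from four real derivatives. *)
Lemma ex_derive_is_qderive (g : R -> quat) (t : R) : ex_derive g t <-> is_qderive g t (qDerive g t).
Proof.
split.
- intros [d Hd].
  assert (X : is_qderive g t d).
  { generalize (proj1 (is_derive_iff_little_o g t d) Hd). clear Hd. intros Hd.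
    split; [|split; [|split]]; refine (proj2 (is_derive_iff_little_o (V := R_NormedModule) _ _ _) _); intros eps; generalize (Hd eps); apply filter_imp; intros s Hs;
    (eapply Rle_trans; [|exact Hs]); rewrite qnorm_norm.
    - apply (qnorm_re_le (minus (minus (g s) (g t)) (scal (s - t) d))).
    - apply (qnorm_im_i_le (minus (minus (g s) (g t)) (scal (s - t) d))).
    - apply (qnorm_im_j_le (minus (minus (g s) (g t)) (scal (s - t) d))).
    - apply (qnorm_im_k_le (minus (minus (g s) (g t)) (scal (s - t) d))). }
  now rewrite (is_qderive_qDerive _ _ _ X).
- set (d := qDerive g t). intros [H1 [H2 [H3 H4]]]. exists d. apply is_derive_iff_little_o. intros eps.
  assert (He : 0 < eps / 4) by (destruct eps; simpl; lra).
  assert (L1 := proj1 (is_derive_iff_little_o _ _ _) H1 (mkposreal _ He)).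
  assert (L2 := proj1 (is_derive_iff_little_o _ _ _) H2 (mkposreal _ He)).
  assert (L3 := proj1 (is_derive_iff_little_o _ _ _) H3 (mkposreal _ He)).
  assert (L4 := proj1 (is_derive_iff_little_o _ _ _) H4 (mkposreal _ He)).
  generalize (filter_and _ _ (filter_and _ _ L1 L2) (filter_and _ _ L3 L4)).
  apply filter_imp. intros s [[K1 K2] [K3 K4]]. rewrite qnorm_norm.
  eapply Rle_trans; [apply qnorm_le_sum|]. simpl in K1, K2, K3, K4.
  match goal with |- Rabs (qre ?x) + _ + _ + _ <= _ => set (D := x) end.
  change (Rabs (qre D) <= eps / 4 * Rabs (s - t)) in K1.
  change (Rabs (qim_i D) <= eps / 4 * Rabs (s - t)) in K2.
  change (Rabs (qim_j D) <= eps / 4 * Rabs (s - t)) in K3.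
  change (Rabs (qim_k D) <= eps / 4 * Rabs (s - t)) in K4.
  clearbody D.
  lra.
Qed.

Lemma is_derive_lin4 (a b c d : R -> R) (t da db dc dd x y z w : R) :
  is_derive a t da -> is_derive b t db -> is_derive c t dc -> is_derive d t dd ->
  is_derive (fun s => x * a s + y * b s + z * c s + w * d s) t (x * da + y * db + z * dc + w * dd).
Proof.
intros Ha Hb Hc Hd.
apply (is_derive_plus (V := R_NormedModule)); [|now apply is_derive_scal].
apply (is_derive_plus (V := R_NormedModule)); [|now apply is_derive_scal].
apply (is_derive_plus (V := R_NormedModule)); now apply is_derive_scal.
Qed.

Lemma is_qderive_mul_l (p : quat) (g : R -> quat) (t : R) (d : quat) : is_qderive g t d ->
  is_qderive (fun s => p * g s)%H t (p * d)%H.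
Proof.
intros [H1 [H2 [H3 H4]]]. destruct p as [[[x y] z] w].
split; [|split; [|split]].
- replace (qre _) with (x * qre d + - y * qim_i d + - z * qim_j d + - w * qim_k d) by (qunfold; ring).
  eapply is_derive_ext; [|apply (is_derive_lin4 _ _ _ _ _ _ _ _ _ _ _ _ _ H1 H2 H3 H4)].
  intros; qunfold; as_R; ring.
- replace (qim_i _) with (y * qre d + x * qim_i d + - w * qim_j d + z * qim_k d) by (qunfold; ring).
  eapply is_derive_ext; [|apply (is_derive_lin4 _ _ _ _ _ _ _ _ _ _ _ _ _ H1 H2 H3 H4)].
  intros; qunfold; as_R; ring.
- replace (qim_j _) with (z * qre d + w * qim_i d + x * qim_j d + - y * qim_k d) by (qunfold; ring).
  eapply is_derive_ext; [|apply (is_derive_lin4 _ _ _ _ _ _ _ _ _ _ _ _ _ H1 H2 H3 H4)].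
  intros; qunfold; as_R; ring.
- replace (qim_k _) with (w * qre d + - z * qim_i d + y * qim_j d + x * qim_k d) by (qunfold; ring).
  eapply is_derive_ext; [|apply (is_derive_lin4 _ _ _ _ _ _ _ _ _ _ _ _ _ H1 H2 H3 H4)].
  intros; qunfold; as_R; ring.
Qed.

Lemma is_qderive_ext_loc (f g : R -> quat) (t : R) (d : quat) : locally t (fun s => f s = g s) ->
  is_qderive f t d -> is_qderive g t d.
Proof.
intros E [H1 [H2 [H3 H4]]].
split; [|split; [|split]]; (eapply is_derive_ext_loc; [|eassumption]); generalize E; apply filter_imp; intros s Hs; now rewrite Hs.
Qed.

Lemma Cderive_Re_Im (u : C -> C) (g : R -> C) (t : R) (d v : C) : Cderive u (g t) d ->
  is_derive (fun s => Re (g s)) t (Re v) -> is_derive (fun s => Im (g s)) t (Im v) ->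
  is_derive (fun s => Re (u (g s))) t (Re (d * v)) /\ is_derive (fun s => Im (u (g s))) t (Im (d * v)).
Proof.
intros H H1 H2. split.
- generalize (Cderive_curve u g t 1 d v H H1 H2).
  rewrite Cmult_1_l. apply is_derive_ext. intros s. now rewrite Cmult_1_l.
- generalize (Cderive_curve u g t (- Ci) d v H H1 H2).
  replace (Re (- Ci * d * v)) with (Im (d * v)) by (unfold Re, Im; simpl; ring).
  apply is_derive_ext. intros s. unfold Re, Im; simpl; as_R; ring.
Qed.

Lemma is_qderive_qpair (u v : C -> C) (g : R -> C) (t : R) (d e w : C) :
  Cderive u (g t) d -> Cderive v (g t) e ->
  is_derive (fun s => Re (g s)) t (Re w) -> is_derive (fun s => Im (g s)) t (Im w) ->
  is_qderive (fun s => qpair (u (g s)) (v (g s))) t (qpair (d * w) (e * w)).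
Proof.
intros Hu Hv H1 H2.
destruct (Cderive_Re_Im u g t d w Hu H1 H2). destruct (Cderive_Re_Im v g t e w Hv H1 H2).
split; [|split; [|split]]; assumption.
Qed.

Lemma locally_Cmod_lt_1 {T : UniformSpace} (g : T -> C) (t : T) : Ccont g t -> Cmod (g t) < 1 -> locally t (fun s => Cmod (g s) < 1).
Proof.
intros Hc H1. assert (He : 0 < 1 - Cmod (g t)) by lra.
generalize (proj1 (Ccont_eps g t) Hc (mkposreal _ He)). apply filter_imp. intros s Hs. simpl in Hs.
replace (g s) with (g t + (g s - g t))%C by ring.
eapply Rle_lt_trans; [apply Cmod_triangle|]. lra.
Qed.

Lemma slice_pt_0_1 (I : quat) : slice_pt I 0 1 = I.
Proof. unfold slice_pt. qring. Qed.

Section PowerSumSlice.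

Variables (f : quat -> quat) (a : nat -> quat) (I l : quat).
Hypothesis Hf : expands f a.
Hypothesis Hl : l <> 0%H.
Hypothesis HI : forall x y, slice_pt I x y = rot l (x, y).

Let Ha : qconv a := expands_conv f a Hf.

Lemma slice_curve_deriv (g : R -> C) (t : R) (w : C) : Cmod (g t) < 1 -> Ccont g t ->
  is_derive (fun s => Re (g s)) t (Re w) -> is_derive (fun s => Im (g s)) t (Im w) ->
  is_qderive (fun s => f (rot l (g s))) t (rot l w * power_sum (qdcoef a) (rot l (g t)))%H.
Proof.
intros Hg Hc H1 H2.
apply (is_qderive_ext_loc (fun s => qinv l * (l * power_sum a (rot l (g s))))%H).
{ generalize (locally_Cmod_lt_1 g t Hc Hg). apply filter_imp. intros s Hs.
  rewrite qmulA, qinv_l, qmul1l by assumption. symmetry. apply expands_eq; [assumption|].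
  red. now rewrite qnorm_rot. }
unfold rot at 2. rewrite <- !qmulA. apply is_qderive_mul_l.
rewrite power_sum_qdcoef_rot by assumption.
apply (is_qderive_ext_loc (fun s => qpair (Csum (fun n => c1 (l * a n)%H) (g s)) (Csum (fun n => c2 (l * a n)%H) (g s)))).
{ generalize (locally_Cmod_lt_1 g t Hc Hg). apply filter_imp. intros s Hs. now rewrite power_sum_rot. }
match goal with |- is_qderive _ _ (qC w * qpair ?d ?e)%H =>
  replace (qC w * qpair d e)%H with (qpair (d * w) (e * w)) end.
2:{ unfold qpair, qC, Cmult; simpl. qunfold. qsplit; ring. }
apply is_qderive_qpair; try assumption; apply Cderive_Csum; try assumption.
now apply conv_c1. now apply conv_c2.
Qed.

Lemma slice_deriv_x (x y : R) : in_ball (slice_pt I x y) ->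
  is_qderive (fun t => f (slice_pt I t y)) x (power_sum (qdcoef a) (slice_pt I x y)).
Proof.
intros Hb. rewrite HI in *. red in Hb. rewrite qnorm_rot in Hb by assumption.
apply (is_qderive_ext_loc (fun t => f (rot l (t, y)))).
{ apply filter_forall. intros. now rewrite HI. }
replace (power_sum _ _) with (rot l (RtoC 1%R) * power_sum (qdcoef a) (rot l (x, y)))%H.
- apply (slice_curve_deriv (fun t => (t, y)) x 1); try assumption.
  + apply Ccont_pair. apply continuous_id. apply continuous_const.
  + change (is_derive (fun t : R => t) x 1). auto_derive; auto.
  + change (is_derive (fun _ : R => y) x 0). auto_derive; auto.
- unfold rot at 1. replace (qC 1) with 1%H by reflexivity. now rewrite qmul1r, qinv_l, qmul1l.
Qed.

Lemma slice_deriv_y (x y : R) : in_ball (slice_pt I x y) ->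
  is_qderive (fun t => f (slice_pt I x t)) y (I * power_sum (qdcoef a) (slice_pt I x y))%H.
Proof.
intros Hb.
assert (EI : I = rot l (0, 1)) by (now rewrite <- HI, slice_pt_0_1).
rewrite HI in Hb |- *. red in Hb. rewrite qnorm_rot in Hb by assumption.
apply (is_qderive_ext_loc (fun t => f (rot l (x, t)))).
{ apply filter_forall. intros. now rewrite HI. }
rewrite EI. apply (slice_curve_deriv (fun t => (x, t)) y (0, 1)); try assumption.
+ apply Ccont_pair. apply continuous_const. apply continuous_id.
+ change (is_derive (fun _ : R => x) y 0). auto_derive; auto.
+ change (is_derive (fun t : R => t) y 1). auto_derive; auto.
Qed.

End PowerSumSlice.

Notation R2 := (prod_UniformSpace R_UniformSpace R_UniformSpace).

Lemma continuous_lin4 {T : UniformSpace} (a b c d : T -> R) (t : T) (x y z w : R) :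
  continuous a t -> continuous b t -> continuous c t -> continuous d t ->
  continuous (fun s => x * a s + y * b s + z * c s + w * d s) t.
Proof.
intros Ha Hb Hc Hd.
assert (S : forall (k : R) (f : T -> R), continuous f t -> continuous (fun s => k * f s) t).
{ intros k f Hf. apply (continuous_mult (K := R_AbsRing)); [apply continuous_const|exact Hf]. }
exact (continuous_plus (V := R_NormedModule) _ _ _ (continuous_plus (V := R_NormedModule) _ _ _
  (continuous_plus (V := R_NormedModule) _ _ _ (S x a Ha) (S y b Hb)) (S z c Hc)) (S w d Hd)).
Qed.

Lemma continuous_quat {T : UniformSpace} (g : T -> quat) (t : T) : continuous g t <->
  continuous (fun s => qre (g s)) t /\ continuous (fun s => qim_i (g s)) t /\
  continuous (fun s => qim_j (g s)) t /\ continuous (fun s => qim_k (g s)) t.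
Proof. apply filterlim_quat. Qed.

Lemma continuous_qmul_l {T : UniformSpace} (p : quat) (g : T -> quat) (t : T) : continuous g t ->
  continuous (fun s => p * g s)%H t.
Proof.
rewrite !continuous_quat. intros [H1 [H2 [H3 H4]]]. destruct p as [[[x y] z] w].
assert (L := fun x y z w => continuous_lin4 _ _ _ _ t x y z w H1 H2 H3 H4).
split; [|split; [|split]].
- eapply continuous_ext; [|apply (L x (-y) (-z) (-w))]. intros; qunfold; as_R; ring.
- eapply continuous_ext; [|apply (L y x (-w) z)]. intros; qunfold; as_R; ring.
- eapply continuous_ext; [|apply (L z w x (-y))]. intros; qunfold; as_R; ring.
- eapply continuous_ext; [|apply (L w (-z) y x)]. intros; qunfold; as_R; ring.
Qed.

Lemma continuous_qpair {T : UniformSpace} (u v : T -> C) (t : T) : Ccont u t -> Ccont v t ->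
  continuous (fun s => qpair (u s) (v s)) t.
Proof.
intros Hu Hv. apply continuous_quat. split; [|split; [|split]].
- apply (continuous_Re u t Hu). - apply (continuous_Im u t Hu).
- apply (continuous_Re v t Hv). - apply (continuous_Im v t Hv).
Qed.

Lemma Ccont_R2 (p : R * R) : Ccont (T := R2) (fun q => q : C) p.
Proof.
apply (continuous_ext (U := CU) (fun q : R2 => (fst q, snd q) : C)).
- now intros [x y].
- apply (Ccont_pair (T := R2) fst snd); [apply continuous_fst|apply continuous_snd].
Qed.

Lemma slice_pt_in_ball (I l : quat) (x y : R) : l <> 0%H ->
  (forall x y, slice_pt I x y = rot l (x, y)) -> (in_ball (slice_pt I x y) <-> Cmod (x, y) < 1).
Proof. intros Hl HI. unfold in_ball. rewrite HI, qnorm_rot by assumption. tauto. Qed.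

Lemma continuous_power_sum_rot (b : nat -> quat) (l : quat) (p : R * R) : qconv b -> l <> 0%H ->
  Cmod p < 1 -> continuous (T := R2) (fun q => power_sum b (rot l q)) p.
Proof.
intros Hb Hl Hp.
apply (continuous_ext_loc (T := R2) _ (fun q => qinv l * qpair (Csum (fun n => c1 (l * b n)%H) q) (Csum (fun n => c2 (l * b n)%H) q))%H).
- generalize (locally_Cmod_lt_1 (T := R2) (fun q => q) p (Ccont_R2 p) Hp). apply filter_imp. intros q Hq.
  rewrite <- power_sum_rot by assumption. now rewrite qmulA, qinv_l, qmul1l.
- apply (continuous_qmul_l (T := R2)). apply (continuous_qpair (T := R2)).
  + apply (Ccont_comp (T := R2) (Csum _) (fun q => q)). apply Ccont_R2.
    eapply Cderive_cont. apply Cderive_Csum; [|assumption]. now apply conv_c1.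
  + apply (Ccont_comp (T := R2) (Csum _) (fun q => q)). apply Ccont_R2.
    eapply Cderive_cont. apply Cderive_Csum; [|assumption]. now apply conv_c2.
Qed.

Lemma expands_slice_regular (f : quat -> quat) (a : nat -> quat) : expands f a -> slice_regular f.
Proof.
intros Hf I x y HI Hb.
assert (Hd := qconv_qdcoef a (expands_conv f a Hf)).
destruct (imag_unit_rot I HI) as [l [Hl HIl]].
assert (Hloc : locally (T := R2) (x, y) (fun p => in_ball (slice_pt I (fst p) (snd p)))).
{ generalize (locally_Cmod_lt_1 (T := R2) (fun q => q) (x, y) (Ccont_R2 _)
    (proj1 (slice_pt_in_ball I l x y Hl HIl) Hb)).
  apply filter_imp. intros [u v] H. now apply (slice_pt_in_ball I l). }
assert (Dx := fun x y Hb => slice_deriv_x f a I l Hf Hl HIl x y Hb).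
assert (Dy := fun x y Hb => slice_deriv_y f a I l Hf Hl HIl x y Hb).
assert (Ex : forall x y, in_ball (slice_pt I x y) -> partial_x f I x y = power_sum (qdcoef a) (slice_pt I x y)).
{ intros. now apply is_qderive_qDerive, Dx. }
assert (Ey : forall x y, in_ball (slice_pt I x y) -> partial_y f I x y = (I * power_sum (qdcoef a) (slice_pt I x y))%H).
{ intros. now apply is_qderive_qDerive, Dy. }
assert (Hcont : continuous (T := R2) (fun p => power_sum (qdcoef a) (slice_pt I (fst p) (snd p))) (x, y)).
{ apply (continuous_ext (T := R2) (fun p => power_sum (qdcoef a) (rot l p))).
  - intros [u v]. now rewrite HIl.
  - apply continuous_power_sum_rot; try assumption. now apply (slice_pt_in_ball I l). }
split; [|split; [|split; [|split]]].
- apply ex_derive_is_qderive. change (is_qderive (fun t => f (slice_pt I t y)) x (partial_x f I x y)). rewrite Ex by assumption. now apply Dx.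
- apply ex_derive_is_qderive. change (is_qderive (fun t => f (slice_pt I x t)) y (partial_y f I x y)). rewrite Ey by assumption. now apply Dy.
- apply (continuous_ext_loc (T := R2) _ (fun p => power_sum (qdcoef a) (slice_pt I (fst p) (snd p)))); [|assumption].
  generalize Hloc. apply filter_imp. intros p Hp. now rewrite Ex.
- apply (continuous_ext_loc (T := R2) _ (fun p => I * power_sum (qdcoef a) (slice_pt I (fst p) (snd p)))%H).
  + generalize Hloc. apply filter_imp. intros p Hp. now rewrite Ey.
  + now apply (continuous_qmul_l (T := R2)).
- rewrite Ex, Ey, qmulA, HI by assumption. generalize (power_sum (qdcoef a) (slice_pt I x y)).
  clear. qring.
Qed.

(** With P the sum of the derived series, the partial derivatives are P and I P, and half of P - I
    (I P) is P. *)
Lemma slice_derivative_expands (f : quat -> quat) (a : nat -> quat) (q : quat) : expands f a -> in_ball q ->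
  slice_derivative f q = power_sum (qdcoef a) q.
Proof.
intros Hf Hq. assert (HI := imag_unit_slice_unit q).
assert (Hs := slice_pt_slice_unit q). unfold slice_derivative. cbv zeta.
set (I := slice_unit q) in *. set (x := qre q) in *. set (y := qnorm (qimag q)) in *.
destruct (imag_unit_rot I HI) as [l [Hl HIl]].
assert (Hb : in_ball (slice_pt I x y)) by now rewrite Hs.
unfold partial_x, partial_y.
rewrite (is_qderive_qDerive _ _ _ (slice_deriv_x f a I l Hf Hl HIl x y Hb)).
rewrite (is_qderive_qDerive _ _ _ (slice_deriv_y f a I l Hf Hl HIl x y Hb)).
rewrite qmulA, HI, Hs. generalize (power_sum (qdcoef a) q). clear. intros p.
unfold qsub, qopp. qdestruct. qunfold. qsplit; lra.
Qed.

Lemma cauchy_riemann_solve (I p q : quat) : imag_unit I ->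
  (qreal (1 / 2) * (p + I * q) = 0)%H -> q = (I * p)%H.
Proof.
intros HI H.
assert (E : (p + I * q = 0)%H).
{ replace (p + I * q)%H with (qreal 2 * (qreal (1 / 2) * (p + I * q)))%H.
  rewrite H. apply qmul0r. rewrite qmulA. replace (qreal 2 * qreal (1 / 2))%H with 1%H.
  apply qmul1l. qunfold. qsplit; field. }
transitivity (qopp (I * I * q)); [rewrite HI; qring|].
replace p with (p + I * q - I * q)%H by (qring).
rewrite E. qring.
Qed.

Lemma diff_expand (l A B P I : quat) (s t : R) :
  (l * (A - B - (qreal s * P + qreal t * (I * P))) =
   l * A - l * B - (qreal s * (l * P) + qreal t * (l * I * P)))%H.
Proof. qring. Qed.

Lemma diff_collect (l A B P : quat) (u v x y : R) :
  (l * A - l * B - (qreal (u - x) * (l * P) + qreal (v - y) * (qC (0%R, 1%R) * l * P)) =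
   l * A - l * B - qC ((u, v) - (x, y))%C * (l * P))%H.
Proof. unfold qC. simpl. qring. Qed.

Section SliceExpansion.

Variables (f : quat -> quat) (I l : quat).
Hypothesis Hf : slice_regular f.
Hypothesis HI : imag_unit I.
Hypothesis Hl : l <> 0%H.
Hypothesis HIl : forall x y, slice_pt I x y = rot l (x, y).

Lemma in_ball_slice (x y : R) : Cmod (x, y) < 1 -> in_ball (slice_pt I x y).
Proof. exact (proj2 (slice_pt_in_ball I l x y Hl HIl)). Qed.

Lemma partial_y_eq (x y : R) : Cmod (x, y) < 1 -> partial_y f I x y = (I * partial_x f I x y)%H.
Proof.
intros Hz. destruct (Hf I x y HI (in_ball_slice x y Hz)) as [_ [_ [_ [_ H]]]].
now apply cauchy_riemann_solve.
Qed.

(** Total differentiability needs more than partial derivatives at the point: here the x-partial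
    exists nearby and is continuous, and the y-partial exists at the point. Each of the four real
    components receives a quarter of [eps]. *)
Lemma partials_differentiable (x y : R) (eps : posreal) : Cmod (x, y) < 1 ->
  exists delta : posreal, forall u v, Rabs (u - x) < delta -> Rabs (v - y) < delta ->
  qnorm (f (slice_pt I u v) - f (slice_pt I x y)
    - (qreal (u - x) * partial_x f I x y + qreal (v - y) * partial_y f I x y))%H
   <= eps * Rmax (Rabs (u - x)) (Rabs (v - y)).
Proof.
intros Hz.
assert (He : 0 < eps / 4) by (destruct eps; simpl; lra).
destruct (Hf I x y HI (in_ball_slice x y Hz)) as [_ [Hy [Hc _]]].
apply ex_derive_is_qderive in Hy. destruct Hy as [Y1 [Y2 [Y3 Y4]]].
apply (continuous_quat (T := R2)) in Hc. destruct Hc as [K1 [K2 [K3 K4]]].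
assert (Hx : locally (T := R2) (x, y) (fun p => is_qderive (fun t => f (slice_pt I t (snd p))) (fst p) (partial_x f I (fst p) (snd p)))).
{ generalize (locally_Cmod_lt_1 (T := R2) (fun q => q) (x, y) (Ccont_R2 _) Hz).
  apply filter_imp. intros [u v] H. apply ex_derive_is_qderive.
  exact (proj1 (Hf I u v HI (in_ball_slice u v H))). }
assert (D : forall g : quat -> R,
  locally (T := R2) (x, y) (fun p => is_derive (fun t => g (f (slice_pt I t (snd p)))) (fst p) (g (partial_x f I (fst p) (snd p)))) ->
  is_derive (fun t => g (f (slice_pt I x t))) y (g (partial_y f I x y)) ->
  continuous (T := R2) (fun p => g (partial_x f I (fst p) (snd p))) (x, y) ->
  exists delta : posreal, forall u v, Rabs (u - x) < delta -> Rabs (v - y) < delta ->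
   Rabs (g (f (slice_pt I u v)) - g (f (slice_pt I x y)) -
     (g (partial_x f I x y) * (u - x) + g (partial_y f I x y) * (v - y))) <= eps / 4 * Rmax (Rabs (u - x)) (Rabs (v - y))).
{ intros g H1 H2 H3.
  assert (F := is_derive_filterdiff (fun u v => g (f (slice_pt I u v))) x y (fun u v => g (partial_x f I u v)) _ H1 H2 H3).
  apply filterdiff_differentiable_pt_lim in F. exact (F (mkposreal _ He)). }
destruct (D qre) as [d1 D1]; [generalize Hx; apply filter_imp; intros p [A [B [G E]]]; exact A|exact Y1|exact K1|].
destruct (D qim_i) as [d2 D2]; [generalize Hx; apply filter_imp; intros p [A [B [G E]]]; exact B|exact Y2|exact K2|].
destruct (D qim_j) as [d3 D3]; [generalize Hx; apply filter_imp; intros p [A [B [G E]]]; exact G|exact Y3|exact K3|].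
destruct (D qim_k) as [d4 D4]; [generalize Hx; apply filter_imp; intros p [A [B [G E]]]; exact E|exact Y4|exact K4|].
clear D Hx K1 K2 K3 K4 Y1 Y2 Y3 Y4.
assert (Hm : 0 < Rmin (Rmin d1 d2) (Rmin d3 d4)).
{ repeat apply Rmin_glb_lt; apply cond_pos. }
exists (mkposreal _ Hm). simpl. intros u v Hu Hv.
assert (M1 := Rmin_l (Rmin d1 d2) (Rmin d3 d4)). assert (M2 := Rmin_r (Rmin d1 d2) (Rmin d3 d4)).
assert (M3 := Rmin_l d1 d2). assert (M4 := Rmin_r d1 d2).
assert (M5 := Rmin_l d3 d4). assert (M6 := Rmin_r d3 d4).
specialize (D1 u v ltac:(lra) ltac:(lra)). specialize (D2 u v ltac:(lra) ltac:(lra)).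
specialize (D3 u v ltac:(lra) ltac:(lra)). specialize (D4 u v ltac:(lra) ltac:(lra)).
eapply Rle_trans; [apply qnorm_le_sum|].
revert D1 D2 D3 D4. generalize (Rmax (Rabs (u - x)) (Rabs (v - y))).
generalize (f (slice_pt I u v)), (f (slice_pt I x y)), (partial_x f I x y), (partial_y f I x y).
clear. intros A B P Q m D1 D2 D3 D4.
match goal with |- Rabs ?e1 + Rabs ?e2 + Rabs ?e3 + Rabs ?e4 <= _ =>
 replace e1 with (qre A - qre B - (qre P * (u - x) + qre Q * (v - y))) by (qdestruct; qunfold; ring);
 replace e2 with (qim_i A - qim_i B - (qim_i P * (u - x) + qim_i Q * (v - y))) by (qdestruct; qunfold; ring);
 replace e3 with (qim_j A - qim_j B - (qim_j P * (u - x) + qim_j Q * (v - y))) by (qdestruct; qunfold; ring);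
 replace e4 with (qim_k A - qim_k B - (qim_k P * (u - x) + qim_k Q * (v - y))) by (qdestruct; qunfold; ring)
end.
lra.
Qed.

(** As l I = i l, the Cauchy-Riemann equation turns l (s P + t I P), with P the x-partial, into (s +
    t i) (l P): the total differential becomes complex linear. *)
Lemma slice_complex_diff (z : C) (eps : posreal) : Cmod z < 1 ->
  exists delta : posreal, forall w, Cmod (w - z) < delta ->
  qnorm (l * f (rot l w) - l * f (rot l z) - qC (w - z) * (l * partial_x f I (fst z) (snd z)))%H
    <= eps * Cmod (w - z).
Proof.
intros Hz. destruct z as [x y].
assert (Pl := qnorm_gt_0 l Hl).
assert (He : 0 < eps / qnorm l) by (apply Rdiv_lt_0_compat; [apply eps|assumption]).
destruct (partials_differentiable x y (mkposreal _ He) Hz) as [delta Hd].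
exists delta. intros [u v] Hw. cbn [fst snd].
assert (H1 := Rle_lt_trans _ _ _ (Re_le_Cmod _) Hw).
assert (H2 := Rle_lt_trans _ _ _ (Im_le_Cmod _) Hw).
specialize (Hd u v H1 H2). simpl pos in Hd.
rewrite partial_y_eq in Hd by assumption. rewrite !HIl in Hd.
assert (EI : (l * I = qC (0%R, 1%R) * l)%H) by now rewrite <- (slice_pt_0_1 I), HIl, mul_rot.
match goal with |- qnorm ?e <= _ => replace e with
  (l * (f (rot l (u, v)) - f (rot l (x, y)) - (qreal (u - x) * partial_x f I x y + qreal (v - y) * (I * partial_x f I x y))))%H end.
- rewrite qnorm_mul. apply Rle_trans with (qnorm l * (eps / qnorm l * Rmax (Rabs (u - x)) (Rabs (v - y)))).
  + apply Rmult_le_compat_l; lra.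
  + replace (qnorm l * _) with (eps * Rmax (Rabs (u - x)) (Rabs (v - y))) by (field; lra).
    apply Rmult_le_compat_l; [apply Rlt_le, eps|]. apply (Rmax_Cmod ((u, v) - (x, y))%C).
- generalize (f (rot l (u, v))), (f (rot l (x, y))), (partial_x f I x y). intros A B P.
  transitivity (l * A - l * B - (qreal (u - x) * (l * P) + qreal (v - y) * (l * I * P)))%H.
  + apply diff_expand.
  + rewrite EI. apply diff_collect.
Qed.

Lemma slice_complex_cont (z : C) : Cmod z < 1 ->
  Ccont (T := CU) (fun z => c1 (l * partial_x f I (fst z) (snd z))%H) z /\
  Ccont (T := CU) (fun z => c2 (l * partial_x f I (fst z) (snd z))%H) z.
Proof.
intros Hz. destruct z as [x y].
destruct (Hf I x y HI (in_ball_slice x y Hz)) as [_ [_ [Hc _]]].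
assert (Hc' : continuous (T := CU) (fun z => l * partial_x f I (fst z) (snd z))%H (x, y)).
{ apply (continuous_qmul_l (T := CU)).
  (* The modulus on C and the maximum of coordinates on R x R define the same neighbourhoods. *)
  apply (continuous_comp (U := CU) (V := R2) (fun z => (z : R * R)) (fun p => partial_x f I (fst p) (snd p)) (x, y)); [|exact Hc].
  intros P HP. now apply locally_C. }
apply (continuous_quat (T := CU)) in Hc'. destruct Hc' as [H1 [H2 [H3 H4]]].
split.
- exact (Ccont_pair (T := CU) _ _ _ H1 H2).
- exact (Ccont_pair (T := CU) _ _ _ H3 H4).
Qed.

(** The two complex coordinates of [l * f (rot l z)] expand separately into series with coefficients
    a1 and a2, and l^-1 (a1 + a2 j) are the quaternionic coefficients. They may still depend on [I]
    and [r]. *)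
Lemma slice_expansion (r : R) : 0 < r < 1 -> exists a : nat -> quat,
  forall x y, qnorm (slice_pt I x y) < r ->
    is_series (fun n => qpow (slice_pt I x y) n * a n)%H (f (slice_pt I x y)).
Proof.
intros Hr.
assert (H1 : Chol (fun z => c1 (l * f (rot l z))%H) (fun z => c1 (l * partial_x f I (fst z) (snd z))%H)).
{ intros z Hz. split; [|exact (proj1 (slice_complex_cont z Hz))].
  apply Cderive_eps. intros eps. destruct (slice_complex_diff z eps Hz) as [delta Hd].
  exists delta. intros w Hw. eapply Rle_trans; [|apply (Hd w Hw)].
  eapply Rle_trans; [|apply Cmod_c1_le]. apply Req_le. f_equal.
  rewrite (Cmult_comm _ (w - z)), <- c1_qC_mul. reflexivity. }
assert (H2 : Chol (fun z => c2 (l * f (rot l z))%H) (fun z => c2 (l * partial_x f I (fst z) (snd z))%H)).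
{ intros z Hz. split; [|exact (proj2 (slice_complex_cont z Hz))].
  apply Cderive_eps. intros eps. destruct (slice_complex_diff z eps Hz) as [delta Hd].
  exists delta. intros w Hw. eapply Rle_trans; [|apply (Hd w Hw)].
  eapply Rle_trans; [|apply Cmod_c2_le]. apply Req_le. f_equal.
  rewrite (Cmult_comm _ (w - z)), <- c2_qC_mul. reflexivity. }
destruct (Chol_series _ _ r H1 Hr) as [a1 A1]. destruct (Chol_series _ _ r H2 Hr) as [a2 A2].
exists (fun n => qinv l * qpair (a1 n) (a2 n))%H.
intros x y Hb. rewrite HIl, qnorm_rot in * by assumption.
specialize (A1 _ Hb). specialize (A2 _ Hb).
replace (f (rot l (x, y))) with (qinv l * (l * f (rot l (x, y))))%H
  by now rewrite qmulA, qinv_l, qmul1l.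
apply (qseries_ext (fun n => qinv l * (qC ((x, y) ^ n) * qpair (a1 n) (a2 n)))%H).
- intros n. rewrite qpow_rot by assumption. unfold rot.
  rewrite <- !qmulA. do 2 f_equal. now rewrite qmulA, qinv_r, qmul1l.
- apply qseries_mul_l. apply qseries_c. split.
  + apply (Cseries_ext (fun n => (x, y) ^ n * a1 n)%C); [|assumption].
    intros n. now rewrite c1_qC_mul, c1_qpair.
  + apply (Cseries_ext (fun n => (x, y) ^ n * a2 n)%C); [|assumption].
    intros n. now rewrite c2_qC_mul, c2_qpair.
Qed.

End SliceExpansion.

Lemma slice_pt_real (I : quat) (x : R) : slice_pt I x 0 = qreal x.
Proof. unfold slice_pt. qring. Qed.

Theorem slice_regular_expands (f : quat -> quat) : slice_regular f -> exists a, expands f a.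
Proof.
intros Hf.
assert (Hex : forall I r, imag_unit I -> 0 < r < 1 -> exists a : nat -> quat,
  forall x y, qnorm (slice_pt I x y) < r ->
    is_series (fun n => qpow (slice_pt I x y) n * a n)%H (f (slice_pt I x y))).
{ intros I r HI Hr. destruct (imag_unit_rot I HI) as [l [Hl HIl]].
  now apply (slice_expansion f I l). }
assert (Hi : imag_unit qi) by (unfold imag_unit, qi; qring).
(* The reference coefficients come from the slice of [i]. Radius 1/2 is enough for uniqueness and
   does not exceed the radius (1 + |q|)/2 taken on the slice of [q]. *)
destruct (Hex qi (1 / 2) Hi ltac:(lra)) as [a Ha].
exists a. intros q Hq. assert (Hq0 := qnorm_ge_0 q). red in Hq.
destruct (Hex (slice_unit q) ((1 + qnorm q) / 2) (imag_unit_slice_unit q) ltac:(lra)) as [b Hb].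
assert (E : forall n, b n = a n).
{ apply (qcoeffs_unique (1 / 2) b a (fun x => f (qreal x))); [lra| |]; intros x Hx.
  - rewrite <- (slice_pt_real (slice_unit q)). apply Hb. rewrite slice_pt_real, qnorm_qreal. lra.
  - rewrite <- (slice_pt_real qi). apply Ha. rewrite slice_pt_real, qnorm_qreal. lra. }
assert (Hs := slice_pt_slice_unit q).
generalize (Hb (qre q) (qnorm (qimag q))). rewrite Hs. intros H.
apply (qseries_ext _ _ _ (fun n => f_equal (qmul (qpow q n)) (E n))). apply H. lra.
Qed.

(** * A Schwarz lemma for pairs of slice regular functions *)

Lemma Csum_lin (x y : nat -> C) (k m z : C) :
  conv_disc (fun n => Cmod (x n)) -> conv_disc (fun n => Cmod (y n)) -> Cmod z < 1 ->
  Csum (fun n => k * x n + m * y n)%C z = (k * Csum x z + m * Csum y z)%C.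
Proof.
intros Hx Hy Hz.
assert (H : Cseries (fun n => z ^ n * (k * x n + m * y n))%C (k * Csum x z + m * Csum y z)).
{ apply (Cseries_ext (fun n => k * (z ^ n * x n) + m * (z ^ n * y n))%C). intros; ring.
  apply Cseries_plus; apply Cseries_scal; now apply Csum_correct. }
apply Cseries_components in H. destruct H as [H1 H2].
apply injective_projections.
- exact (is_series_unique _ _ H1).
- exact (is_series_unique _ _ H2).
Qed.

Lemma conv_qcomp (b : nat -> quat) (g : quat -> C) : qconv b -> (forall q, Cmod (g q) <= qnorm q) ->
  conv_disc (fun n => Cmod (g (b n))).
Proof. intros H Hg. apply (conv_disc_le _ (fun n => qnorm (b n))); [|exact H]. intros n. split. apply Cmod_ge_0. apply Hg. Qed.

Lemma Cmod_conj_c1_le (q : quat) : Cmod (Cconj (c1 q)) <= qnorm q.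
Proof. rewrite Cmod_conj. apply Cmod_c1_le. Qed.
Lemma Cmod_conj_c2_le (q : quat) : Cmod (Cconj (c2 q)) <= qnorm q.
Proof. rewrite Cmod_conj. apply Cmod_c2_le. Qed.

Definition s1 (b : nat -> quat) := Csum (fun n => c1 (b n)).
Definition s2 (b : nat -> quat) := Csum (fun n => c2 (b n)).
(** Conjugating the coefficients instead of the values keeps [s1c] and [s2c] holomorphic in [z]. *)
Definition s1c (b : nat -> quat) := Csum (fun n => Cconj (c1 (b n))).
Definition s2c (b : nat -> quat) := Csum (fun n => Cconj (c2 (b n))).

(* Coordinates of [l * f(rot l z)] for [l = x + y j] and [f = power_sum b]: the row vector [(x, y)]
   times the holomorphic matrix [[s1, s2], [- s2c, s1c]]. *)
Definition row1 (b : nat -> quat) (x y z : C) : C := (x * s1 b z - y * s2c b z)%C.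
Definition row2 (b : nat -> quat) (x y z : C) : C := (x * s2 b z + y * s1c b z)%C.

Lemma power_sum_rows (b : nat -> quat) (l : quat) (z : C) : qconv b -> l <> 0%H -> Cmod z < 1 ->
  (l * power_sum b (rot l z))%H = qpair (row1 b (c1 l) (c2 l) z) (row2 b (c1 l) (c2 l) z).
Proof.
intros Hb Hl Hz. rewrite power_sum_rot by assumption. f_equal.
- unfold row1, s1, s2c.
  match goal with |- _ = (?k * ?X - ?m * ?Y)%C => replace (k * X - m * Y)%C with (k * X + - m * Y)%C by ring end.
  rewrite <- Csum_lin; try assumption.
  + apply Csum_ext. intros n. rewrite c1_mul. ring.
  + apply conv_qcomp; [assumption|apply Cmod_c1_le].
  + apply (conv_qcomp b (fun q => Cconj (c2 q))); [assumption|apply Cmod_conj_c2_le].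
- unfold row2, s2, s1c. rewrite <- Csum_lin; try assumption.
  + apply Csum_ext. intros n. apply c2_mul.
  + apply conv_qcomp; [assumption|apply Cmod_c2_le].
  + apply (conv_qcomp b (fun q => Cconj (c1 q))); [assumption|apply Cmod_conj_c1_le].
Qed.

Lemma holomorphic_Csum (c : nat -> C) : conv_disc (fun n => Cmod (c n)) -> holomorphic (Csum c).
Proof. intros H. eexists. now apply Chol_Csum. Qed.

Lemma holomorphic_s (b : nat -> quat) : qconv b ->
  holomorphic (s1 b) /\ holomorphic (s2 b) /\ holomorphic (s1c b) /\ holomorphic (s2c b).
Proof.
intros Hb. split; [|split; [|split]]; apply holomorphic_Csum.
- apply conv_qcomp; [assumption|apply Cmod_c1_le].
- apply conv_qcomp; [assumption|apply Cmod_c2_le].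
- apply (conv_qcomp b (fun q => Cconj (c1 q))); [assumption|apply Cmod_conj_c1_le].
- apply (conv_qcomp b (fun q => Cconj (c2 q))); [assumption|apply Cmod_conj_c2_le].
Qed.

Definition sq2 (x y : C) : R := Cmod x ^ 2 + Cmod y ^ 2.

Lemma sq2_qpair (x y : C) : qnorm (qpair x y) ^ 2 = sq2 x y.
Proof. now rewrite qnorm_sq, qsq_c, c1_qpair, c2_qpair. Qed.

Lemma sq2_ge_0 (x y : C) : 0 <= sq2 x y.
Proof. unfold sq2. generalize (pow2_ge_0 (Cmod x)) (pow2_ge_0 (Cmod y)). lra. Qed.

Lemma sq2_0 : sq2 0 0 = 0.
Proof. unfold sq2. rewrite Cmod_0. ring. Qed.

Lemma qpair_neq_0 (x y : C) : (x <> 0 \/ y <> 0) -> qpair x y <> 0%H.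
Proof.
intros H E. assert (E1 := f_equal c1 E). assert (E2 := f_equal c2 E).
rewrite c1_qpair in E1. rewrite c2_qpair in E2. destruct H as [H|H]; apply H; assumption.
Qed.

Lemma Cmod_dot_sq_le (a b u v : C) :
  Cmod (a * Cconj u + b * Cconj v) ^ 2 <= sq2 a b * sq2 u v.
Proof.
apply Rle_trans with ((Cmod a * Cmod u + Cmod b * Cmod v) ^ 2).
- apply pow_incr. split. apply Cmod_ge_0.
  eapply Rle_trans; [apply Cmod_triangle|]. rewrite !Cmod_mult, !Cmod_conj. lra.
- unfold sq2. generalize (Cmod a), (Cmod b), (Cmod u), (Cmod v). intros p q s t.
  assert (H := pow2_ge_0 (p * t - q * s)). nra.
Qed.

Lemma dot_self (u v : C) : (u * Cconj u + v * Cconj v)%C = sq2 u v.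
Proof. unfold sq2. rewrite !Cmod2_alt. unfold Re, Im. apply injective_projections; simpl; ring. Qed.

Section Schwarz.

Variables b c : nat -> quat.
Hypothesis Hb : qconv b.
Hypothesis Hc : qconv c.
Hypothesis Hbc : forall q, in_ball q -> qnorm (q * power_sum c q)%H < qnorm (power_sum b q).

(** For l = x + y j, the hypothesis at the point [rot l z], multiplied by |l| and squared, is this
    inequality for the row (x, y). *)
Lemma rows_lt (x y z : C) : (x <> 0 \/ y <> 0) -> Cmod z < 1 ->
  Cmod z ^ 2 * sq2 (row1 c x y z) (row2 c x y z) < sq2 (row1 b x y z) (row2 b x y z).
Proof.
intros Hxy Hz. set (l := qpair x y).
assert (Hl : l <> 0%H) by now apply qpair_neq_0.
assert (Pl := qnorm_gt_0 l Hl).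
assert (H := Hbc (rot l z) ltac:(red; now rewrite qnorm_rot)).
assert (Eb := power_sum_rows b l z Hb Hl Hz). assert (Ec := power_sum_rows c l z Hc Hl Hz).
unfold l in Eb at 3 4 5 6. unfold l in Ec at 3 4 5 6. rewrite c1_qpair, c2_qpair in Eb, Ec.
rewrite <- !sq2_qpair, <- Eb, <- Ec, <- Rpow_mult_distr.
assert (P0 := qnorm_ge_0 (rot l z * power_sum c (rot l z))%H).
rewrite !qnorm_mul, qnorm_rot in * by assumption.
generalize dependent (qnorm (power_sum c (rot l z))). intros C0 H P0.
generalize dependent (qnorm (power_sum b (rot l z))). intros B0 H.
replace (Cmod z * (qnorm l * C0)) with (qnorm l * (Cmod z * C0)) by ring.
rewrite !Rpow_mult_distr. rewrite <- Rpow_mult_distr.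
apply Rmult_lt_compat_l. now apply pow_lt. nra.
Qed.

(** The determinant of the matrix of [b]. As a function of [z] it is the symmetrization of
    [power_sum b] on the slice of [i]. *)
Let det (z : C) : C := (s1 b z * s1c b z + s2 b z * s2c b z)%C.

(** By [rows_lt] no nonzero row is killed by the matrix of [b]. If the determinant vanished, both
    rows of the adjugate would be killed, hence zero; then the matrix itself is zero and kills (1,
    0). *)
Lemma det_neq_0 (z : C) : Cmod z < 1 -> det z <> 0.
Proof.
intros Hz E.
assert (X : forall x y, row1 b x y z = 0 -> row2 b x y z = 0 -> x = 0 /\ y = 0).
{ intros x y E1 E2. destruct (Classical_Prop.classic (x = 0 /\ y = 0)) as [|N]; [assumption|exfalso].
  assert (H : x <> 0 \/ y <> 0) by tauto.
  generalize (rows_lt x y z H Hz). rewrite E1, E2, sq2_0.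
  assert (P := Rmult_le_pos _ _ (pow2_ge_0 (Cmod z)) (sq2_ge_0 (row1 c x y z) (row2 c x y z))). lra. }
unfold det in E.
destruct (X (s1c b z) (- s2 b z)%C) as [A1 A2].
- unfold row1. transitivity (s1 b z * s1c b z + s2 b z * s2c b z)%C; [ring|exact E].
- unfold row2. ring.
- destruct (X (s2c b z) (s1 b z)%C) as [A3 A4].
  + unfold row1. ring.
  + unfold row2. transitivity (s1 b z * s1c b z + s2 b z * s2c b z)%C; [ring|exact E].
  + assert (A2' : s2 b z = 0) by (replace (s2 b z) with (- - s2 b z)%C by ring; rewrite A2; ring).
    destruct (X 1 0) as [F _].
    * unfold row1. rewrite A4, A3. ring.
    * unfold row2. rewrite A2', A1. ring.
    * apply (f_equal fst) in F. simpl in F. lra.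
Qed.

(* The row vector [(x, y)] times the inverse of the matrix of [b]. *)
Let sol1 (x y z : C) : C := ((x * s1c b z + y * s2c b z) / det z)%C.
Let sol2 (x y z : C) : C := ((y * s1 b z - x * s2 b z) / det z)%C.

Lemma row_sol (x y z : C) : Cmod z < 1 ->
  row1 b (sol1 x y z) (sol2 x y z) z = x /\ row2 b (sol1 x y z) (sol2 x y z) z = y.
Proof.
intros Hz. assert (D := det_neq_0 z Hz). unfold row1, row2, sol1, sol2, det in *.
split; field; exact D.
Qed.

Lemma sol_row (x y z : C) : Cmod z < 1 ->
  sol1 (row1 b x y z) (row2 b x y z) z = x /\ sol2 (row1 b x y z) (row2 b x y z) z = y.
Proof.
intros Hz. assert (D := det_neq_0 z Hz). unfold row1, row2, sol1, sol2, det in *.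
split; field; exact D.
Qed.

(** Inserting the solution row in [rows_lt] puts the given row on the right-hand side. The strict
    sign is lost because the solution row may be zero. *)
Lemma rows_sol_le (x y z : C) : Cmod z < 1 ->
  Cmod z ^ 2 * sq2 (row1 c (sol1 x y z) (sol2 x y z) z) (row2 c (sol1 x y z) (sol2 x y z) z) <= sq2 x y.
Proof.
intros Hz. destruct (row_sol x y z Hz) as [E1 E2].
destruct (Classical_Prop.classic (sol1 x y z = 0 /\ sol2 x y z = 0)) as [[N1 N2]|N].
- rewrite N1, N2. unfold row1, row2.
  replace (0 * s1 c z - 0 * s2c c z)%C with (RtoC 0) by ring.
  replace (0 * s2 c z + 0 * s1c c z)%C with (RtoC 0) by ring.
  rewrite sq2_0, Rmult_0_r. apply sq2_ge_0.
- assert (R := rows_lt (sol1 x y z) (sol2 x y z) z ltac:(tauto) Hz).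
  rewrite E1, E2 in R. now apply Rlt_le.
Qed.

(** The row (p, q) is frozen at its value at [z], and [psi w] pairs its image under the quotient
    matrix at [w] with the target (u, v). Thus [psi] is holomorphic with psi z = |(u, v)|^2, while
    on |w| = r the previous lemma and Cauchy-Schwarz bound it by |(p, q)| |(u, v)| / r. The result
    follows as r tends to 1. *)
Lemma rows_le (x y z : C) : Cmod z < 1 ->
  sq2 (row1 c x y z) (row2 c x y z) <= sq2 (row1 b x y z) (row2 b x y z).
Proof.
intros Hz.
set (u := row1 c x y z). set (v := row2 c x y z). set (p := row1 b x y z). set (q := row2 b x y z).
set (psi := fun w => (row1 c (sol1 p q w) (sol2 p q w) w * Cconj u + row2 c (sol1 p q w) (sol2 p q w) w * Cconj v)%C).
destruct (holomorphic_s b Hb) as [B1 [B2 [B3 B4]]]. destruct (holomorphic_s c Hc) as [C1 [C2 [C3 C4]]].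
assert (Hdet : holomorphic det) by (apply holomorphic_plus; now apply holomorphic_mult).
assert (HC := holomorphic_const).
assert (S1 : holomorphic (fun w => sol1 p q w)).
{ apply holomorphic_div; [apply det_neq_0| |assumption]. apply holomorphic_plus; now apply holomorphic_mult. }
assert (S2 : holomorphic (fun w => sol2 p q w)).
{ apply holomorphic_div; [apply det_neq_0| |assumption]. apply holomorphic_minus; now apply holomorphic_mult. }
assert (Hpsi : holomorphic psi).
{ assert (R1 : holomorphic (fun w => row1 c (sol1 p q w) (sol2 p q w) w)).
  { exact (holomorphic_minus _ _ (holomorphic_mult _ _ S1 C1) (holomorphic_mult _ _ S2 C4)). }
  assert (R2 : holomorphic (fun w => row2 c (sol1 p q w) (sol2 p q w) w)).
  { exact (holomorphic_plus _ _ (holomorphic_mult _ _ S1 C2) (holomorphic_mult _ _ S2 C3)). }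
  exact (holomorphic_plus _ _ (holomorphic_mult _ _ R1 (HC _)) (holomorphic_mult _ _ R2 (HC _))). }
assert (Epsi : psi z = sq2 u v).
{ unfold psi. destruct (sol_row x y z Hz) as [E1 E2]. fold p in E1, E2. fold q in E1, E2.
  rewrite E1, E2. fold u v. apply dot_self. }
set (M := sqrt (sq2 p q * sq2 u v)).
assert (PM : 0 <= sq2 p q * sq2 u v) by (apply Rmult_le_pos; apply sq2_ge_0).
assert (HM : forall r, Cmod z < r < 1 -> sq2 u v * r <= M).
{ intros r Hr. assert (Z0 := Cmod_ge_0 z).
  assert (X : Cmod (psi z) <= M / r).
  { apply (max_principle psi r); [assumption|lra|lra|].
    intros w Hw. apply Rle_div_r; [lra|].
    apply le_of_sq_le; [apply sqrt_pos|]. unfold M. rewrite pow2_sqrt by assumption.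
    assert (K1 := rows_sol_le p q w ltac:(lra)). rewrite Hw in K1.
    assert (K2 := Cmod_dot_sq_le (row1 c (sol1 p q w) (sol2 p q w) w) (row2 c (sol1 p q w) (sol2 p q w) w) u v).
    fold (psi w) in K2. rewrite Rpow_mult_distr.
    apply Rle_trans with (r ^ 2 * sq2 (row1 c (sol1 p q w) (sol2 p q w) w) (row2 c (sol1 p q w) (sol2 p q w) w) * sq2 u v).
    - rewrite Rmult_comm, Rmult_assoc. apply Rmult_le_compat_l; [apply pow2_ge_0|exact K2].
    - apply Rmult_le_compat_r; [apply sq2_ge_0|exact K1]. }
  rewrite Epsi, Cmod_R, Rabs_pos_eq in X by apply sq2_ge_0. apply Rle_div_r in X; lra. }
assert (N0 := sq2_ge_0 u v). assert (P0 := sq2_ge_0 p q).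
(* The limit r -> 1: if [sq2 u v] exceeded [M], any r strictly between max(|z|, M / sq2 u v) and 1
   would contradict [HM]; the midpoint of that interval is taken. *)
assert (HM1 : sq2 u v <= M).
{ apply Rnot_lt_le. intros Hlt. assert (M0 : 0 <= M) by apply sqrt_pos.
  set (m := M / sq2 u v).
  assert (Hm : m * sq2 u v = M) by (unfold m; field; lra).
  assert (Hm1 : m < 1) by nra.
  assert (R1 := Rmax_l (Cmod z) m). assert (R2 := Rmax_r (Cmod z) m).
  assert (R3 : Rmax (Cmod z) m < 1) by now apply Rmax_lub_lt.
  specialize (HM ((1 + Rmax (Cmod z) m) / 2) ltac:(lra)). nra. }
assert (E : M ^ 2 = sq2 p q * sq2 u v) by (unfold M; now apply pow2_sqrt).
nra.
Qed.

Theorem qschwarz (q : quat) : in_ball q -> qnorm (power_sum c q) <= qnorm (power_sum b q).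
Proof.
intros Hq. destruct (exists_rot q) as [l [z [Hl [E Ez]]]]. red in Hq. rewrite <- Ez in Hq.
assert (Pl := qnorm_gt_0 l Hl).
apply Rmult_le_reg_l with (qnorm l); [assumption|].
rewrite <- !qnorm_mul, E, !power_sum_rows by assumption.
apply le_of_sq_le. apply qnorm_ge_0. rewrite !sq2_qpair. now apply rows_le.
Qed.

End Schwarz.

(** * Growth along a ray *)

Lemma power_sum_0 (a : nat -> quat) : qconv a -> power_sum a 0%H = a O.
Proof.
intros Ha. apply (qSeries_unique (fun n => qpow 0%H n * a n)%H), qseries_components.
assert (X : forall g : quat -> R, g 0%H = 0 -> is_series (fun n => g (qpow 0 n * a n)%H) (g (a O))).
{ intros g Hg. apply (is_series_decr_1 (V := R_NormedModule)).
  replace (plus _ _) with 0.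
  - apply (is_series_ext (fun _ => 0)).
    + intros n. simpl. rewrite !qmul0l. now symmetry.
    + apply (filterlim_ext (fun _ : nat => 0)).
      * intros n. symmetry. rewrite sum_n_const. apply Rmult_0_r.
      * apply filterlim_const.
  - simpl qpow. rewrite qmul1l. symmetry. apply (plus_opp_r (G := R_AbelianGroup)). }
split; [|split; [|split]]; now apply X.
Qed.

Lemma power_sum_plus (a b : nat -> quat) (q : quat) : qconv a -> qconv b -> in_ball q ->
  power_sum (fun n => a n + b n)%H q = (power_sum a q + power_sum b q)%H.
Proof.
intros Ha Hb Hq. apply qSeries_unique.
apply (qseries_ext (fun n => qpow q n * a n + qpow q n * b n)%H). { intros; qring. }
apply qseries_plus; now apply power_sum_correct.
Qed.

Lemma qconv_plus (a b : nat -> quat) : qconv a -> qconv b -> qconv (fun n => a n + b n)%H.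
Proof.
intros Ha Hb. apply (conv_disc_le _ (fun n => qnorm (a n) + qnorm (b n))).
- intros n. split. apply qnorm_ge_0. apply qnorm_triangle.
- intros r Hr. apply (ex_series_ext (fun n => qnorm (a n) * r ^ n + qnorm (b n) * r ^ n)).
  + intros; as_R; ring.
  + apply (ex_series_plus (V := R_NormedModule)). now apply Ha. now apply Hb.
Qed.

Lemma power_sum_S (a : nat -> quat) (q : quat) : qconv a -> qconv (fun n => a (S n)) -> in_ball q ->
  power_sum a q = (q * power_sum (fun n => a (S n)) q + a O)%H.
Proof.
intros Ha Ha' Hq. apply qSeries_unique.
replace (q * power_sum (fun n => a (S n)) q + a O)%H
  with (q * power_sum (fun n => a (S n)) q + qpow q 0 * a O)%H by (simpl; now rewrite qmul1l).
apply (qseries_decr_1 (fun n => qpow q n * a n)%H).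
apply (qseries_ext (fun n => q * (qpow q n * a (S n)))%H). { intros; simpl. apply qmulA. }
apply qseries_mul_l. now apply power_sum_correct.
Qed.

(** The shifted coefficients are dominated by the derived ones, since n + 1 >= 1. *)
Lemma qconv_S (a : nat -> quat) : qconv a -> qconv (fun n => a (S n)).
Proof.
intros Ha. apply (conv_disc_le _ (fun n => qnorm (qdcoef a n))); [|now apply qconv_qdcoef].
intros n. split. apply qnorm_ge_0. unfold qdcoef.
rewrite qnorm_mul, qnorm_qreal, Rabs_pos_eq by apply pos_INR.
generalize (qnorm_ge_0 (a (S n))) (pos_INR n). rewrite S_INR. nra.
Qed.

Lemma qsq_plus_minus (p q : quat) :
  qsq (p + q)%H = qsq p + qsq q + 2 * qdot p q /\ qsq (p - q)%H = qsq p + qsq q - 2 * qdot p q.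
Proof. unfold qsq, qdot. qdestruct. qunfold. split; ring. Qed.

Lemma qre_qinv_mul (p q : quat) : qre (qinv p * q)%H = / qnorm p ^ 2 * qdot p q.
Proof. unfold qinv. generalize (/ qnorm p ^ 2). intros k. unfold qdot. qdestruct. qunfold. ring. Qed.

Lemma qdot_mul_l (q p s : quat) : qdot (q * p)%H (q * s)%H = qsq q * qdot p s.
Proof. unfold qdot, qsq. qdestruct. qunfold. ring. Qed.

(* The half-plane condition on [f^-1 q f'] as a disc condition, with [f = q h] and [f' = p]. *)
Lemma log_quotient_pos_iff (q h p : quat) : q <> 0%H -> h <> 0%H ->
  (0 < qre (qinv (q * h) * q * p)%H <-> qnorm (p - h)%H < qnorm (p + h)%H).
Proof.
intros Hq Hh. rewrite <- qmulA, qre_qinv_mul, qdot_mul_l, <- qnorm_sq, qnorm_mul.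
assert (Pq := qnorm_gt_0 q Hq). assert (Ph := qnorm_gt_0 h Hh).
destruct (qsq_plus_minus p h) as [E1 E2]. rewrite <- !qnorm_sq in E1, E2.
assert (Ed : qdot h p = qdot p h) by (unfold qdot; ring).
assert (H1 := qnorm_ge_0 (p - h)%H). assert (H2 := qnorm_ge_0 (p + h)%H).
assert (K : 0 < / (qnorm q * qnorm h) ^ 2 * qnorm q ^ 2).
{ apply Rmult_lt_0_compat. apply Rinv_0_lt_compat, pow_lt. nra. nra. }
rewrite <- Rmult_assoc, Ed. split; intros H.
- apply Rnot_le_lt. intros F. assert (qdot p h > 0) by nra. nra.
- apply Rmult_lt_0_compat; [assumption|]. nra.
Qed.

Section DiscCondition.

(* [h = |H|], [p = |P|], [d = <P, H>] and [r = |q|], where [|P - H| <= r |P + H|]. *)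
Variables (h p d r : R).
Hypothesis Hr : 0 <= r < 1.
Hypothesis Hh : 0 < h.
Hypothesis Hd : d ^ 2 <= p ^ 2 * h ^ 2.
Hypothesis Hdisc : p ^ 2 + h ^ 2 - 2 * d <= r ^ 2 * (p ^ 2 + h ^ 2 + 2 * d).

(** In the complex model P/H lies in the image of |w| <= r under (1 + w)/(1 - w), whose real part
    ranges from (1 - r)/(1 + r) to (1 + r)/(1 - r). Here [p] is eliminated between the disc
    condition and Cauchy-Schwarz, which leaves a quadratic inequality in [d] whose roots are these
    two values times h^2. *)
Lemma dot_bounds : (1 - r) * h ^ 2 <= (1 + r) * d /\ (1 - r) * d <= (1 + r) * h ^ 2.
Proof.
set (N := h ^ 2) in *. assert (PN : 0 < N) by (unfold N; nra).
assert (A : (1 - r ^ 2) * (p ^ 2 + N) <= 2 * (1 + r ^ 2) * d) by lra.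
assert (Pd : 0 < d).
{ assert (0 < (1 - r ^ 2) * (p ^ 2 + N)).
  { apply Rmult_lt_0_compat. nra. generalize (pow2_ge_0 p); lra. }
  nra. }
assert (B : ((1 + r) * d - (1 - r) * N) * ((1 - r) * d - (1 + r) * N) <= 0).
{ replace (_ * _) with ((1 - r ^ 2) * (d ^ 2 + N ^ 2) - 2 * (1 + r ^ 2) * d * N) by ring.
  assert ((1 - r ^ 2) * (d ^ 2 + N ^ 2) <= (1 - r ^ 2) * (p ^ 2 + N) * N).
  { rewrite Rmult_assoc. apply Rmult_le_compat_l. nra. nra. }
  assert ((1 - r ^ 2) * (p ^ 2 + N) * N <= 2 * (1 + r ^ 2) * d * N) by (apply Rmult_le_compat_r; lra).
  lra. }
(* The two sides differ by 4 r N. This orders the two factors of [B], so a nonpositive product fixes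
   the sign of each. *)
assert (C1 : (1 - r) * ((1 + r) * d - (1 - r) * N) >= (1 + r) * ((1 - r) * d - (1 + r) * N)) by nra.
split; apply Rnot_lt_le; intros F.
- assert ((1 - r) * d - (1 + r) * N < 0) by nra. nra.
- assert ((1 + r) * d - (1 - r) * N > 0) by nra. nra.
Qed.

End DiscCondition.

Lemma is_derive_qsq (g : R -> quat) (t : R) (d : quat) : is_qderive g t d ->
  is_derive (fun s => qsq (g s)) t (2 * qdot (g t) d).
Proof.
intros [H1 [H2 [H3 H4]]]. unfold qsq.
replace (2 * qdot (g t) d) with
  (INR 2 * qre d * qre (g t) ^ 1 + INR 2 * qim_i d * qim_i (g t) ^ 1 + INR 2 * qim_j d * qim_j (g t) ^ 1
   + INR 2 * qim_k d * qim_k (g t) ^ 1) by (unfold qdot; change (INR 2) with 2; ring).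
exact (is_derive_plus (V := R_NormedModule) _ _ _ _ _ (is_derive_plus (V := R_NormedModule) _ _ _ _ _
  (is_derive_plus (V := R_NormedModule) _ _ _ _ _ (is_derive_pow _ 2 _ _ H1) (is_derive_pow _ 2 _ _ H2))
  (is_derive_pow _ 2 _ _ H3)) (is_derive_pow _ 2 _ _ H4)).
Qed.

Lemma rot_scal (l : quat) (t : R) (w : C) : rot l (t * w)%C = (qreal t * rot l w)%H.
Proof. unfold rot. generalize (qinv l). intros m. unfold qC. simpl. qring. Qed.

Lemma qdot_ray (A B W : quat) (t : R) :
  t * (2 * qdot A (W * B)%H) = 2 * (qdot (qreal t * W * B + A)%H A - qsq A).
Proof. unfold qdot, qsq. qdestruct. qcompute. ring. Qed.

Section Growth.

Variable a : nat -> quat.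
Hypothesis Ha : qconv a.
Hypothesis Ha0 : a O = 1%H.
Let H (q : quat) : quat := power_sum a q.
Let P (q : quat) : quat := (q * power_sum (qdcoef a) q + H q)%H.
Hypothesis Hnz : forall q, in_ball q -> H q <> 0%H.
Hypothesis Hdisc : forall q, in_ball q -> qnorm (P q - H q)%H <= qnorm q * qnorm (P q + H q)%H.

Lemma disc_dot_bounds (q : quat) : in_ball q ->
  (1 - qnorm q) * qsq (H q) <= (1 + qnorm q) * qdot (P q) (H q) /\
  (1 - qnorm q) * qdot (P q) (H q) <= (1 + qnorm q) * qsq (H q).
Proof.
intros Hq. rewrite <- !qnorm_sq.
apply (dot_bounds (qnorm (H q)) (qnorm (P q))).
- split. apply qnorm_ge_0. exact Hq.
- now apply qnorm_gt_0, Hnz.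
- rewrite !qnorm_sq. apply qdot_sq_le.
- destruct (qsq_plus_minus (P q) (H q)) as [E1 E2]. rewrite !qnorm_sq, <- E1, <- E2, <- !qnorm_sq, <- Rpow_mult_distr.
  apply pow_incr. split. apply qnorm_ge_0. now apply Hdisc.
Qed.

Section Ray.

Variables (l : quat) (w : C).
Hypothesis Hl : l <> 0%H.
Hypothesis Hw : Cmod w = 1.

Let x (t : R) : quat := rot l (t * w).
Let N (t : R) : R := qsq (H (x t)).
Let N' (t : R) : R := 2 * qdot (H (x t)) (rot l w * power_sum (qdcoef a) (x t))%H.

Lemma qnorm_ray (t : R) : 0 <= t -> qnorm (x t) = t.
Proof.
intros Ht. unfold x. rewrite qnorm_rot by assumption.
rewrite Cmod_mult, Hw, Cmod_R, Rabs_pos_eq by assumption. ring.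
Qed.

Lemma is_derive_ray (t : R) : 0 <= t < 1 -> is_derive N t (N' t).
Proof.
intros Ht. unfold N, N'. apply (is_derive_qsq (fun s => H (x s))).
apply (slice_curve_deriv (power_sum a) a l (expands_power_sum a Ha) Hl (fun s => s * w)%C).
- rewrite Cmod_mult, Hw, Cmod_R, Rabs_pos_eq; lra.
- apply Ccont_mult; [|apply Ccont_const]. apply Ccont_pair. apply continuous_id. apply continuous_const.
- unfold Re; simpl. auto_derive; auto. ring.
- unfold Im; simpl. auto_derive; auto. ring.
Qed.

(** Multiplying by t turns the direction [rot l w] into the point q = x t, and q H' = P - H. The
    radial derivative of |H|^2 is thus expressed by the quantity that the disc condition
    controls. *)
Lemma ray_deriv_eq (t : R) : t * N' t = 2 * (qdot (P (x t)) (H (x t)) - N t).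
Proof.
unfold N', N, P.
generalize (H (x t)), (power_sum (qdcoef a) (x t)). intros A B.
unfold x. rewrite rot_scal. apply qdot_ray.
Qed.

Lemma ray_0 : N 0 = 1.
Proof.
unfold N, x, H. rewrite rot_scal. fold (qreal 0). rewrite qmul0l, power_sum_0, Ha0 by assumption.
unfold qsq. qunfold. ring.
Qed.

(** N (1 + t)^4 does not decrease and N (1 - t)^4 does not increase along the ray, and both equal 1
    at t = 0. The exponent is 4 because N is the square of |H|. *)
Lemma ray_growth (r : R) : 0 < r < 1 -> 1 <= N r * (1 + r) ^ 4 /\ N r * (1 - r) ^ 4 <= 1.
Proof.
intros Hr.
(* Inserted in [ray_deriv_eq], the bounds (1 - t)/(1 + t) and (1 + t)/(1 - t) on qdot P H / N become
   - 4/(1 + t) and 4/(1 - t) for N'/N. Cancelling t requires t > 0, and the mean value theorem uses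
   the sign only at an interior point. *)
assert (B : forall t, 0 < t < 1 -> - 4 * N t <= N' t * (1 + t) /\ N' t * (1 - t) <= 4 * N t).
{ intros t Ht. assert (Hn : qnorm (x t) = t) by (apply qnorm_ray; lra).
  assert (Hb : in_ball (x t)) by (red; rewrite Hn; lra).
  destruct (disc_dot_bounds (x t) Hb) as [B1 B2]. rewrite Hn in B1, B2. fold (N t) in B1, B2.
  assert (E := ray_deriv_eq t).
  split; apply Rmult_le_reg_l with t; try lra.
  - replace (t * (N' t * (1 + t))) with (t * N' t * (1 + t)) by ring. rewrite E. nra.
  - replace (t * (N' t * (1 - t))) with (t * N' t * (1 - t)) by ring. rewrite E. nra. }
split.
- destruct (MVT_cor2 (fun t => N t * (1 + t) ^ 4) (fun t => N' t * (1 + t) ^ 4 + N t * (4 * (1 + t) ^ 3)) 0 r)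
    as [c [Ec Hc]]; [lra| |].
  + intros c Hc. apply is_derive_Reals.
    apply (is_derive_mult (K := R_AbsRing) N (fun t => (1 + t) ^ 4) c (N' c) (4 * (1 + c) ^ 3)).
    * apply is_derive_ray. lra.
    * auto_derive; auto. simpl. ring.
    * exact Rmult_comm.
  + rewrite ray_0 in Ec.
    assert (0 <= N' c * (1 + c) ^ 4 + N c * (4 * (1 + c) ^ 3)); [|nra].
    replace (_ + _) with ((1 + c) ^ 3 * (N' c * (1 + c) - - 4 * N c)) by ring.
    apply Rmult_le_pos. apply pow_le; lra. destruct (B c ltac:(lra)). lra.
- destruct (MVT_cor2 (fun t => N t * (1 - t) ^ 4) (fun t => N' t * (1 - t) ^ 4 + N t * (- 4 * (1 - t) ^ 3)) 0 r)
    as [c [Ec Hc]]; [lra| |].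
  + intros c Hc. apply is_derive_Reals.
    apply (is_derive_mult (K := R_AbsRing) N (fun t => (1 - t) ^ 4) c (N' c) (- 4 * (1 - c) ^ 3)).
    * apply is_derive_ray. lra.
    * auto_derive; auto. simpl. ring.
    * exact Rmult_comm.
  + rewrite ray_0 in Ec.
    assert (N' c * (1 - c) ^ 4 + N c * (- 4 * (1 - c) ^ 3) <= 0); [|nra].
    replace (_ + _) with (- ((1 - c) ^ 3 * (4 * N c - N' c * (1 - c)))) by ring.
    apply Ropp_le_cancel. rewrite Ropp_involutive, Ropp_0.
    apply Rmult_le_pos. apply pow_le; lra. destruct (B c ltac:(lra)). lra.
Qed.

End Ray.

Lemma growth (q : quat) : in_ball q ->
  / (1 + qnorm q) ^ 2 <= qnorm (H q) /\ qnorm (H q) <= / (1 - qnorm q) ^ 2.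
Proof.
intros Hq. red in Hq. assert (H0 := qnorm_ge_0 (H q)).
destruct (Classical_Prop.classic (q = 0%H)) as [E|E].
- unfold H. rewrite E, power_sum_0, Ha0, qnorm_0, qnorm_qreal, Rabs_R1 by assumption. lra.
- assert (Pq := qnorm_gt_0 q E).
  destruct (exists_rot q) as [l [z [Hl [Eq Ez]]]].
  assert (r0 : RtoC (qnorm q) <> 0) by (intros F; injection F; lra).
  (* The unit direction for which [q] is the point at parameter |q| of the ray. *)
  set (w := (z / qnorm q)%C).
  assert (Hw : Cmod w = 1).
  { unfold w. rewrite Cmod_div, Ez, Cmod_R, Rabs_pos_eq by (assumption || lra). field. lra. }
  assert (Ew : rot l (qnorm q * w) = q).
  { rewrite Eq at 2. f_equal. unfold w. field. assumption. }
  destruct (ray_growth l w Hl Hw (qnorm q) ltac:(lra)) as [G1 G2].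
  rewrite Ew, <- qnorm_sq in G1, G2.
  assert (P1 : 0 < (1 + qnorm q) ^ 2) by nra. assert (P2 : 0 < (1 - qnorm q) ^ 2) by nra.
  replace (qnorm (H q) ^ 2 * (1 + qnorm q) ^ 4) with ((qnorm (H q) * (1 + qnorm q) ^ 2) ^ 2) in G1 by ring.
  replace (qnorm (H q) ^ 2 * (1 - qnorm q) ^ 4) with ((qnorm (H q) * (1 - qnorm q) ^ 2) ^ 2) in G2 by ring.
  split.
  + apply Rmult_le_reg_r with ((1 + qnorm q) ^ 2); [assumption|]. rewrite Rinv_l by lra.
    apply le_of_sq_le. apply Rmult_le_pos; lra. lra.
  + apply Rmult_le_reg_r with ((1 - qnorm q) ^ 2); [assumption|]. rewrite Rinv_l by lra.
    apply le_of_sq_le; lra.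
Qed.

(** Only triangle inequalities: |P| <= |P - H| + |H| and its mirror image, with |P + H| <= |P| + |H|
    on the right of the disc condition. *)
Lemma deriv_ratio (q : quat) : in_ball q ->
  (1 - qnorm q) * qnorm (H q) <= (1 + qnorm q) * qnorm (P q) /\
  (1 - qnorm q) * qnorm (P q) <= (1 + qnorm q) * qnorm (H q).
Proof.
intros Hq. assert (D := Hdisc q Hq). assert (r0 := qnorm_ge_0 q).
assert (T1 := qnorm_triangle (P q) (H q)).
assert (T2 : qnorm (P q) <= qnorm (P q - H q)%H + qnorm (H q)).
{ replace (P q) with (P q - H q + H q)%H at 1 by apply qsub_add. apply qnorm_triangle. }
assert (T3 : qnorm (H q) <= qnorm (P q - H q)%H + qnorm (P q)).
{ replace (H q) with (qopp (P q - H q) + P q)%H at 1 by apply qopp_sub_add.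
  eapply Rle_trans; [apply qnorm_triangle|]. rewrite qnorm_opp. lra. }
split; nra.
Qed.

End Growth.

(** * Bounds for starlike functions *)

Lemma qmul_conj (q : quat) : (q * qconj q)%H = qreal (qnorm q ^ 2).
Proof. rewrite qnorm_sq. unfold qsq. qring. Qed.

Lemma qnorm_conj (q : quat) : qnorm (qconj q) = qnorm q.
Proof. unfold qnorm. f_equal. qdestruct. qunfold. ring. Qed.

Lemma qsub_eq_add_eq_0 (p q : quat) : (p - q = 0 -> p + q = 0 -> q = 0)%H.
Proof.
intros H1 H2. replace q with (qreal (1 / 2) * (p + q - (p - q)))%H.
- rewrite H1, H2. qring.
- qdestruct. qcompute. qsplit; field.
Qed.

Lemma qpow_add (q : quat) (m n : nat) : qpow q (m + n) = (qpow q m * qpow q n)%H.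
Proof. induction m; simpl. now rewrite qmul1l. now rewrite IHm, qmulA. Qed.

Lemma qsum_ext (c d : nat -> quat) (n : nat) : (forall k, c k = d k) -> qsum c n = qsum d n.
Proof. intros E. induction n; simpl; now rewrite ?IHn, !E. Qed.

Lemma qnorm_rec (x : R) (p q : quat) : x < 1 -> p = (q + qreal x * p)%H -> qnorm p = qnorm q / (1 - x).
Proof.
intros Hx E. assert (F : (qreal (1 - x) * p = q)%H).
{ transitivity (p - qreal x * p)%H; [qring|]. rewrite E at 1. qring. }
rewrite <- F, qnorm_mul, qnorm_qreal, Rabs_pos_eq by lra. field. lra.
Qed.

(* [s = sum q^n u^n] is the regular inverse of [1 - q u], and [1 - 2 Re(u) q + q^2] its symmetrization. *)
Lemma symmetrization_mul_geom (u q s : quat) : (u * qconj u = 1)%H -> s = (q * (s * u) + 1)%H ->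
  ((1 - qreal (2 * qre u) * q + q * q) * s = 1 - q * qconj u)%H.
Proof.
intros Hu E. set (a := (q * s)%H).
assert (Eu : (a * u = s - 1)%H) by (unfold a; rewrite E at 2; rewrite <- qmulA, qaddC; symmetry; apply qadd_sub).
assert (Ea : a = ((s - 1) * qconj u)%H) by now rewrite <- Eu, <- qmulA, Hu, qmul1r.
assert (Eq : (q * a = a * qconj u - q * qconj u)%H).
{ rewrite Ea at 1. rewrite qmulA, qmul_sub_l, qmul1r, qmul_sub_r. reflexivity. }
transitivity (s - qreal (2 * qre u) * a + q * a)%H.
{ rewrite qmul_add_r, qmul_sub_r, qmul1l, <- !qmulA. reflexivity. }
rewrite qreal_trace_mul, Eu, Eq. generalize (a * qconj u)%H, (q * qconj u)%H. qring.
Qed.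

Lemma in_ball_0 : in_ball 0%H.
Proof. red. rewrite qnorm_0. lra. Qed.

(** The bounds on [p], the norm of the derivative, are the products of the growth bounds with the
    ratio bounds. *)
Lemma bounds_of_growth (h p r : R) :
  / (1 + r) ^ 2 <= h -> h <= / (1 - r) ^ 2 ->
  (1 - r) * h <= (1 + r) * p -> (1 - r) * p <= (1 + r) * h -> 0 < h -> 0 <= r -> r < 1 ->
  (r / (1 + r) ^ 2 <= r * h /\ r * h <= r / (1 - r) ^ 2) /\
  ((1 - r) / (1 + r) ^ 3 <= p /\ p <= (1 + r) / (1 - r) ^ 3) /\
  ((1 - r) / (1 + r) <= p / h /\ p / h <= (1 + r) / (1 - r)).
Proof.
intros G1 G2 D1 D2 h0 r0 r1.
assert (p0 : 0 < 1 + r) by lra. assert (m0 : 0 < 1 - r) by lra.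
assert (p2 := pow_lt _ 2 p0). assert (m2 := pow_lt _ 2 m0).
assert (G1' : 1 <= h * (1 + r) ^ 2).
{ apply Rmult_le_compat_r with (r := (1 + r) ^ 2) in G1; [|lra]. rewrite Rinv_l in G1; lra. }
assert (G2' : h * (1 - r) ^ 2 <= 1).
{ apply Rmult_le_compat_r with (r := (1 - r) ^ 2) in G2; [|lra]. rewrite Rinv_l in G2; lra. }
split; [|split]; split.
- apply <- Rle_div_l; [|lra]. rewrite Rmult_assoc. nra.
- apply -> Rle_div_r; [|lra]. rewrite Rmult_assoc. nra.
- apply <- Rle_div_l; [|now apply pow_lt].
  replace (p * (1 + r) ^ 3) with ((1 + r) * p * (1 + r) ^ 2) by ring.
  apply Rle_trans with ((1 - r) * h * (1 + r) ^ 2); [nra|]. apply Rmult_le_compat_r; lra.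
- apply -> Rle_div_r; [|now apply pow_lt].
  replace (p * (1 - r) ^ 3) with ((1 - r) * p * (1 - r) ^ 2) by ring.
  apply Rle_trans with ((1 + r) * h * (1 - r) ^ 2); [|nra]. apply Rmult_le_compat_r; lra.
- apply <- Rle_div_l; [|lra]. unfold Rdiv. rewrite Rmult_assoc, (Rmult_comm (/ h)), <- Rmult_assoc.
  apply -> Rle_div_r; lra.
- apply -> Rle_div_r; [|lra]. unfold Rdiv. rewrite Rmult_assoc, (Rmult_comm (/ h)), <- Rmult_assoc.
  apply <- Rle_div_l; lra.
Qed.

Section Starlike.

Variables (f : quat -> quat) (a : nat -> quat).
Hypothesis Hf : expands f a.
Hypothesis Ha0 : a O = 0%H.
Hypothesis Ha1 : a 1%nat = 1%H.

Let b (n : nat) : quat := a (S n).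
Let H (q : quat) : quat := power_sum b q.
Let P (q : quat) : quat := (q * power_sum (qdcoef b) q + H q)%H.

Lemma qconv_tail : qconv b.
Proof. apply qconv_S. eapply expands_conv, Hf. Qed.

Lemma expands_factor (q : quat) : in_ball q -> f q = (q * H q)%H.
Proof.
intros Hq. rewrite (expands_eq f a q Hf Hq).
rewrite power_sum_S; [|eapply expands_conv, Hf|apply qconv_tail|assumption].
rewrite Ha0. apply qadd_0_r.
Qed.

(** The product rule for q H read off the coefficients: (n + 1) b_n = n b_n + b_n, where the n b_n,
    zero at n = 0, are the coefficients of q H'. *)
Lemma slice_derivative_factor (q : quat) : in_ball q -> slice_derivative f q = P q.
Proof.
intros Hq. assert (Hb := qconv_tail). assert (Hd := qconv_qdcoef b Hb).
rewrite (slice_derivative_expands f a q Hf Hq).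
set (c := fun n => (qreal (INR n) * b n)%H).
assert (Ec : forall n, c (S n) = qdcoef b n) by reflexivity.
assert (Hc : qconv c).
{ apply (conv_disc_le _ (fun n => qnorm (qdcoef a n))); [|apply qconv_qdcoef; eapply expands_conv, Hf].
  intros n. split. apply qnorm_ge_0. unfold c, qdcoef, b.
  rewrite !qnorm_mul, !qnorm_qreal, !Rabs_pos_eq by apply pos_INR.
  apply Rmult_le_compat_r. apply qnorm_ge_0. rewrite S_INR. lra. }
rewrite (power_sum_ext (qdcoef a) (fun n => c n + b n)%H).
2:{ intros n. unfold qdcoef, c, b. rewrite S_INR, qreal_add_mul. now rewrite qmul1l. }
rewrite power_sum_plus by assumption. unfold P, H. f_equal.
rewrite power_sum_S; [|assumption|exact Hd|assumption].
change (fun n => c (S n)) with (qdcoef b).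
replace (c O) with 0%H by (unfold c; simpl; now rewrite qmul0l).
apply qadd_0_r.
Qed.

Lemma disc_iff (q : quat) : in_ball q -> q <> 0%H -> f q <> 0%H ->
  (0 < qre (log_quotient f q) <-> qnorm (P q - H q)%H < qnorm (P q + H q)%H).
Proof.
intros Hq Hq0 Hfq. unfold log_quotient.
destruct (excluded_middle_informative (q = 0%H)) as [E|_]; [contradiction|].
rewrite slice_derivative_factor, expands_factor by assumption.
apply log_quotient_pos_iff; [assumption|].
intros E. apply Hfq. rewrite expands_factor, E by assumption. apply qmul0r.
Qed.

Hypothesis Hzero : forall q, in_ball q -> f q = 0%H -> q = 0%H.
Hypothesis Hpos : forall q, in_ball q -> 0 < qre (log_quotient f q).

Lemma tail_neq_0 (q : quat) : in_ball q -> H q <> 0%H.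
Proof.
intros Hq E. assert (Eq : q = 0%H).
{ apply Hzero; [assumption|]. rewrite expands_factor, E by assumption. apply qmul0r. }
subst q. unfold H in E. rewrite (power_sum_0 b qconv_tail) in E. unfold b in E. rewrite Ha1 in E.
injection E. lra.
Qed.

(** At q = 0 the value of [log_quotient] is a convention and carries no information on P and H, so
    this case is computed: P = H = 1. *)
Lemma disc_strict (q : quat) : in_ball q -> qnorm (P q - H q)%H < qnorm (P q + H q)%H.
Proof.
intros Hq. destruct (Classical_Prop.classic (q = 0%H)) as [E|E].
- assert (E0 : H 0%H = 1%H) by (rewrite <- Ha1; exact (power_sum_0 b qconv_tail)).
  subst q. unfold P. rewrite E0, qmul0l.
  replace (0 + 1 - 1)%H with (qreal 0) by (clear; qring).
  replace (0 + 1 + 1)%H with (qreal 2) by (clear; qunfold; qsplit; lra).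
  rewrite !qnorm_qreal, Rabs_R0, Rabs_pos_eq; lra.
- apply disc_iff; try assumption; [|now apply Hpos]. intros F. now apply E, Hzero.
Qed.

(** [qschwarz] compares the series of P + H, with coefficients [g], and that of H', with
    coefficients [qdcoef b], where P - H = q H'. *)
Lemma disc_schwarz (q : quat) : in_ball q -> qnorm (P q - H q)%H <= qnorm q * qnorm (P q + H q)%H.
Proof.
assert (Hb := qconv_tail). assert (Hd := qconv_qdcoef b Hb).
set (g := fun n => (qdcoef a n + b n)%H).
assert (Hg : qconv g).
{ apply qconv_plus; [|assumption]. apply qconv_qdcoef. eapply expands_conv, Hf. }
assert (Eg : forall q, in_ball q -> power_sum g q = (P q + H q)%H).
{ intros p Hp. unfold g. rewrite power_sum_plus; try assumption.
  - f_equal. rewrite <- slice_derivative_factor by assumption. symmetry. now apply slice_derivative_expands.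
  - apply qconv_qdcoef. eapply expands_conv, Hf. }
assert (Ed : forall q, (P q - H q)%H = (q * power_sum (qdcoef b) q)%H).
{ intros p. unfold P. rewrite qaddC. apply qadd_sub. }
intros Hq. rewrite Ed, qnorm_mul, <- Eg by assumption.
apply Rmult_le_compat_l; [apply qnorm_ge_0|].
apply qschwarz; try assumption.
intros p Hp. rewrite <- Ed, Eg by assumption. now apply disc_strict.
Qed.

Lemma starlike_bounds (q : quat) : in_ball q ->
  (qnorm q / (1 + qnorm q) ^ 2 <= qnorm (f q) /\ qnorm (f q) <= qnorm q / (1 - qnorm q) ^ 2) /\
  ((1 - qnorm q) / (1 + qnorm q) ^ 3 <= qnorm (slice_derivative f q) /\
   qnorm (slice_derivative f q) <= (1 + qnorm q) / (1 - qnorm q) ^ 3) /\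
  ((1 - qnorm q) / (1 + qnorm q) <= abs_quotient f q /\
   abs_quotient f q <= (1 + qnorm q) / (1 - qnorm q)).
Proof.
intros Hq.
destruct (growth b qconv_tail Ha1 tail_neq_0 disc_schwarz q Hq) as [G1 G2].
destruct (deriv_ratio b disc_schwarz q Hq) as [D1 D2].
fold (H q) in *. fold (P q) in *.
assert (h0 := qnorm_gt_0 _ (tail_neq_0 q Hq)). assert (r0 := qnorm_ge_0 q). red in Hq.
(* The factor |q| cancels off 0, and at 0 the limit value 1 agrees because P and H coincide
   there. *)
assert (Q : abs_quotient f q = qnorm (P q) / qnorm (H q)).
{ unfold abs_quotient. destruct (excluded_middle_informative (q = 0%H)) as [E|E].
  - subst q. unfold P. rewrite qmul0l.
    rewrite qadd_0_l. field. lra.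
  - rewrite slice_derivative_factor, expands_factor, !qnorm_mul by assumption.
    assert (Pq := qnorm_gt_0 q E). field. lra. }
rewrite Q, slice_derivative_factor, expands_factor, qnorm_mul by assumption.
now apply bounds_of_growth.
Qed.

End Starlike.

Lemma slice_starlike_coeffs (f : quat -> quat) : slice_starlike f ->
  exists a, expands f a /\ a O = 0%H /\ a 1%nat = 1%H.
Proof.
intros [[Hr [Hz Hd]] _]. destruct (slice_regular_expands f Hr) as [a Ha].
assert (Hc := expands_conv f a Ha).
exists a. split; [assumption|split].
- rewrite <- (power_sum_0 a Hc), <- (expands_eq f a) by (assumption || apply in_ball_0).
  now apply Hz; [apply in_ball_0|].
- rewrite (slice_derivative_expands f a) in Hd by (assumption || apply in_ball_0).
  rewrite (power_sum_0 _ (qconv_qdcoef a Hc)) in Hd. unfold qdcoef in Hd.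
  rewrite <- Hd. simpl. now rewrite qmul1l.
Qed.

Lemma qpow_comm (p q : quat) (n : nat) : (p * q = q * p)%H -> (p * qpow q n = qpow q n * p)%H.
Proof.
intros E. induction n; simpl.
- now rewrite qmul1l, qmul1r.
- now rewrite qmulA, E, <- qmulA, IHn, qmulA.
Qed.

Lemma qsum_0 (c : nat -> quat) (n : nat) : (forall k, (k <= n)%nat -> c k = 0%H) -> qsum c n = 0%H.
Proof.
intros Hc. induction n; simpl. now apply Hc.
rewrite IHn, Hc by (intros; try apply Hc; lia). qring.
Qed.

Lemma symm_coeffs_eq (u q : quat) : (u * qconj u = 1)%H ->
  (1 * qconj 1 + q * (1 * qconj (qopp u) + qopp u * qconj 1) + q * (q * (1 * qconj 0 + qopp u * qconj (qopp u) + 0 * qconj 1))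
    = 1 - qreal (2 * qre u) * q + q * q)%H.
Proof.
intros E.
replace (1 * qconj 0 + qopp u * qconj (qopp u) + 0 * qconj 1)%H with (u * qconj u)%H by qring.
rewrite E, qmul1r, qreal_trace_mul. f_equal. unfold qsub. f_equal; qring.
Qed.

(** * The Koebe functions *)

Section Koebe.

Variable u : quat.
Hypothesis Hu : in_sphere u.

Definition upow (alpha : nat -> R) (n : nat) : quat := (qreal (alpha n) * qpow u n)%H.

(** The bound (n + 1)(n + 2) is the coefficient in the second derivative of the geometric series; it
    covers every sequence of weights introduced below, as |u^n| = 1. *)
Lemma qconv_upow (alpha : nat -> R) :
  (forall n, Rabs (alpha n) <= INR (S n) * INR (S (S n))) -> qconv (upow alpha).
Proof.
intros Ha. apply (conv_disc_le _ (fun n => PS_derive (PS_derive (fun _ => 1)) n)).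
- intros n. split. apply qnorm_ge_0.
  unfold upow. rewrite qnorm_mul, qnorm_qreal, qnorm_qpow, Hu, pow1.
  unfold PS_derive. rewrite !Rmult_1_r. apply Ha.
- assert (H1 : conv_disc (fun _ => 1)).
  { intros r Hr. apply (ex_series_ext (fun n => r ^ n)). intros; as_R; ring.
    apply ex_series_geom. rewrite Rabs_pos_eq; lra. }
  apply conv_disc_derive.
  + intros n. unfold PS_derive. rewrite Rmult_1_r. apply pos_INR.
  + apply conv_disc_derive; [|assumption]. intros; lra.
Qed.

(** The power u^(n + 1) is u^n followed by [u], so one factor [u] leaves the sum on the right while
    one factor [q] leaves it on the left. *)
Lemma upow_shift (alpha beta : nat -> R) (q : quat) : in_ball q -> qconv (upow alpha) -> qconv (upow beta) ->
  (forall n, alpha (S n) = beta n) ->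
  power_sum (upow alpha) q = (q * (power_sum (upow beta) q * u) + qreal (alpha O))%H.
Proof.
intros Hq Ha Hb E. rewrite power_sum_S; try assumption.
2:{ now apply qconv_S. }
f_equal.
- f_equal. apply qSeries_unique.
  apply (qseries_ext (fun n => qpow q n * upow beta n * u)%H).
  + intros n. rewrite <- qmulA. f_equal. unfold upow. rewrite E. simpl.
    rewrite <- qmulA. f_equal. symmetry. now apply qpow_comm.
  + apply qseries_mul_r. now apply power_sum_correct.
- unfold upow. simpl. apply qmul1r.
Qed.

(** [one] belongs to the regular inverse of 1 - q u, [lin] to the regular square of that inverse,
    [sq] to the derivative of the Koebe function. [lo] and its shift [hi] only link [sq] to itself
    in a recursion. *)
Let one (n : nat) : R := 1.
Let lin (n : nat) : R := INR (S n).
Let sq (n : nat) : R := INR (S n) * INR (S n).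
Let lo (n : nat) : R := INR n * INR (S n).
Let hi (n : nat) : R := INR (S n) * INR (S (S n)).

Lemma upow_bounds : qconv (upow one) /\ qconv (upow INR) /\ qconv (upow lin) /\ qconv (upow sq) /\
  qconv (upow lo) /\ qconv (upow hi).
Proof.
unfold one, lin, sq, lo, hi.
repeat split; apply qconv_upow; intros n; assert (P := pos_INR n); rewrite !S_INR, Rabs_pos_eq; nra.
Qed.

Lemma upow_plus (alpha beta gamma : nat -> R) (q : quat) : in_ball q ->
  qconv (upow alpha) -> qconv (upow beta) -> (forall n, gamma n = alpha n + beta n) ->
  power_sum (upow gamma) q = (power_sum (upow alpha) q + power_sum (upow beta) q)%H.
Proof.
intros Hq Ha Hb E. rewrite <- power_sum_plus by assumption. apply power_sum_ext.
intros n. unfold upow. rewrite E. now rewrite qreal_add_mul.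
Qed.

Let S0 (q : quat) := power_sum (upow one) q.
Let K1 (q : quat) := power_sum (upow lin) q.
Let K2 (q : quat) := power_sum (upow sq) q.

Lemma S0_rec (q : quat) : in_ball q -> S0 q = (q * (S0 q * u) + 1)%H.
Proof.
intros Hq. destruct upow_bounds as [H1 _]. now apply (upow_shift one one).
Qed.

(** Split n + 1 as 1 + n: the part n starts with 0, and its shift is n + 1 again. *)
Lemma K1_rec (q : quat) : in_ball q -> K1 q = (S0 q + q * (K1 q * u))%H.
Proof.
intros Hq. destruct upow_bounds as [H1 [H2 [H3 _]]]. unfold K1 at 1.
rewrite (upow_plus one INR lin q Hq H1 H2) by (intros; unfold lin, one; rewrite S_INR; ring).
unfold S0. f_equal. rewrite (upow_shift INR lin q Hq H2 H3) by reflexivity.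
fold (K1 q). simpl. apply qadd_0_r.
Qed.

(* Since [koebe u q = q * K1 q] has slice derivative [K2], this is the disc condition with ratio [q]. *)
Lemma K2_rec (q : quat) : in_ball q -> K2 q = (K1 q + q * ((K2 q + K1 q) * u))%H.
Proof.
intros Hq. destruct upow_bounds as [H1 [H2 [H3 [H4 [H5 H6]]]]]. unfold K2 at 1.
(* (n + 1)^2 = (n + 1) + n (n + 1), and the shift of n (n + 1) is (n + 1)(n + 2) = (n + 1)^2 + (n +
   1), which closes the recursion. *)
rewrite (upow_plus lin lo sq q Hq H3 H5) by (intros; unfold lin, lo, sq; rewrite !S_INR; ring).
unfold K1 at 1. f_equal. rewrite (upow_shift lo hi q Hq H5 H6) by reflexivity.
rewrite (upow_plus sq lin hi q Hq H4 H3) by (intros; unfold lin, hi, sq; rewrite !S_INR; ring).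
replace (lo 0) with 0 by (unfold lo; simpl; ring). apply qadd_0_r.
Qed.

Lemma S0_neq_0 (q : quat) : in_ball q -> S0 q <> 0%H.
Proof.
intros Hq E. assert (H := S0_rec q Hq). rewrite E, qmul0l, qmul0r, qadd_0_l in H.
injection H. lra.
Qed.

Lemma K1_neq_0 (q : quat) : in_ball q -> K1 q <> 0%H.
Proof.
intros Hq E. assert (H := K1_rec q Hq). rewrite E, qmul0l, qmul0r, qadd_0_r in H.
now apply (S0_neq_0 q Hq).
Qed.

Definition koebe_den (n : nat) : quat := match n with O => 1%H | 1%nat => qopp u | _ => 0%H end.

(** Three terms cover all needs: 1 - q u and its regular conjugate have degree 1, their product
    degree 2. *)
Lemma finite_series (c : nat -> quat) : (forall n, (3 <= n)%nat -> c n = 0%H) ->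
  is_series c (c 0%nat + c 1%nat + c 2%nat)%H.
Proof.
intros Hc.
assert (Z : is_series (fun _ : nat => 0%H) 0%H).
{ apply qseries_components.
  assert (Z : is_series (fun _ : nat => 0) 0).
  { apply (filterlim_ext (fun _ : nat => 0)).
    - intros n. symmetry. rewrite sum_n_const. apply Rmult_0_r.
    - apply filterlim_const. }
  repeat split; exact Z. }
assert (H3 : is_series (fun n => c (S (S (S n)))) 0%H).
{ apply (qseries_ext (fun _ => 0%H)); [|exact Z]. intros n. symmetry. apply Hc. lia. }
apply (qseries_decr_1 (fun n => c (S (S n)))) in H3.
apply (qseries_decr_1 (fun n => c (S n))) in H3.
apply (qseries_decr_1 c) in H3.
replace (c 0%nat + c 1%nat + c 2%nat)%H with (0 + c 2%nat + c 1%nat + c 0%nat)%H; [exact H3|].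
rewrite qadd_0_l, <- (qaddC (c 0%nat)), <- (qaddC (c 1%nat)). apply qaddA.
Qed.

Lemma power_sum_quadratic (c : nat -> quat) (q : quat) : (forall n, (3 <= n)%nat -> c n = 0%H) ->
  is_series (fun n => qpow q n * c n)%H (c 0%nat + q * c 1%nat + q * (q * c 2%nat))%H.
Proof.
intros Hc.
replace (c 0%nat + q * c 1%nat + q * (q * c 2%nat))%H with
  (qpow q 0 * c 0%nat + qpow q 1 * c 1%nat + qpow q 2 * c 2%nat)%H.
- apply (finite_series (fun n => qpow q n * c n)%H). intros n Hn. rewrite Hc by assumption. apply qmul0r.
- simpl. now rewrite !qmul1r, qmul1l, qmulA.
Qed.

Lemma expands_koebe_den : expands (fun p => 1 - p * u)%H koebe_den.
Proof.
intros q _. replace (1 - q * u)%H with (koebe_den 0 + q * koebe_den 1 + q * (q * koebe_den 2))%H.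
- apply power_sum_quadratic. intros [|[|n]] Hn; try lia. reflexivity.
- simpl. rewrite !qmul0r, qadd_0_r. unfold qsub. now rewrite qmul_opp_r.
Qed.

Lemma expands_koebe_den_conj :
  expands (regular_conj (fun p => 1 - p * u)%H) (fun n => qconj (koebe_den n)) /\
  forall q, regular_conj (fun p => 1 - p * u)%H q = (1 - q * qconj u)%H.
Proof.
assert (E : forall q, is_series (fun n => qpow q n * qconj (koebe_den n))%H (1 - q * qconj u)%H).
{ intros q. replace (1 - q * qconj u)%H with
   (qconj (koebe_den 0) + q * qconj (koebe_den 1) + q * (q * qconj (koebe_den 2)))%H.
  - apply (power_sum_quadratic (fun n => qconj (koebe_den n))). intros [|[|n]] Hn; try lia.
    simpl. apply qconj_0.
  - simpl. rewrite qconj_0, !qmul0r, qadd_0_r. unfold qsub. rewrite qconj_1, qconj_opp. now rewrite qmul_opp_r. }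
assert (F : forall q, regular_conj (fun p => 1 - p * u)%H q = (1 - q * qconj u)%H).
{ intros q. unfold regular_conj.
  rewrite (power_sum_ext _ (fun n => qconj (koebe_den n))).
  - now apply qSeries_unique.
  - intros n. f_equal. apply coeffs_unique, expands_koebe_den. }
split; [|exact F]. intros q _. rewrite F. apply E.
Qed.

Lemma symmetrization_koebe_den (q : quat) :
  symmetrization (fun p => 1 - p * u)%H q = (1 - qreal (2 * qre u) * q + q * q)%H.
Proof.
unfold symmetrization, regular_mul.
set (c := fun n => qsum (fun k => koebe_den k * qconj (koebe_den (n - k)))%H n).
rewrite (power_sum_ext _ c).
2:{ intros n. unfold c.
    rewrite <- (qsum_ext (fun k => koebe_den k * qconj (koebe_den (n - k)))%H). reflexivity.
    intros k. f_equal. symmetry. apply coeffs_unique, expands_koebe_den.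
    symmetry. apply (coeffs_unique _ (fun n => qconj (koebe_den n))). apply expands_koebe_den_conj. }
assert (H := power_sum_quadratic c q). apply qSeries_unique in H.
- unfold power_sum. rewrite H. unfold c. simpl.
  assert (E : (u * qconj u = 1)%H) by (rewrite qmul_conj, Hu; f_equal; ring).
  now apply symm_coeffs_eq.
- intros n Hn. unfold c. apply qsum_0. intros k Hk.
  (* Beyond degree 2 one of the two factors has index at least 2 and vanishes: the index n - k when
     k <= 1, the index k otherwise. *)
  destruct k as [|[|k]].
  + destruct n as [|[|n]]; try lia. simpl. rewrite qconj_0. apply qmul0r.
  + destruct n as [|[|[|n]]]; try lia. simpl. rewrite qconj_0. apply qmul0r.
  + simpl. apply qmul0l.
Qed.

(** The symmetrization times the geometric sum [S0] is the regular conjugate 1 - q conj(u); as soon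
    as the symmetrization is nonzero, dividing by it gives [S0]. *)
Lemma expands_regular_inv : expands (regular_inv (fun p => 1 - p * u)%H) (qpow u).
Proof.
intros q Hq.
assert (HS : is_series (fun n => qpow q n * qpow u n)%H (S0 q)).
{ apply (qseries_ext (fun n => qpow q n * upow one n)%H).
  - intros n. unfold upow, one. f_equal. apply qmul1l.
  - apply power_sum_correct; [|assumption]. apply upow_bounds. }
replace (regular_inv (fun p => 1 - p * u)%H q) with (S0 q); [exact HS|].
unfold regular_inv. rewrite (proj2 expands_koebe_den_conj q), symmetrization_koebe_den.
set (sigma := (1 - qreal (2 * qre u) * q + q * q)%H).
assert (E : (sigma * S0 q = 1 - q * qconj u)%H).
{ apply symmetrization_mul_geom.
  - rewrite qmul_conj, Hu. f_equal. ring.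
  - now apply S0_rec. }
(* A zero of [sigma] would force q conj(u) = 1, impossible for |q| < 1 = |u|. *)
assert (Hs : sigma <> 0%H).
{ intros F. rewrite F, qmul0l in E.
  assert (N : qnorm (q * qconj u)%H = 1).
  { replace (q * qconj u)%H with (1 - (1 - q * qconj u))%H by apply qsub_sub. rewrite <- E.
    rewrite qsub_0_r, qnorm_qreal. apply Rabs_R1. }
  rewrite qnorm_mul, qnorm_conj, Hu in N. red in Hq. lra. }
rewrite <- E, qmulA, qinv_l by assumption. symmetry. apply qmul1l.
Qed.

Definition koebe_coeffs (n : nat) : quat := match n with O => 0%H | S n => upow lin n end.

Lemma koebe_eq (q : quat) : koebe u q = (q * K1 q)%H.
Proof.
unfold koebe. cbv zeta. f_equal. unfold regular_mul, K1. apply power_sum_ext. intros n.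
assert (E : forall k, coeffs (regular_inv (fun p => 1 - p * u)%H) k = qpow u k)
  by (apply coeffs_unique, expands_regular_inv).
rewrite (qsum_ext _ (fun k => qpow u k * qpow u (n - k))%H) by (intros; now rewrite !E).
unfold upow, lin.
(* The induction is on the upper limit m with n fixed; an induction on n would change every factor
   u^(n - k). *)
assert (G : forall m, (m <= n)%nat -> qsum (fun k => qpow u k * qpow u (n - k))%H m = (qreal (INR (S m)) * qpow u n)%H).
{ assert (T : forall k, (k <= n)%nat -> (qpow u k * qpow u (n - k) = qpow u n)%H).
  { intros k Hk. rewrite <- qpow_add. f_equal. lia. }
  intros m. induction m; intros Hm.
  - change (qpow u 0 * qpow u (n - 0) = qreal (INR 1) * qpow u n)%H. rewrite T by lia. symmetry. apply qmul1l.
  - change (qsum (fun k => qpow u k * qpow u (n - k)) m + qpow u (S m) * qpow u (n - S m) = qreal (INR (S (S m))) * qpow u n)%H.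
    rewrite IHm, T, (S_INR (S m)) by lia. rewrite qreal_add_mul. now rewrite qmul1l. }
apply G. lia.
Qed.

Lemma expands_koebe : expands (koebe u) koebe_coeffs.
Proof.
intros q Hq. rewrite koebe_eq.
replace (q * K1 q)%H with (q * K1 q + qpow q 0 * koebe_coeffs 0)%H.
- apply (qseries_decr_1 (fun n => qpow q n * koebe_coeffs n)%H).
  apply (qseries_ext (fun n => q * (qpow q n * upow lin n))%H).
  + intros n. simpl. apply qmulA.
  + apply qseries_mul_l, power_sum_correct; [|assumption]. apply upow_bounds.
- simpl. rewrite qmul0r. apply qadd_0_r.
Qed.

Lemma slice_derivative_koebe (q : quat) : in_ball q -> slice_derivative (koebe u) q = K2 q.
Proof.
intros Hq. rewrite (slice_derivative_expands _ _ q expands_koebe Hq).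
apply power_sum_ext. intros n. unfold qdcoef, koebe_coeffs, upow, sq, lin.
rewrite qmulA. f_equal. generalize (INR (S n)). intros x. apply qreal_mul.
Qed.

Lemma slice_starlike_koebe : slice_starlike (koebe u).
Proof.
split; [split; [|split]|].
- eapply expands_slice_regular, expands_koebe.
- intros q Hq. rewrite koebe_eq. split; intros E.
  + apply qmul_eq_0 in E. destruct E as [E|E]; [assumption|]. now apply K1_neq_0 in E.
  + subst q. apply qmul0l.
- rewrite slice_derivative_koebe by apply in_ball_0. unfold K2.
  rewrite power_sum_0 by apply upow_bounds. unfold upow, sq. simpl. rewrite Rmult_1_r. apply qmul1l.
- intros q Hq. unfold log_quotient.
  destruct (excluded_middle_informative (q = 0%H)) as [E|E]; [change (0 < 1); lra|].
  rewrite koebe_eq, slice_derivative_koebe by assumption.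
  apply log_quotient_pos_iff; [assumption|now apply K1_neq_0|].
  (* Hence |K2 - K1| = |q| |K2 + K1|, equality in the Schwarz bound; what remains is |q| < 1 and K2
     + K1 <> 0. *)
  assert (D : (K2 q - K1 q = q * ((K2 q + K1 q) * u))%H).
  { rewrite (K2_rec q Hq) at 1. apply qadd_sub. }
  rewrite D, !qnorm_mul, Hu. red in Hq.
  assert (N : 0 < qnorm (K2 q + K1 q)%H).
  (* If K2 + K1 = 0, then [D] gives K2 - K1 = 0 as well, so K1 = 0. *)
  { apply qnorm_gt_0. intros F. rewrite F, qmul0l, qmul0r in D. apply (K1_neq_0 q Hq).
    now apply (qsub_eq_add_eq_0 (K2 q)). }
  nra.
Qed.

Section Aligned.

Variables (q : quat) (x : R).
Hypothesis Hq : in_ball q.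
Hypothesis Hqu : (q * u)%H = qreal x.

Lemma aligned_abs : Rabs x = qnorm q.
Proof. rewrite <- qnorm_qreal, <- Hqu, qnorm_mul, Hu. ring. Qed.

Lemma aligned_comm : (u * q = q * u)%H.
Proof.
destruct (Classical_Prop.classic (q = 0%H)) as [E|E].
- now rewrite E, qmul0l, qmul0r.
- transitivity (qinv q * (q * u * q))%H.
  + now rewrite !qmulA, qinv_l, qmul1l.
  + rewrite Hqu. rewrite (qreal_comm x q), qmulA, qinv_l, qmul1l by assumption. reflexivity.
Qed.

(** [u] commutes with [q], hence with the whole sum F, so that q F u = (q u) F and the real number
    [x] comes out. *)
Lemma aligned_power_sum (alpha : nat -> R) : qconv (upow alpha) ->
  (q * (power_sum (upow alpha) q * u) = qreal x * power_sum (upow alpha) q)%H.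
Proof.
intros Ha. rewrite <- Hqu, <- qmulA. f_equal.
assert (H := power_sum_correct _ _ Ha Hq).
apply (qseries_unique (fun n => u * (qpow q n * upow alpha n))%H); [|now apply qseries_mul_l].
apply (qseries_ext (fun n => qpow q n * upow alpha n * u)%H); [|now apply qseries_mul_r].
intros n. unfold upow.
rewrite !qmulA, (qpow_comm u q n aligned_comm), <- !qmulA. f_equal.
rewrite (qmulA u), <- (qreal_comm (alpha n) u), <- qmulA. f_equal. symmetry. now apply qpow_comm.
Qed.

Lemma koebe_aligned :
  qnorm (koebe u q) = qnorm q / (1 - x) ^ 2 /\
  qnorm (slice_derivative (koebe u) q) = (1 + x) / (1 - x) ^ 3 /\
  (q <> 0%H -> abs_quotient (koebe u) q = (1 + x) / (1 - x)).
Proof.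
assert (Hx : Rabs x < 1) by (rewrite aligned_abs; exact Hq).
apply Rabs_def2 in Hx.
destruct upow_bounds as [H1 [H2 [H3 [H4 [H5 H6]]]]].
assert (A0 := aligned_power_sum one H1). assert (A1 := aligned_power_sum lin H3).
assert (A2 := aligned_power_sum sq H4). fold (S0 q) in A0. fold (K1 q) in A1. fold (K2 q) in A2.
(* The recursions have become scalar: (1 - x) S0 = 1, (1 - x) K1 = S0 and (1 - x) K2 = (1 + x)
   K1. *)
assert (E0 : qnorm (S0 q) = / (1 - x)).
{ assert (E := S0_rec q Hq). rewrite A0, qaddC in E.
  rewrite (qnorm_rec x _ _ (proj1 Hx) E), qnorm_qreal, Rabs_R1. field. lra. }
assert (E1 : qnorm (K1 q) = / (1 - x) ^ 2).
{ assert (E := K1_rec q Hq). rewrite A1 in E.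
  rewrite (qnorm_rec x _ _ (proj1 Hx) E), E0. field. lra. }
assert (E2 : qnorm (K2 q) = (1 + x) / (1 - x) ^ 3).
{ assert (E := K2_rec q Hq).
  rewrite qmul_add_r, qmul_add_l, A1, A2 in E.
  assert (F : K2 q = (qreal (1 + x) * K1 q + qreal x * K2 q)%H).
  { rewrite E at 1. rewrite qreal_add_mul, qmul1l, <- !qaddA. f_equal. apply qaddC. }
  rewrite (qnorm_rec x _ _ (proj1 Hx) F), qnorm_mul, qnorm_qreal, E1, Rabs_pos_eq by lra.
  field. lra. }
rewrite slice_derivative_koebe by assumption.
split; [|split].
- rewrite koebe_eq, qnorm_mul, E1. reflexivity.
- exact E2.
- intros Hq0. unfold abs_quotient.
  destruct (excluded_middle_informative (q = 0%H)) as [E|_]; [contradiction|].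
  rewrite koebe_eq, slice_derivative_koebe, !qnorm_mul, E1, E2 by assumption.
  assert (Pq := qnorm_gt_0 q Hq0). field. lra.
Qed.

End Aligned.

End Koebe.

(** The normalised conjugate conj(q)/|q| rotates [q] onto |q|; the sign [e] selects the end of the
    real axis. *)
Lemma exists_aligned (q : quat) (e : R) : q <> 0%H -> Rabs e = 1 ->
  exists u, in_sphere u /\ (q * u)%H = qreal (e * qnorm q).
Proof.
intros Hq He. assert (P := qnorm_gt_0 q Hq).
exists (qreal (e / qnorm q) * qconj q)%H. split.
- red. rewrite qnorm_mul, qnorm_qreal, qnorm_conj. unfold Rdiv.
  rewrite Rabs_mult, He, Rabs_pos_eq by now apply Rlt_le, Rinv_0_lt_compat. field. lra.
- rewrite qmulA, <- qreal_comm, <- qmulA, qmul_conj, qreal_mul. f_equal. field. lra.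
Qed.

Theorem theorem5p3 :
  (forall f : quat -> quat, slice_starlike f ->
   forall q : quat, in_ball q ->
     (qnorm q / (1 + qnorm q) ^ 2 <= qnorm (f q) /\
      qnorm (f q) <= qnorm q / (1 - qnorm q) ^ 2) /\
     ((1 - qnorm q) / (1 + qnorm q) ^ 3 <= qnorm (slice_derivative f q) /\
      qnorm (slice_derivative f q) <= (1 + qnorm q) / (1 - qnorm q) ^ 3) /\
     ((1 - qnorm q) / (1 + qnorm q) <= abs_quotient f q /\
      abs_quotient f q <= (1 + qnorm q) / (1 - qnorm q))) /\
  (forall q0 : quat, in_ball q0 -> q0 <> 0%H ->
     (exists u : quat, in_sphere u /\ slice_starlike (koebe u) /\
        qnorm q0 / (1 + qnorm q0) ^ 2 = qnorm (koebe u q0)) /\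
     (exists u : quat, in_sphere u /\ slice_starlike (koebe u) /\
        qnorm (koebe u q0) = qnorm q0 / (1 - qnorm q0) ^ 2) /\
     (exists u : quat, in_sphere u /\ slice_starlike (koebe u) /\
        (1 - qnorm q0) / (1 + qnorm q0) ^ 3
          = qnorm (slice_derivative (koebe u) q0)) /\
     (exists u : quat, in_sphere u /\ slice_starlike (koebe u) /\
        qnorm (slice_derivative (koebe u) q0)
          = (1 + qnorm q0) / (1 - qnorm q0) ^ 3) /\
     (exists u : quat, in_sphere u /\ slice_starlike (koebe u) /\
        (1 - qnorm q0) / (1 + qnorm q0) = abs_quotient (koebe u) q0) /\
     (exists u : quat, in_sphere u /\ slice_starlike (koebe u) /\
        abs_quotient (koebe u) q0 = (1 + qnorm q0) / (1 - qnorm q0))).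
Proof.
split.
- intros f Hf q Hq. destruct (slice_starlike_coeffs f Hf) as [a [Ha [Ha0 Ha1]]].
  destruct Hf as [[_ [Hz _]] Hp].
  apply (starlike_bounds f a Ha Ha0 Ha1); try assumption.
  intros p Hp'. now apply Hz.
- intros q Hq Hq0.
  (* [u] makes x = |q| and attains the three upper bounds; [v] makes x = - |q|, which exchanges 1 -
     x and 1 + x and attains the three lower ones. *)
  destruct (exists_aligned q 1 Hq0 Rabs_R1) as [u [Hu Eu]]. rewrite Rmult_1_l in Eu.
  destruct (exists_aligned q (-1) Hq0 ltac:(rewrite Rabs_left; lra)) as [v [Hv Ev]].
  replace (-1 * qnorm q) with (- qnorm q) in Ev by ring.
  destruct (koebe_aligned u Hu q _ Hq Eu) as [U1 [U2 U3]]. specialize (U3 Hq0).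
  destruct (koebe_aligned v Hv q _ Hq Ev) as [V1 [V2 V3]]. specialize (V3 Hq0).
  unfold Rminus in V1, V2, V3. rewrite !Ropp_involutive in V1, V2, V3.
  assert (Su := slice_starlike_koebe u Hu). assert (Sv := slice_starlike_koebe v Hv).
  repeat split; ((exists u; split; [exact Hu|split; [exact Su|assumption]]) ||
    (exists v; split; [exact Hv|split; [exact Sv|symmetry; assumption]])).
Qed.
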